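(* Let $G$ be a finite abelian group, $\Gamma=(H^2(G,\mathbb{T})\times G/2G)\rtimes\operatorname{Aut}(G)$, and let $\mathcal{C}$ be a C$^*$-generalized Haagerup category with $G$ having a solution $(\epsilon_h(g),\eta_g,A_g(h,k))$ of the polynomial equations (P1)–(P9) as its numerical data. Assume $A_g(h,k)\neq0$ for all $g,h,k\in G$. Then the outer automorphism group $\operatorname{Out}(\mathcal{C})$ of $\mathcal{C}$ is (isomorphic to) the stabilizer subgroup $\Gamma_0$ in $\Gamma$ of the gauge equivalence class of the solution $(\epsilon_h(g),\eta_g,A_g(h,k))$.
   Context: $\operatorname{Out}(\mathcal C)$ is the group of ($*$-preserving) monoidal auto-equivalences of $\mathcal C$ up to monoidal natural isomorphism, modulo the inner ones (conjugation $\alpha\otimes\cdot\otimes\alpha^{-1}$ by invertible objects). Generalized Haagerup categories. Let $G$ be a finite abelian group, written additively. A generalized Haagerup category with $G$ is a (strict) fusion category $\mathcal{C}$ over $\mathbb{C}$ whose group of isomorphism classes of invertible objects is identified with $G$ (representatives denoted $g$, with $0$ represented by $\mathbf 1$), with a self-dual non-invertible simple object $\rho$ such that the simple classes are exactly the distinct classes $[g]$, $[g\otimes\rho]$ ($g\in G$), with fusion rules $[g][h]=[g+h]$, $[g][\rho]=[\rho][-g]$, $[\rho]^2=[\mathbf 1]+\sum_{g\in G}[g\otimes\rho]$, and such that there are isomorphisms $v_{g,h}:g+h\to g\otimes h$ and $w_g:g\otimes\rho\to\rho\otimes(-g)$ with $(\mathrm{id}_g\otimes v_{h,k})v_{g,h+k}=(v_{g,h}\otimes\mathrm{id}_k)v_{g+h,k}$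 and $(w_g\otimes\mathrm{id}_{-h})(\mathrm{id}_g\otimes w_h)(v_{g,h}\otimes\mathrm{id}_\rho)w_{g+h}^{-1}=\mathrm{id}_\rho\otimes v_{-g,-h}$. Numerical data. Every C$^*$-fusion category embeds in $\operatorname{End}(M)$, $M$ the hyperfinite type III$_1$ factor (objects: unital endomorphisms; tensor product: composition; morphisms $(\sigma,\sigma')=\{T\in M: T\sigma(x)=\sigma'(x)T\ \forall x\in M\}$). Put $n=|G|$, $d=\frac{n+\sqrt{n^2+4}}2$, $G_2=\{g\in G:2g=0\}$, $\mathbb T=\{z\in\mathbb C:|z|=1\}$. A standard lifting of $\mathcal C\subset\operatorname{End}(M)$ is a pair $[\rho,\alpha]$ with $\rho\in\operatorname{End}(M)$ and an action $\alpha:G\to\operatorname{Aut}(M)$ such that the simple classes of $\mathcal C$ are $[\alpha_g]$, $[\alpha_g\rho]$, $\alpha_g\circ\rho=\rho\circ\alpha_{-g}$, and $\alpha|_{G_2}$ acts trivially on $(\rho,\rho^2)$; standard liftings always exist. Choose an isometry $S\in(\mathrm{id},\rho^2)$ and, for each $g$, an isometry $T_g\in(\alpha_g\rho,\rho^2)$ with $\sqrt d\,T_g^*\rho(S)=T_g$ (unique up to sign), normalized so that $\alpha_h(T_0)=T_{2h}$. The numerical data are defined by $\alpha_h(T_g)=\epsilon_h(g)T_{g+2h}$, $\sqrt d\,\alpha_g\rho(T_g)^*S=\eta_gT_g$, and $\alpha_g\rho(T_g)=\eta_gT_gSS^*+\frac{\overline{\eta_g}}{\sqrt d}ST_g^*+\sum_{h,k}A_g(h,k)T_{g+h}T_{g+h+k}T_{g+k}^*$.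 Polynomial equations. $\epsilon_h(g)\in\{1,-1\}$, $\eta_g\in\mathbb T$, $A_g(h,k)\in\mathbb C$ satisfy, for all elements of $G$: (P1) $\epsilon_{h+k}(g)=\epsilon_h(g)\epsilon_k(g+2h)$, $\epsilon_h(0)=1$; (P2) $\eta_{g+2h}=\eta_g$, $\eta_g^3=1$; (P3) $\sum_{h}A_g(h,0)=-\overline{\eta_g}/d$; (P4) $\sum_{h}A_g(h-g,k)\overline{A_{g'}(h-g',k)}=\delta_{g,g'}-\frac{\overline{\eta_g}\eta_{g'}}{d}\delta_{k,0}$; (P5) $A_{g+2h}(p,q)=\epsilon_h(g)\epsilon_h(g+p)\epsilon_h(g+q)\epsilon_h(g+p+q)A_g(p,q)$; (P6) $A_g(k,h)=\overline{A_g(h,k)}$; (P7) $A_g(h,k)=A_g(-k,h-k)\,\eta_g\,\epsilon_{-k}(g+h)\epsilon_{-k}(g+k)\epsilon_{-k}(g+h+k)=A_g(k-h,-h)\,\overline{\eta_g}\,\epsilon_{-h}(g+h)\epsilon_{-h}(g+k)\epsilon_{-h}(g+h+k)$; (P8) $A_g(h,k)=A_{g+h}(h,k)\eta_g\eta_{g+k}\overline{\eta_{g+h}\eta_{g+h+k}}\epsilon_h(g)\epsilon_h(g+k)=A_{g+k}(h,k)\overline{\eta_g\eta_{g+h}}\eta_{g+k}\eta_{g+h+k}\epsilon_k(g)\epsilon_k(g+h)$; (P9) $\sum_{l}A_g(x+y,l)A_{g-p+x}(-x,l+p)A_{g-q+x+y}(-y,l+q)=A_g(p+x,q+x+y)A_{g-p}(q+y,p+x+y)\,\eta_g\eta_{g+q+x}\eta_{g+p+q+y}\overline{\eta_{g+p}\eta_{g+x+y}\eta_{g+q+x+y}}\,\epsilon_p(g-p+x)\epsilon_{p+x}(g-p+q+y)\epsilon_q(g-q+x+y)\epsilon_{q+y}(g-q+x)-\frac{\delta_{x,0}\delta_{y,0}}{d}\eta_g\eta_{g+p}\eta_{g+q}$.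 Gauge equivalence: $(\epsilon,\eta,A)$ and $(\epsilon',\eta,A')$ are gauge equivalent if for some $\delta_g\in\{1,-1\}$ one has $\epsilon'_h(g)=\delta_g\delta_{g+2h}\epsilon_h(g)$ and $A'_g(h,k)=\delta_g\delta_{g+h}\delta_{g+k}\delta_{g+h+k}A_g(h,k)$. Action of $\Gamma$ on gauge equivalence classes. (a) $\theta\in\operatorname{Aut}(G)$ acts by relabelling: $\epsilon'_{\theta(h)}(\theta(g))=\epsilon_h(g)$, $\eta'_{\theta(g)}=\eta_g$, $A'_{\theta(g)}(\theta(h),\theta(k))=A_g(h,k)$. (b) Every class in $H^2(G,\mathbb T)$ has a representative $\omega$ with $\omega(g,0)=\omega(0,g)=\omega(g,-g)=1$ and $\omega(g,h)\omega(h,g)=\omega(g,h)\overline{\omega(-g,-h)}=1$; choose $\mu:G\to\{1,-1\}$ with $\mu(2g)=\omega(g,g)$; then $[\omega]$ sends $(\epsilon,\eta,A)$ to $(\epsilon',\eta,A')$ with $\epsilon'_h(g)=\epsilon_h(g)\mu(g)\mu(g+2h)\overline{\omega(h,g)\omega(g+h,h)}$, $A'_g(h,k)=A_g(h,k)\mu(g+k)\mu(g)\mu(g+h+k)\mu(g+h)\overline{\omega(g+k,h)\omega(h,g)}$. (c) For $p\in G$ choose a character $\chi\in\widehat G$ extending the character $z\mapsto\epsilon_z(p)$ of $G_2$, and square roots $\nu(g)$ of $\chi(g)$ with $\nu(p+2h)=\chi(h)\epsilon_h(p)\nu(p)$; then $p$ (replacing $\rho$ by $\alpha_p\rho$) sends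 $(\epsilon,\eta,A)$ to $\epsilon'_h(g)=\epsilon_h(p+g)\nu(p+g+2h)\overline{\nu(p+g)\chi(h)}$, $\eta'_g=\eta_{p+g}$, $A'_g(h,k)=A_{p+g}(h,k)\nu(p+g+h+k)\nu(p+g+h)\overline{\nu(p+g+k)\nu(p+g)\chi(h)}$; $2G$ acts trivially on gauge equivalence classes. *)

(* Defs.v *)
From HB Require Import structures.
From mathcomp Require Import all_boot all_order all_algebra.
From mathcomp Require Import perm.
From mathcomp Require Import boolp classical_sets reals.
From mathcomp Require Import complex ring.

Set Implicit Arguments.
Unset Strict Implicit.
Unset Printing Implicit Defensive.

Import Order.TTheory GRing.Theory Num.Theory.
Local Open Scope ring_scope.
Local Open Scope complex_scope.
Local Open Scope quotient_scope.

Record preGroup := PreGroup {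
  pg_car :> Type;
  pg_eq : pg_car -> pg_car -> Prop;
  pg_mul : pg_car -> pg_car -> pg_car;
  pg_one : pg_car;
  pg_refl : forall x, pg_eq x x;
  pg_sym : forall x y, pg_eq x y -> pg_eq y x;
  pg_trans : forall x y z, pg_eq x y -> pg_eq y z -> pg_eq x z;
  pg_mulC : forall x x' y y', pg_eq x x' -> pg_eq y y' ->
    pg_eq (pg_mul x y) (pg_mul x' y');
  pg_mulA : forall x y z,
    pg_eq (pg_mul x (pg_mul y z)) (pg_mul (pg_mul x y) z);
  pg_mul1 : forall x, pg_eq (pg_mul pg_one x) x;
  pg_mulr1 : forall x, pg_eq (pg_mul x pg_one) x;
  pg_inv : forall x, exists y, pg_eq (pg_mul x y) pg_one }.

Section QuotientGroup.
Variable P : preGroup.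

Definition pg_rel (x y : {classic P}) : bool := `[< pg_eq x y >].

Lemma pg_rel_refl : reflexive pg_rel.
Proof. by move=> x; apply/asboolP; apply: pg_refl. Qed.

Lemma pg_rel_sym : symmetric pg_rel.
Proof.
by move=> x y; apply/idP/idP => /asboolP h; apply/asboolP; apply: pg_sym.
Qed.

Lemma pg_rel_trans : transitive pg_rel.
Proof.
move=> y x z /asboolP h /asboolP h'; apply/asboolP; exact: pg_trans h h'.
Qed.

Definition pg_equiv : equiv_rel {classic P} :=
  EquivRel pg_rel pg_rel_refl pg_rel_sym pg_rel_trans.

Definition pg_quot := {eq_quot pg_equiv}.
HB.instance Definition _ := Choice.on pg_quot.

Definition pg_class (x : P) : pg_quot := \pi_({eq_quot pg_equiv}) (x : {classic P}).
Definition pg_repr (q : pg_quot) : P := repr (q : {eq_quot pg_equiv}).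

Lemma pg_reprK q : pg_class (pg_repr q) = q.
Proof. exact: reprK. Qed.

Lemma pg_classP (x y : P) : pg_class x = pg_class y <-> pg_eq x y.
Proof.
split=> [/eqmodP /asboolP //|h]; apply/eqmodP; exact/asboolP.
Qed.

Lemma pg_repr_class (x : P) : pg_eq (pg_repr (pg_class x)) x.
Proof. by apply/pg_classP; rewrite pg_reprK. Qed.

Definition pgq_mul (p q : pg_quot) := pg_class (pg_mul (pg_repr p) (pg_repr q)).
Definition pgq_one := pg_class (pg_one P).
Definition pgq_inv (p : pg_quot) := pg_class (projT1 (cid (pg_inv (pg_repr p)))).

Lemma pg_class_mul (x y : P) :
  pgq_mul (pg_class x) (pg_class y) = pg_class (pg_mul x y).
Proof. by apply/pg_classP; apply: pg_mulC; apply: pg_repr_class. Qed.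

Lemma pgq_mulA : associative pgq_mul.
Proof.
move=> x y z; rewrite -(pg_reprK x) -(pg_reprK y) -(pg_reprK z) !pg_class_mul.
by apply/pg_classP; apply: pg_mulA.
Qed.

Lemma pgq_mul1 : left_id pgq_one pgq_mul.
Proof.
by move=> x; rewrite -(pg_reprK x) pg_class_mul; apply/pg_classP/pg_mul1.
Qed.

Lemma pgq_mulr1 : right_id pgq_one pgq_mul.
Proof.
by move=> x; rewrite -(pg_reprK x) pg_class_mul; apply/pg_classP/pg_mulr1.
Qed.

Lemma pgq_mulV : right_inverse pgq_one pgq_inv pgq_mul.
Proof.
move=> x; rewrite /pgq_inv; case: cid => y hy /=.
by rewrite -{1}(pg_reprK x) pg_class_mul; apply/pg_classP.
Qed.

Lemma pgq_mulVl : left_inverse pgq_one pgq_inv pgq_mul.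
Proof.
move=> x; rewrite -[LHS]pgq_mulr1 -{1}(pgq_mulV (pgq_inv x)).
by rewrite pgq_mulA -(pgq_mulA _ x) pgq_mulV pgq_mulr1 pgq_mulV.
Qed.

HB.instance Definition _ := isGroup.Build pg_quot
  pgq_mulA pgq_mul1 pgq_mulr1 pgq_mulVl pgq_mulV.

End QuotientGroup.

Record starAlg (R : realType) := StarAlg {
  salg :> algType R[i];
  star : salg -> salg;
  starK : forall x, star (star x) = x;
  starD : forall x y, star (x + y) = star x + star y;
  starM : forall x y, star (x * y) = star y * star x;
  starZ : forall (c : R[i]) x, star (c *: x) = (Num.conj c) *: star x }.

Section StarTensor.
Variables (R : realType) (M : starAlg R).
Implicit Types (s t : M -> M) (x y : M).
Local Notation st := (@star R M).

Definition unitary (u : M) : Prop := st u * u = 1 /\ u * st u = 1.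

Definition isometry (v : M) : Prop := st v * v = 1.

Definition star_endo (s : M -> M) : Prop :=
  [/\ forall (c : R[i]) x y, s (c *: x + y) = c *: s x + s y,
      forall x y, s (x * y) = s x * s y,
      s 1 = 1 &
      forall x, s (st x) = st (s x)].

(* End(M) is a strict tensor category: the objects are the unital
   *-endomorphisms, s (x) t is s \o t, the morphisms from s to t are the T of
   hom s t, composition is the product of M, and for S in hom s s', T in
   hom t t', the tensor product S (x) T is the element S * s T. *)
Definition hom s t : M -> Prop := fun T => forall x, T * s x = t x * T.

(* Isomorphic objects of a C*-category are unitarily isomorphic. *)
Definition iso s t : Prop := exists2 u, hom s t u & unitary u.

Definition simple s : Prop := forall T, hom s s T -> exists c : R[i], T = c%:A.

Definition dsum (I : finType) (s : I -> M -> M) (t : M -> M) : Prop :=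
  exists V : I -> M,
    [/\ forall i, hom (s i) t (V i),
        forall i j, st (V i) * V j = if i == j then 1 else 0 &
        \sum_i V i * st (V i) = 1].

Definition dual s t : Prop :=
  exists r r' : M, [/\ hom idfun (t \o s) r, hom idfun (s \o t) r',
    st r' * s r = 1 & st r * t r' = 1].

(* C*-fusion categories realized in End(M), as full replete subcategories. *)
Record fusionCat := FusionCat {
  obj :> (M -> M) -> Prop;
  obj_endo : forall s, obj s -> star_endo s;
  obj_replete : forall s t, obj s -> star_endo t -> iso s t -> obj t;
  obj_id : obj idfun;
  obj_comp : forall s t, obj s -> obj t -> obj (s \o t);
  obj_id_simple : simple idfun;
  obj_sum : forall s t, obj s -> obj t ->
    exists2 k, obj k & dsum (fun b : bool => if b then s else t) k;
  obj_sub : forall s p, obj s -> hom s s p -> p != 0 -> st p = p ->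
    p * p = p ->
    exists t v, [/\ obj t, hom t s v, isometry v & v * st v = p];
  obj_dual : forall s, obj s -> exists2 t, obj t & dual s t;
  obj_semisimple : forall s, obj s -> exists (n : nat) (t : 'I_n -> M -> M),
    (forall i, obj (t i) /\ simple (t i)) /\ dsum t s;
  obj_fin_hom : forall s t, obj s -> obj t -> exists (n : nat) (V : 'I_n -> M),
    forall T, hom s t T -> exists c : 'I_n -> R[i], T = \sum_i c i *: V i;
  obj_fin : exists (n : nat) (t : 'I_n -> M -> M),
    forall s, obj s -> simple s -> exists i, iso (t i) s }.

Definition invertible (C : fusionCat) s : Prop :=
  C s /\ exists t, [/\ C t, iso (s \o t) idfun & iso (t \o s) idfun].

(* *-preserving monoidal autoequivalences with unitary structure morphisms.
   ae_obj and ae_mor s t are only meaningful on objects of C and on hom s t. *)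
Record autoeq_data := AutoeqData {
  ae_obj :> (M -> M) -> (M -> M);
  ae_mor : (M -> M) -> (M -> M) -> M -> M;
  ae_ten : (M -> M) -> (M -> M) -> M;   (* F s (x) F t -> F (s (x) t) *)
  ae_unit : M }.                        (* 1 -> F 1 *)

Record is_autoeq (C : fusionCat) (F : autoeq_data) : Prop := IsAutoeq {
  ax_objP : forall s, C s -> C (F s);
  ax_morP : forall s t T, C s -> C t -> hom s t T ->
    hom (F s) (F t) (ae_mor F s t T);
  ax_lin : forall s t (c : R[i]) T T', C s -> C t -> hom s t T -> hom s t T' ->
    ae_mor F s t (c *: T + T') = c *: ae_mor F s t T + ae_mor F s t T';
  ax_comp : forall s t k T T', C s -> C t -> C k -> hom s t T -> hom t k T' ->
    ae_mor F s k (T' * T) = ae_mor F t k T' * ae_mor F s t T;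
  ax_id : forall s, C s -> ae_mor F s s 1 = 1;
  ax_star : forall s t T, C s -> C t -> hom s t T ->
    ae_mor F t s (st T) = st (ae_mor F s t T);
  ax_faithful : forall s t T T', C s -> C t -> hom s t T -> hom s t T' ->
    ae_mor F s t T = ae_mor F s t T' -> T = T';
  ax_full : forall s t X, C s -> C t -> hom (F s) (F t) X ->
    exists2 T, hom s t T & ae_mor F s t T = X;
  ax_surj : forall t, C t -> exists2 s, C s & iso (F s) t;
  ax_tenP : forall s t, C s -> C t ->
    hom (F s \o F t) (F (s \o t)) (ae_ten F s t);
  ax_tenU : forall s t, C s -> C t -> unitary (ae_ten F s t);
  ax_tenN : forall s s' t t' S T, C s -> C s' -> C t -> C t' ->
    hom s s' S -> hom t t' T ->
    ae_mor F (s \o t) (s' \o t') (S * s T) * ae_ten F s t =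
    ae_ten F s' t' * (ae_mor F s s' S * F s (ae_mor F t t' T));
  ax_tenA : forall s t k, C s -> C t -> C k ->
    ae_ten F (s \o t) k * ae_ten F s t = ae_ten F s (t \o k) * F s (ae_ten F t k);
  ax_unitP : hom idfun (F idfun) (ae_unit F);
  ax_unitU : unitary (ae_unit F);
  ax_unitl : forall s, C s -> ae_ten F idfun s * ae_unit F = 1;
  ax_unitr : forall s, C s -> ae_ten F s idfun * F s (ae_unit F) = 1 }.

Record autoeq (C : fusionCat) := Autoeq {
  ae_data :> autoeq_data;
  ae_ax : is_autoeq C ae_data }.

Definition ae_objP C (F : autoeq C) := ax_objP (ae_ax F).
Definition ae_morP C (F : autoeq C) := ax_morP (ae_ax F).
Definition ae_lin C (F : autoeq C) := ax_lin (ae_ax F).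
Definition ae_comp C (F : autoeq C) := ax_comp (ae_ax F).
Definition ae_id C (F : autoeq C) := ax_id (ae_ax F).
Definition ae_star C (F : autoeq C) := ax_star (ae_ax F).
Definition ae_faithful C (F : autoeq C) := ax_faithful (ae_ax F).
Definition ae_full C (F : autoeq C) := ax_full (ae_ax F).
Definition ae_surj C (F : autoeq C) := ax_surj (ae_ax F).
Definition ae_tenP C (F : autoeq C) := ax_tenP (ae_ax F).
Definition ae_tenU C (F : autoeq C) := ax_tenU (ae_ax F).
Definition ae_tenN C (F : autoeq C) := ax_tenN (ae_ax F).
Definition ae_tenA C (F : autoeq C) := ax_tenA (ae_ax F).
Definition ae_unitP C (F : autoeq C) := ax_unitP (ae_ax F).
Definition ae_unitU C (F : autoeq C) := ax_unitU (ae_ax F).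
Definition ae_unitl C (F : autoeq C) := ax_unitl (ae_ax F).
Definition ae_unitr C (F : autoeq C) := ax_unitr (ae_ax F).

Definition mon_iso (C : fusionCat) (F F' : autoeq C) : Prop :=
  exists e e' : (M -> M) -> M,
  [/\ forall s, C s -> [/\ hom (F s) (F' s) (e s), e' s * e s = 1
                         & e s * e' s = 1],
      forall s t T, C s -> C t -> hom s t T ->
        e t * ae_mor F s t T = ae_mor F' s t T * e s,
      forall s t, C s -> C t ->
        e (s \o t) * ae_ten F s t = ae_ten F' s t * (e s * F s (e t)) &
      e idfun * ae_unit F = ae_unit F'].

Lemma st1 : st 1 = 1.
Proof. by rewrite -[LHS]mul1r -[X in X * _]starK -starM mul1r starK. Qed.

Lemma unitary1 : unitary 1.
Proof. by rewrite /unitary st1 mulr1. Qed.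

Lemma unitaryM u v : unitary u -> unitary v -> unitary (u * v).
Proof.
move=> [u1 u2] [v1 v2]; rewrite /unitary starM; split.
  by rewrite -mulrA (mulrA (st u)) u1 mul1r.
by rewrite -mulrA (mulrA v) v2 mul1r.
Qed.

Lemma unitaryV u : unitary u -> unitary (st u).
Proof. by move=> [u1 u2]; rewrite /unitary starK. Qed.

Lemma unitary_endo s u : star_endo s -> unitary u -> unitary (s u).
Proof.
by move=> [_ sM s1 sS] [u1 u2]; rewrite /unitary -sS -!sM u1 u2.
Qed.

Lemma homM s t k T T' : hom s t T -> hom t k T' -> hom s k (T' * T).
Proof. by move=> h h' x; rewrite -mulrA h mulrA h' mulrA. Qed.

Lemma hom1 s : hom s s 1.
Proof. by move=> x; rewrite mul1r mulr1. Qed.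

Lemma homV s t T : star_endo s -> star_endo t -> hom s t T -> hom t s (st T).
Proof.
move=> [_ _ _ sS] [_ _ _ tS] h x.
by rewrite -[x]starK tS sS -!starM h.
Qed.

Lemma homT s s' t t' S T : star_endo s ->
  hom s s' S -> hom t t' T -> hom (s \o t) (s' \o t') (S * s T).
Proof.
by move=> [_ sM _ _] h h' x /=; rewrite -mulrA -sM h' sM mulrA h mulrA.
Qed.

Lemma homI s t t' T : star_endo s -> hom t t' T ->
  hom (s \o t) (s \o t') (s T).
Proof. by move=> hs h; rewrite -[s T]mul1r; apply: homT => //; apply: hom1. Qed.

Lemma homR s s' t S : hom s s' S -> hom (s \o t) (s' \o t) S.
Proof. by move=> h x /=; rewrite h. Qed.

Lemma homL s t c T T' : star_endo t -> hom s t T -> hom s t T' ->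
  hom s t (c *: T + T').
Proof.
by move=> ht h h' x; rewrite mulrDl mulrDr -scalerAl -scalerAr h h'.
Qed.

Lemma endo_id : star_endo idfun.
Proof. by []. Qed.

Lemma endo_comp s t : star_endo s -> star_endo t -> star_endo (s \o t).
Proof.
move=> [s1 s2 s3 s4] [t1 t2 t3 t4]; split=> /=.
- by move=> c x y; rewrite t1 s1.
- by move=> x y; rewrite t2 s2.
- by rewrite t3.
- by move=> x; rewrite t4.
Qed.

Lemma endo_Ad s u : star_endo s -> unitary u ->
  star_endo (fun x => u * s x * st u).
Proof.
move=> [s1 s2 s3 s4] [u1 u2]; split.
- move=> c x y; rewrite s1 mulrDr mulrDl; congr (_ + _).
  by rewrite -scalerAr -scalerAl.
- move=> x y; rewrite s2 -!mulrA; congr (_ * _).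
  by rewrite (mulrA (st u)) u1 mul1r.
- by rewrite s3 mulr1.
- by move=> x; rewrite !starM starK s4 mulrA.
Qed.

Lemma iso_Ad s u : unitary u -> iso s (fun x => u * s x * st u).
Proof.
by move=> uu; exists u => // x; case: uu => u1 _; rewrite -!mulrA u1 mulr1.
Qed.

Lemma iso_sym s t : star_endo s -> star_endo t -> iso s t -> iso t s.
Proof.
by move=> hs ht [u h uu]; exists (st u); [exact: homV|exact: unitaryV].
Qed.

Lemma iso_trans s t k : iso s t -> iso t k -> iso s k.
Proof.
move=> [u h uu] [v h' vv]; exists (v * u); [exact: homM h h'|exact: unitaryM].
Qed.

Section Category.
Variable C : fusionCat.
Implicit Types F K : autoeq C.

Lemma ae_unitary F s t T : C s -> C t -> hom s t T -> unitary T ->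
  unitary (ae_mor F s t T).
Proof.
move=> cs ct h [T1 T2].
have hT := homV (obj_endo cs) (obj_endo ct) h.
rewrite /unitary -(ae_star F cs ct h); split.
  by rewrite -(ae_comp F cs ct cs h hT) T1 ae_id.
by rewrite -(ae_comp F ct cs ct hT h) T2 ae_id.
Qed.

Lemma mon_iso_refl F : mon_iso F F.
Proof.
exists (fun=> 1), (fun=> 1); split.
- by move=> s cs; rewrite mulr1; split=> //; apply: hom1.
- by move=> s t T cs ct h; rewrite mul1r mulr1.
- move=> s t cs ct; rewrite !mul1r.
  by case: (obj_endo (ae_objP F cs)) => _ _ -> _; rewrite mulr1.
- by rewrite mul1r.
Qed.

Lemma mon_iso_sym F K : mon_iso F K -> mon_iso K F.
Proof.
move=> [e [e' [H1 H2 H3 H4]]]; exists e', e; split.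
- move=> s cs; have [h h1 h2] := H1 s cs; split=> // x.
  by rewrite -[RHS]mul1r -h1 -[RHS]mulrA (mulrA (e s)) h -[K s x * _ * _]mulrA h2 mulr1.
- move=> s t T cs ct h; have [_ a1 a2] := H1 s cs; have [_ b1 b2] := H1 t ct.
  rewrite -[RHS]mul1r -b1 -[RHS]mulrA (mulrA (e t)) H2 //.
  by rewrite -[_ * e s * _]mulrA a2 mulr1.
- move=> s t cs ct; have [hs a1 a2] := H1 s cs; have [ht b1 b2] := H1 t ct.
  have [_ d1 d2] := H1 _ (obj_comp cs ct).
  have [_ KM K1 _] := obj_endo (ae_objP K cs).
  have [_ FM F1 _] := obj_endo (ae_objP F cs).
  have E' : (e s * F s (e t)) * (e' s * K s (e' t)) = 1.
    by rewrite hs -mulrA (mulrA (e s)) a2 mul1r -KM b2 K1.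
  rewrite -[RHS]mul1r -d1 -[RHS]mulrA (mulrA (e (s \o t))) H3 //.
  by rewrite -(mulrA (ae_ten K s t)) E' mulr1.
- have [_ h1 _] := H1 _ (obj_id C).
  by rewrite -H4 mulrA h1 mul1r.
Qed.

Lemma mon_iso_trans F K L : mon_iso F K -> mon_iso K L -> mon_iso F L.
Proof.
move=> [e [e' [H1 H2 H3 H4]]] [d [d' [G1 G2 G3 G4]]].
exists (fun s => d s * e s), (fun s => e' s * d' s); split.
- move=> s cs; have [h a1 a2] := H1 s cs; have [h' b1 b2] := G1 s cs; split.
  + exact: homM h h'.
  + by rewrite -mulrA (mulrA (d' s)) b1 mul1r.
  + by rewrite -mulrA (mulrA (e s)) a2 mul1r.
- by move=> s t T cs ct h; rewrite -mulrA H2 // mulrA G2 // mulrA.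
- move=> s t cs ct; rewrite -mulrA H3 // mulrA G3 // -!mulrA; congr (_ * (_ * _)).
  have [h _ _] := H1 s cs; have [_ FM _ _] := obj_endo (ae_objP F cs).
  by rewrite FM !mulrA h.
- by rewrite -mulrA H4.
Qed.

Definition ae_one_data : autoeq_data :=
  AutoeqData (fun s => s) (fun _ _ T => T) (fun _ _ => 1) 1.

Lemma ae_one_ax : is_autoeq C ae_one_data.
Proof.
split=> //=.
- by move=> s t X _ _ h; exists X.
- by move=> t ct; exists t => //; exists 1; [apply: hom1|apply: unitary1].
- by move=> s t _ _; apply: hom1.
- by move=> *; apply: unitary1.
- by move=> *; rewrite mulr1 mul1r.
- by move=> s t k cs ct ck; case: (obj_endo cs) => _ _ -> _.
- exact: hom1.
- exact: unitary1.
- by move=> *; rewrite mulr1.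
- by move=> s cs; case: (obj_endo cs) => _ _ -> _; rewrite mulr1.
Qed.

Definition ae_one : autoeq C := Autoeq ae_one_ax.

Section Comp.
Variables F K : autoeq C.

Definition aec_obj s := F (K s).
Definition aec_mor s t T := ae_mor F (K s) (K t) (ae_mor K s t T).
Definition aec_ten s t :=
  ae_mor F (K s \o K t) (K (s \o t)) (ae_ten K s t) * ae_ten F (K s) (K t).
Definition aec_unit := ae_mor F idfun (K idfun) (ae_unit K) * ae_unit F.

Definition ae_mul_data : autoeq_data :=
  AutoeqData aec_obj aec_mor aec_ten aec_unit.

Lemma ae_mul_ax : is_autoeq C ae_mul_data.
Proof.
have cK s : C s -> C (K s) := @ae_objP _ K s.
have cKK s t : C s -> C t -> C (K s \o K t).
  by move=> cs ct; apply: obj_comp; apply: cK.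
have cK2 s t : C s -> C t -> C (K (s \o t)).
  by move=> cs ct; apply/cK/obj_comp.
have kE s : C s -> star_endo (K s) by move=> /cK /obj_endo.
have fE s : C s -> star_endo (F s) by move=> /(@ae_objP _ F) /obj_endo.
split=> /=; rewrite /aec_obj /aec_mor /aec_ten /aec_unit.
- by move=> s cs; do 2 apply: ae_objP.
- by move=> s t T cs ct h; apply: ae_morP; auto; apply: ae_morP.
- move=> s t c T T' cs ct h h'.
  by rewrite ae_lin // ae_lin //; auto; apply: ae_morP.
- move=> s t k T T' cs ct ck h h'.
  by rewrite (ae_comp K cs ct ck h h') (ae_comp F (cK _ cs) (cK _ ct)) //;
    auto; apply: ae_morP.
- by move=> s cs; rewrite !ae_id //; auto.
- by move=> s t T cs ct h; rewrite ae_star // ae_star //; auto; apply: ae_morP.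
- move=> s t T T' cs ct h h' /ae_faithful E.
  by apply: (ae_faithful cs ct h h'); apply: E; auto; apply: ae_morP.
- move=> s t X cs ct h.
  have [Y hY <-] := ae_full (cK _ cs) (cK _ ct) h.
  by have [T hT <-] := ae_full cs ct hY; exists T.
- move=> t ct; have [s cs i] := ae_surj F ct; have [k ck [u hu uu]] := ae_surj K cs.
  exists k => //; apply: iso_trans i; exists (ae_mor F (K k) s u).
    by apply: ae_morP => //; auto.
  by apply: ae_unitary => //; auto.
- move=> s t cs ct; apply: (homM (t := F (K s \o K t))).
    by apply: ae_tenP; auto.
  by apply: ae_morP; auto; apply: ae_tenP.
- move=> s t cs ct; apply: unitaryM.
    by apply: ae_unitary; auto; [apply: ae_tenP|apply: ae_tenU].
  by apply: ae_tenU; auto.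
- move=> s s' t t' S T cs cs' ct ct' h h'.
  have hS := ae_morP K cs cs' h; have hT := ae_morP K ct ct' h'.
  rewrite mulrA -ae_comp; auto; last 2 first.
  + exact: ae_tenP.
  + by apply: ae_morP; [exact: obj_comp|exact: obj_comp|apply: homT => //; exact: obj_endo cs].
  rewrite ae_tenN // (@ae_comp _ F _ (K s' \o K t')); auto; last 2 first.
  + by apply: homT; auto.
  + exact: ae_tenP.
  by rewrite -[LHS]mulrA -[RHS]mulrA; congr (_ * _); apply: ae_tenN; auto.
- move=> s t k cs ct ck.
  have cst := obj_comp cs ct; have ctk := obj_comp ct ck.
  have N1 := @ae_tenN _ F (K s \o K t) (K (s \o t)) (K k) (K k) (ae_ten K s t) 1
     (cKK _ _ cs ct) (cK2 _ _ cs ct) (cK _ ck) (cK _ ck) (ae_tenP K cs ct) (hom1 _).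
  have N2 := @ae_tenN _ F (K s) (K s) (K t \o K k) (K (t \o k)) 1 (ae_ten K t k)
     (cK _ cs) (cK _ cs) (cKK _ _ ct ck) (cK2 _ _ ct ck) (hom1 _) (ae_tenP K ct ck).
  have e1 : (K s \o K t) 1 = 1.
    by have [_ _ -> _] := endo_comp (kE _ cs) (kE _ ct).
  have e2 : F (K s \o K t) 1 = 1 by have [_ _ -> _] := fE _ (cKK _ _ cs ct).
  rewrite e1 ae_id ?e2 ?mulr1 in N1; auto.
  rewrite ae_id ?mul1r in N2; auto.
  have [_ FM _ _] := fE _ (cK _ cs).
  rewrite -[LHS]mulrA (mulrA (ae_ten F _ _)) -N1 FM -[RHS]mulrA (mulrA (ae_ten F (K s) _)) -N2.
  rewrite -![in LHS]mulrA -![in RHS]mulrA !(mulrA (ae_mor F _ _ _) (ae_mor F _ _ _)).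
  rewrite ae_tenA; auto; rewrite !mulrA; congr (_ * _ * _).
  have c3 : C (K s \o K t \o K k) by apply: obj_comp; auto.
  have c4 : C (K (s \o t) \o K k) by apply: obj_comp; auto.
  have c5 : C (K s \o K (t \o k)) by apply: obj_comp; auto.
  have c6 : C (K ((s \o t) \o k)) by apply/cK/obj_comp.
  rewrite -(@ae_comp _ F _ _ _ _ _ c3 c4 c6); first last.
  + exact: ae_tenP.
  + by apply: homR; exact: ae_tenP.
  rewrite -(@ae_comp _ F _ _ _ _ _ c3 c5 c6); first last.
  + exact: ae_tenP.
  + by apply: homI; [auto|exact: ae_tenP].
  by rewrite ae_tenA.
- apply: (homM (t := F idfun)); first exact: ae_unitP.
  by apply: ae_morP; [exact: obj_id|exact/cK/obj_id|exact: ae_unitP].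
- apply: unitaryM; last exact: ae_unitU.
  by apply: ae_unitary; [exact: obj_id|exact/cK/obj_id|exact: ae_unitP|exact: ae_unitU].
- move=> s cs; have ci := obj_id C.
  have N := @ae_tenN _ F idfun (K idfun) (K s) (K s) (ae_unit K) 1
    ci (cK _ ci) (cK _ cs) (cK _ cs) (ae_unitP K) (hom1 _).
  have e2 : F idfun 1 = 1 by have [_ _ -> _] := fE _ ci.
  rewrite ae_id ?e2 ?mulr1 /= in N; auto.
  rewrite -mulrA (mulrA (ae_ten F _ _)) -N -!mulrA ae_unitl ?mulr1; auto.
  have c4 : C (K idfun \o K s) by apply: obj_comp; auto.
  have c5 : hom (K s) (K idfun \o K s) (ae_unit K).
    exact: (@homR idfun _ (K s)) (ae_unitP K).
  rewrite -(@ae_comp _ F _ _ _ _ _ (cK _ cs) c4 (cK _ cs) c5); last exact: (ae_tenP K ci cs).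
  by rewrite ae_unitl // ae_id //; auto.
- move=> s cs; have ci := obj_id C.
  have N := @ae_tenN _ F (K s) (K s) idfun (K idfun) 1 (ae_unit K)
    (cK _ cs) (cK _ cs) ci (cK _ ci) (hom1 _) (ae_unitP K).
  rewrite ae_id ?mul1r /= in N; auto.
  have [_ FM _ _] := fE _ (cK _ cs).
  rewrite FM -mulrA (mulrA (ae_ten F _ _)) -N -!mulrA ae_unitr ?mulr1; auto.
  have c4 : C (K s \o K idfun) by apply: obj_comp; auto.
  have c5 : hom (K s) (K s \o K idfun) (K s (ae_unit K)).
    exact: homI (kE _ cs) (ae_unitP K).
  rewrite -(@ae_comp _ F _ _ _ _ _ (cK _ cs) c4 (cK _ cs) c5); last exact: (ae_tenP K cs ci).
  by rewrite ae_unitr // ae_id //; auto.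
Qed.

(* The composition F o K. *)
Definition ae_mul : autoeq C := Autoeq ae_mul_ax.

End Comp.


Local Infix "\*" := ae_mul (at level 40, left associativity).

Lemma ae_objE F s : C s -> star_endo (F s).
Proof. by move=> cs; apply: (obj_endo (ae_objP F cs)). Qed.

Lemma ae_objM F s x y : C s -> F s (x * y) = F s x * F s y.
Proof. by move=> /(ae_objE F) [_ ->]. Qed.

Lemma ae_obj1 F s : C s -> F s 1 = 1.
Proof. by move=> /(ae_objE F) [_ _ ->]. Qed.

Lemma ae_objS F s x : C s -> F s (st x) = st (F s x).
Proof. by move=> /(ae_objE F) [_ _ _ ->]. Qed.

Lemma mon_iso_strict F K :
  (forall s, C s -> F s = K s) ->
  (forall s t T, C s -> C t -> hom s t T -> ae_mor F s t T = ae_mor K s t T) ->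
  (forall s t, C s -> C t -> ae_ten F s t = ae_ten K s t) ->
  ae_unit F = ae_unit K -> mon_iso F K.
Proof.
move=> H1 H2 H3 H4; exists (fun=> 1), (fun=> 1); split.
- by move=> s cs; rewrite mulr1 H1 //; split=> //; apply: hom1.
- by move=> s t T cs ct h; rewrite mul1r mulr1 H2.
- by move=> s t cs ct; rewrite !mul1r ae_obj1 // mulr1 H3.
- by rewrite mul1r.
Qed.

Lemma ae_mulA F K L : mon_iso (F \* (K \* L)) (F \* K \* L).
Proof.
apply: mon_iso_strict => //=.
- move=> s t cs ct; rewrite /aec_ten /= /aec_ten mulrA; congr (_ * _).
  have cL r : C r -> C (L r) by apply: ae_objP.
  have cKL r : C r -> C (K (L r)) by move=> /cL; apply: ae_objP.
  apply: (@ae_comp _ F (K (L s) \o K (L t)) (K (L s \o L t)) (K (L (s \o t)))).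
  + by apply: obj_comp; auto.
  + by apply/ae_objP/obj_comp; auto.
  + by apply/cKL/obj_comp.
  + by apply: ae_tenP; auto.
  + apply: ae_morP; [by apply: obj_comp; auto|by apply/cL/obj_comp|exact: ae_tenP].
- rewrite /aec_unit /= /aec_unit mulrA; congr (_ * _); have ci := obj_id C.
  have cL r : C r -> C (L r) by apply: ae_objP.
  have cK r : C r -> C (K r) by apply: ae_objP.
  apply: (@ae_comp _ F idfun (K idfun) (K (L idfun))); auto.
  + exact: ae_unitP.
  + by apply: ae_morP; auto; exact: ae_unitP.
Qed.

Lemma ae_mul1 F : mon_iso (ae_one \* F) F.
Proof.
by apply: mon_iso_strict => //=; rewrite /aec_ten /aec_unit /= => *; rewrite mulr1.
Qed.

Lemma ae_mulr1 F : mon_iso (F \* ae_one) F.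
Proof.
have ci := obj_id C.
apply: mon_iso_strict => //=; rewrite /aec_ten /aec_unit /=.
  by move=> s t cs ct; rewrite ae_id ?mul1r //; exact: obj_comp.
by rewrite ae_id ?mul1r.
Qed.

Lemma ae_mulCr F F' K : mon_iso F F' -> mon_iso (F \* K) (F' \* K).
Proof.
move=> [e [e' [H1 H2 H3 H4]]]; exists (e \o K), (e' \o K).
have cK s : C s -> C (K s) by apply: ae_objP.
split=> /=; rewrite /aec_obj /aec_mor /aec_ten /aec_unit.
- by move=> s cs; apply: H1; auto.
- by move=> s t T cs ct h; apply: H2; auto; apply: ae_morP.
- move=> s t cs ct; rewrite mulrA H2; last exact: ae_tenP.
  + by rewrite -[LHS]mulrA H3 ?mulrA; auto.
  + by apply: obj_comp; auto.
  + by apply/cK/obj_comp.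
- have ci := obj_id C.
  by rewrite mulrA H2; auto; [rewrite -mulrA H4|exact: ae_unitP].
Qed.

Lemma ae_mulCl F K K' : mon_iso K K' -> mon_iso (F \* K) (F \* K').
Proof.
move=> [e [e' [H1 H2 H3 H4]]].
have cK s : C s -> C (K s) by apply: ae_objP.
have cK' s : C s -> C (K' s) by apply: ae_objP.
have he s : C s -> hom (K s) (K' s) (e s) by move=> /H1 [].
have he' s : C s -> hom (K' s) (K s) (e' s).
  move=> cs x; have [h h1 h2] := H1 s cs.
  by rewrite -[RHS]mul1r -h1 -[RHS]mulrA (mulrA (e s)) h -[K' s x * _ * _]mulrA h2 mulr1.
exists (fun s => ae_mor F (K s) (K' s) (e s)), (fun s => ae_mor F (K' s) (K s) (e' s)).
split=> /=; rewrite /aec_obj /aec_mor /aec_ten /aec_unit.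
- move=> s cs; have [h h1 h2] := H1 s cs; split; first by apply: ae_morP; auto.
    by rewrite -(@ae_comp _ F _ _ _ _ _ (cK _ cs) (cK' _ cs) (cK _ cs)) ?h1 ?ae_id; auto.
  by rewrite -(@ae_comp _ F _ _ _ _ _ (cK' _ cs) (cK _ cs) (cK' _ cs)) ?h2 ?ae_id; auto.
- move=> s t T cs ct h.
  rewrite -(@ae_comp _ F _ _ _ _ _ (cK _ cs) (cK _ ct) (cK' _ ct)); auto; last exact: ae_morP.
  rewrite -(@ae_comp _ F _ _ _ _ _ (cK _ cs) (cK' _ cs) (cK' _ ct)); auto; last exact: ae_morP.
  by rewrite H2.
- move=> s t cs ct; have cst := obj_comp cs ct.
  have c1 : C (K s \o K t) by apply: obj_comp; auto.
  have c2 : C (K' s \o K' t) by apply: obj_comp; auto.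
  have hee : hom (K s \o K t) (K' s \o K' t) (e s * K s (e t)).
    by apply: homT; auto; exact: ae_objE.
  rewrite mulrA -(@ae_comp _ F _ _ _ _ _ c1 (cK _ cst) (cK' _ cst)) //;
    [|exact: ae_tenP|by auto].
  rewrite H3 // (@ae_comp _ F _ _ _ _ _ c1 c2 (cK' _ cst)) //; last exact: ae_tenP.
  by rewrite -[LHS]mulrA -[RHS]mulrA; congr (_ * _); apply: ae_tenN; auto.
- have ci := obj_id C; rewrite mulrA.
  rewrite -(@ae_comp _ F _ _ _ _ _ ci (cK _ ci) (cK' _ ci)) //; auto.
    by rewrite H4.
  exact: ae_unitP.
Qed.

Lemma ae_unitary_refl F s t T : C s -> C t -> hom s t T ->
  unitary (ae_mor F s t T) -> unitary T.
Proof.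
move=> cs ct h [u1 u2]; have h' := homV (obj_endo cs) (obj_endo ct) h; split.
  apply: (ae_faithful (F := F) cs cs); [exact: homM h h'|exact: hom1|].
  by rewrite (@ae_comp _ F _ _ _ _ _ cs ct cs) // ae_star // u1 ae_id.
apply: (ae_faithful (F := F) ct ct); [exact: homM h' h|exact: hom1|].
by rewrite (@ae_comp _ F _ _ _ _ _ ct cs ct) // ae_star // u2 ae_id.
Qed.

Lemma ae_tensor F s s' t t' S T : C s -> C s' -> C t -> C t' ->
  hom s s' S -> hom t t' T ->
  ae_mor F (s \o t) (s' \o t') (S * s T) =
  ae_ten F s' t' * (ae_mor F s s' S * F s (ae_mor F t t' T)) * st (ae_ten F s t).
Proof.
move=> cs cs' ct ct' h h'; rewrite -ae_tenN // -mulrA.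
by have [_ ->] := ae_tenU F cs ct; rewrite mulr1.
Qed.

Lemma ae_unitlE F s : C s -> st (ae_ten F idfun s) = ae_unit F.
Proof.
move=> cs; have [h _] := ae_tenU F (obj_id C) cs.
by rewrite -[LHS]mulr1 -(ae_unitl F cs) mulrA h mul1r.
Qed.

Section Inverse.
Variables (F : autoeq C) (g : (M -> M) -> M -> M) (w : (M -> M) -> M).
Variable h : (M -> M) -> (M -> M) -> M -> M.
Hypothesis gP : forall t, C t -> C (g t).
Hypothesis wP : forall t, C t -> hom (F (g t)) t (w t).
Hypothesis wU : forall t, C t -> unitary (w t).
Hypothesis hP : forall s t X, C s -> C t -> hom (F s) (F t) X -> hom s t (h s t X).
Hypothesis hK : forall s t X, C s -> C t -> hom (F s) (F t) X ->
  ae_mor F s t (h s t X) = X.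

Let gm s t T := h (g s) (g t) (st (w t) * T * w s).
Let gt s t := h (g s \o g t) (g (s \o t))
  (st (w (s \o t)) * (w s * F (g s) (w t)) * st (ae_ten F (g s) (g t))).
Let gu := h idfun (g idfun) (st (w idfun) * st (ae_unit F)).

Let E s : C s -> star_endo s. Proof. exact: obj_endo. Qed.
Let Fg s : C s -> star_endo (F (g s)). Proof. by move=> /gP /ae_objE. Qed.
Let wV t : C t -> hom t (F (g t)) (st (w t)).
Proof. by move=> ct; apply: homV; auto. Qed.
Let w1 t : C t -> st (w t) * w t = 1. Proof. by move=> /wU []. Qed.
Let w2 t : C t -> w t * st (w t) = 1. Proof. by move=> /wU []. Qed.
Let gg s t : C s -> C t -> C (g s \o g t).
Proof. by move=> cs ct; apply: obj_comp; auto. Qed.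
Let g2 s t : C s -> C t -> C (g (s \o t)).
Proof. by move=> cs ct; apply/gP/obj_comp. Qed.

Let hgm s t T : C s -> C t -> hom s t T ->
  hom (F (g s)) (F (g t)) (st (w t) * T * w s).
Proof.
move=> cs ct hT; apply: homM (wP cs) _; exact: homM hT (wV ct).
Qed.

Let gmP s t T : C s -> C t -> hom s t T -> hom (g s) (g t) (gm s t T).
Proof. by move=> cs ct hT; apply: hP; auto; apply: hgm. Qed.

Let Fgm s t T : C s -> C t -> hom s t T ->
  ae_mor F (g s) (g t) (gm s t T) = st (w t) * T * w s.
Proof. by move=> cs ct hT; apply: hK; auto; apply: hgm. Qed.

Let hgt s t : C s -> C t -> hom (F (g s \o g t)) (F (g (s \o t)))
  (st (w (s \o t)) * (w s * F (g s) (w t)) * st (ae_ten F (g s) (g t))).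
Proof.
move=> cs ct; have cst := obj_comp cs ct.
apply: (homM (t := F (g s) \o F (g t))).
  apply: homV; [apply: endo_comp; auto|apply: ae_objE; auto|apply: ae_tenP; auto].
apply: homM (wV cst); apply: homT; auto.
Qed.

Let gtP s t : C s -> C t -> hom (g s \o g t) (g (s \o t)) (gt s t).
Proof. by move=> cs ct; apply: hP; auto; apply: hgt. Qed.

Let Fgt s t : C s -> C t -> ae_mor F (g s \o g t) (g (s \o t)) (gt s t) =
  st (w (s \o t)) * (w s * F (g s) (w t)) * st (ae_ten F (g s) (g t)).
Proof. by move=> cs ct; apply: hK; auto; apply: hgt. Qed.

Let hgu : hom (F idfun) (F (g idfun)) (st (w idfun) * st (ae_unit F)).
Proof.
have ci := obj_id C; apply: homM (wV ci).
by apply: homV; [exact: endo_id|exact: ae_objE|exact: ae_unitP].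
Qed.

Let guP : hom idfun (g idfun) gu.
Proof. by have ci := obj_id C; apply: hP; auto; exact: hgu. Qed.

Let Fgu : ae_mor F idfun (g idfun) gu = st (w idfun) * st (ae_unit F).
Proof. by have ci := obj_id C; apply: hK; auto; exact: hgu. Qed.

Let tU1 s t : C s -> C t -> st (ae_ten F s t) * ae_ten F s t = 1.
Proof. by move=> cs ct; have [] := ae_tenU F cs ct. Qed.

Let comp3 (s t k : M -> M) T T' : C s -> C t -> C k ->
  hom s t T -> hom t k T' ->
  ae_mor F s k (T' * T) = ae_mor F t k T' * ae_mor F s t T.
Proof. exact: ae_comp. Qed.

Let wc s x : C s -> w s * F (g s) x = s x * w s.
Proof. by move=> cs; apply: wP. Qed.

Let gA s t k : C s -> C t -> C k ->
  gt (s \o t) k * gt s t = gt s (t \o k) * g s (gt t k).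
Proof.
move=> cs ct ck; have cst := obj_comp cs ct; have ctk := obj_comp ct ck.
have c0 : C (g s \o g t \o g k) by apply: obj_comp; auto.
have c1 : C (g (s \o t) \o g k) by apply: obj_comp; auto.
have c2 : C (g s \o g (t \o k)) by apply: obj_comp; auto.
have c3 : C (g (s \o t \o k)) by apply/gP/obj_comp.
have h1 := @homR _ _ (g k) _ (gtP cs ct).
have h2 := homI (E (gP cs)) (gtP ct ck).
apply: (ae_faithful (F := F) c0 c3).
- exact: homM h1 (gtP cst ck).
- exact: homM h2 (gtP cs ctk).
rewrite (comp3 c0 c1 c3 h1 (gtP cst ck)) (comp3 c0 c2 c3 h2 (gtP cs ctk)).
have := @ae_tensor F _ _ _ _ _ _ (gg cs ct) (gP cst) (gP ck) (gP ck) (gtP cs ct) (hom1 (g k)).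
have -> : (g s \o g t) 1 = 1 by have [_ _ -> _] := E (gg cs ct).
rewrite mulr1 ae_id ?ae_obj1 ?mulr1; auto => ->.
have := @ae_tensor F _ _ _ _ _ _ (gP cs) (gP cs) (gg ct ck) (gP ctk) (hom1 (g s)) (gtP ct ck).
rewrite !mul1r ae_id ?mul1r; auto => ->.
rewrite !Fgt //.
rewrite -!mulrA (mulrA (st (ae_ten F (g (s \o t)) (g k)))) tU1 ?mul1r; auto.
rewrite (mulrA (st (ae_ten F (g s) (g (t \o k))))) tU1 ?mul1r; auto.
congr (_ * _).
have cgs := gP cs; have cgt := gP ct; have cgk := gP ck.
rewrite mulrA wc // -[LHS]mulrA (mulrA (w (s \o t)) (st _)) w2 // mul1r.
rewrite (mulrA (F (g s) (w (t \o k)))) -ae_objM // (mulrA (w (t \o k))) w2 // mul1r.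
rewrite (mulrA (w t)) wc // -(mulrA (t _)) !ae_objM //.
rewrite -[in RHS](mulrA (F (g s) (t _))) [RHS]mulrA wc // -[RHS]mulrA.
rewrite -[in RHS](mulrA (F (g s) (w t))).
congr (_ * (_ * (_ * _))).
by rewrite ae_objS // -!starM ae_tenA.
Qed.

Let gN s s' t t' S T : C s -> C s' -> C t -> C t' -> hom s s' S -> hom t t' T ->
  gm (s \o t) (s' \o t') (S * s T) * gt s t =
  gt s' t' * (gm s s' S * g s (gm t t' T)).
Proof.
move=> cs cs' ct ct' hS hT.
have cst := obj_comp cs ct; have cst' := obj_comp cs' ct'.
have hST : hom (s \o t) (s' \o t') (S * s T) by apply: homT; auto.
have hGG : hom (g s \o g t) (g s' \o g t') (gm s s' S * g s (gm t t' T)).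
  by apply: homT; [exact/E/gP|exact: gmP|exact: gmP].
apply: (ae_faithful (F := F) (gg cs ct) (g2 cs' ct')).
- exact: homM (gtP cs ct) (gmP cst cst' hST).
- exact: homM hGG (gtP cs' ct').
rewrite (comp3 (gg cs ct) (gP cst) (gP cst') (gtP cs ct) (gmP cst cst' hST)).
rewrite (comp3 (gg cs ct) (gg cs' ct') (gP cst') hGG (gtP cs' ct')).
rewrite (@ae_tensor F _ _ _ _ _ _ (gP cs) (gP cs') (gP ct) (gP ct')); auto; try exact: gmP.
rewrite !Fgm // !Fgt // -!mulrA; congr (_ * _).
rewrite (mulrA (st (ae_ten F (g s') (g t')))) tU1 ?mul1r; auto.
rewrite !mulrA; congr (_ * _).
rewrite -(mulrA _ (w (s \o t))) w2 // mulr1 (wc (w t') cs').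
rewrite -(mulrA _ (w s')) w2 // mulr1 -(hS (w t')).
rewrite -!(mulrA _ (w s)) !wc // !mulrA; congr (_ * _).
have [_ sM _ _] := E cs.
by rewrite -!(mulrA S) -!sM -!mulrA (mulrA (w t')) w2 // mul1r.
Qed.

Let gul s : C s -> gt idfun s * gu = 1.
Proof.
move=> cs; have ci := obj_id C.
have c1 : C (g idfun \o g s) by apply: obj_comp; auto.
have h1 : hom (g s) (g idfun \o g s) gu by exact: (@homR idfun _ (g s)) guP.
have h2 : hom (g idfun \o g s) (g s) (gt idfun s) by exact: gtP ci cs.
apply: (ae_faithful (F := F) (gP cs) (gP cs)); [exact: homM h1 h2|exact: hom1|].
rewrite (comp3 (gP cs) c1 (gP cs) h1 h2) ae_id; auto.
have := @ae_tensor F _ _ _ _ _ _ ci (gP ci) (gP cs) (gP cs) guP (hom1 (g s)).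
rewrite mulr1 ae_id ?ae_obj1 ?mulr1 ?ae_unitlE /=; auto => E1.
rewrite [X in _ * X]E1 [X in X * _](Fgt ci cs) Fgu /=.
rewrite -!mulrA (mulrA (st (ae_ten F (g idfun) (g s)))) tU1 ?mul1r; auto.
have [u1 _] := ae_unitU F.
by rewrite u1 mulr1 (mulrA (w _)) wc // -(mulrA (idfun _)) w2 // mulr1 /= w1.
Qed.

Let gur s : C s -> gt s idfun * g s gu = 1.
Proof.
move=> cs; have ci := obj_id C.
have c1 : C (g s \o g idfun) by apply: obj_comp; auto.
have h1 : hom (g s) (g s \o g idfun) (g s gu) by exact: homI (E (gP cs)) guP.
have h2 : hom (g s \o g idfun) (g s) (gt s idfun) by exact: gtP cs ci.
apply: (ae_faithful (F := F) (gP cs) (gP cs)); [exact: homM h1 h2|exact: hom1|].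
rewrite (comp3 (gP cs) c1 (gP cs) h1 h2) ae_id; auto.
have := @ae_tensor F _ _ _ _ _ _ (gP cs) (gP cs) ci (gP ci) (hom1 (g s)) guP.
rewrite !mul1r ae_id ?mul1r /=; auto => E1.
rewrite [X in _ * X]E1 [X in X * _](Fgt cs ci) Fgu /=.
rewrite -!mulrA (mulrA (st (ae_ten F (g s) (g idfun)))) tU1 ?mul1r; auto.
rewrite (mulrA (st (w s))) w1 // mul1r (mulrA (F (g s) _)) -ae_objM; auto.
rewrite mulrA w2 // mul1r ae_objS; auto.
by rewrite -starM ae_unitr ?st1; auto.
Qed.

Lemma ae_inv0_ax : is_autoeq C (AutoeqData g gm gt gu).
Proof.
refine (@IsAutoeq C (AutoeqData g gm gt gu)
  gP gmP _ _ _ _ _ _ _ gtP _ gN gA guP _ gul gur) => /=.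
- move=> s t c T T' cs ct h1 h2.
  have hL : hom s t (c *: T + T') by apply: homL; auto.
  have hR : hom (g s) (g t) (c *: gm s t T + gm s t T') by apply: homL; auto.
  apply: (ae_faithful (F := F) (gP cs) (gP ct)) => //; first exact: gmP.
  rewrite Fgm // ae_lin; auto; rewrite !Fgm // mulrDr mulrDl.
  by rewrite -scalerAr -scalerAl.
- move=> s t k T T' cs ct ck h1 h2; have hc := homM h1 h2.
  apply: (ae_faithful (F := F) (gP cs) (gP ck)).
  + exact: gmP.
  + exact: homM (gmP cs ct h1) (gmP ct ck h2).
  rewrite (comp3 (gP cs) (gP ct) (gP ck) (gmP cs ct h1) (gmP ct ck h2)) !Fgm //.
  by rewrite !mulrA -(mulrA _ (w t)) w2 // mulr1.
- move=> s cs; apply: (ae_faithful (F := F) (gP cs) (gP cs)).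
  + by apply: gmP => //; exact: hom1.
  + exact: hom1.
  by rewrite Fgm ?ae_id ?mulr1 ?w1; auto; exact: hom1.
- move=> s t T cs ct h1; have h2 := homV (E cs) (E ct) h1.
  apply: (ae_faithful (F := F) (gP ct) (gP cs)); first exact: gmP.
    by apply: homV; auto.
  by rewrite ae_star; auto; rewrite !Fgm // !starM starK mulrA.
- move=> s t T T' cs ct h1 h2 /(congr1 (ae_mor F (g s) (g t))).
  rewrite !Fgm // => /(congr1 (fun x => w t * x * st (w s))).
  by rewrite -!mulrA w2 // !mulr1 !mulrA w2 // !mul1r.
- move=> s t X cs ct hX; have hF := ae_morP F (gP cs) (gP ct) hX.
  have hY := homM (homM (wV cs) hF) (wP ct).
  exists (w t * (ae_mor F (g s) (g t) X * st (w s))) => //.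
  apply: (ae_faithful (F := F) (gP cs) (gP ct)) => //; first exact: gmP.
  by rewrite Fgm // !mulrA w1 // mul1r -mulrA w1 // mulr1.
- move=> t ct; exists (F t); first exact: ae_objP.
  have cF : C (F t) by exact: ae_objP.
  exists (h (g (F t)) t (w (F t))); first by apply: hP; auto.
  apply: (ae_unitary_refl (F := F) (gP cF) ct); first by apply: hP; auto.
  by rewrite hK; auto.
- move=> s t cs ct; apply: (ae_unitary_refl (F := F) (gg cs ct) (g2 cs ct) (gtP cs ct)).
  rewrite Fgt //; apply: unitaryM; last by apply/unitaryV/ae_tenU; auto.
  have cst := obj_comp cs ct.
  apply: unitaryM; first by apply: unitaryV; auto.
  by apply: unitaryM; auto; apply: unitary_endo; auto.
- have ci := obj_id C; apply: (ae_unitary_refl (F := F) ci (gP ci) guP).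
  by rewrite Fgu; apply: unitaryM; apply: unitaryV; auto; exact: ae_unitU.
Qed.

Definition ae_inv0 : autoeq C := Autoeq ae_inv0_ax.

Lemma ae_inv0P : mon_iso (F \* ae_inv0) (ae_one).
Proof.
have ci := obj_id C; have [u1 u2] := ae_unitU F.
exists w, (fun s => st (w s)); split=> /=;
  rewrite /aec_obj /aec_mor /aec_ten /aec_unit /=.
- by move=> s cs; split; auto.
- by move=> s t T cs ct hT; rewrite Fgm // !mulrA w2 // mul1r.
- move=> s t cs ct; rewrite Fgt // mul1r -!mulrA tU1; auto; rewrite mulr1.
  by rewrite mulrA w2 ?mul1r //; exact: obj_comp.
- by rewrite Fgu -mulrA u1 mulr1 w2.
Qed.

End Inverse.

Lemma ae_inv F : exists K, mon_iso (F \* K) (ae_one).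
Proof.
have H1 t : exists p : (M -> M) * M,
    C t -> [/\ C p.1, hom (F p.1) t p.2 & unitary p.2].
  have [ct|nct] := pselect (C t); last by exists (t, 1).
  by have [s cs [u hu uu]] := ae_surj F ct; exists (s, u).
have [p pP] := choice H1.
have H2 q : exists T, C q.1.1 -> C q.1.2 -> hom (F q.1.1) (F q.1.2) q.2 ->
    hom q.1.1 q.1.2 T /\ ae_mor F q.1.1 q.1.2 T = q.2.
  have [c1|n] := pselect (C q.1.1); last by exists 0.
  have [c2|n] := pselect (C q.1.2); last by exists 0.
  have [hX|n] := pselect (hom (F q.1.1) (F q.1.2) q.2); last by exists 0.
  by have [T hT e] := ae_full c1 c2 hX; exists T.
have [h hP] := choice H2.
pose g t := (p t).1; pose w t := (p t).2.
have gP t : C t -> C (g t) by move=> /pP [].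
have wP t : C t -> hom (F (g t)) t (w t) by move=> /pP [].
have wU t : C t -> unitary (w t) by move=> /pP [].
have h1 s t X : C s -> C t -> hom (F s) (F t) X -> hom s t (h (s, t, X)).
  by move=> cs ct hX; have [] := hP (s, t, X) cs ct hX.
have h2 s t X : C s -> C t -> hom (F s) (F t) X -> ae_mor F s t (h (s, t, X)) = X.
  by move=> cs ct hX; have [] := hP (s, t, X) cs ct hX.
exists (ae_inv0 (h := fun s t X => h (s, t, X)) gP wP wU h1 h2); exact: ae_inv0P.
Qed.

(* An invertible object of C is an automorphism a of M (M being a factor and C
   replete), whose inverse b is again an object of C.  Conjugation by a is a
   strict tensor functor: s |-> a \o s \o b on objects and T |-> a T on
   morphisms. *)
Definition inner_pair (a b : M -> M) : Prop :=
  [/\ C a, C b, a \o b = idfun & b \o a = idfun].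

Definition ae_conj_data (a b : M -> M) : autoeq_data :=
  AutoeqData (fun s => a \o s \o b) (fun _ _ T => a T) (fun _ _ => 1) 1.

Lemma ae_conj_ax a b : inner_pair a b -> is_autoeq C (ae_conj_data a b).
Proof.
move=> [ca cb e1 e2].
have k1 x : a (b x) = x by exact: (congr1 (@^~ x) e1).
have k2 x : b (a x) = x by exact: (congr1 (@^~ x) e2).
have [a1 a2 a3 a4] := obj_endo ca; have [b1 b2 b3 b4] := obj_endo cb.
have cab s : C s -> C (a \o s \o b) by move=> cs; do 2 apply: obj_comp => //.
split=> //=.
- by move=> s t T cs ct h x /=; rewrite -!a2 h.
- by move=> s t T T' _ _ _ _ /(congr1 b); rewrite !k2.
- move=> s t X cs ct h; exists (b X); last exact: k1.
  by move=> x; have := congr1 b (h (a x)); rewrite /= !b2 !k2.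
- move=> t ct; exists (b \o t \o a); first by do 2 apply: obj_comp => //.
  exists 1; last exact: unitary1.
  by move=> x /=; rewrite !k1 mul1r mulr1.
- by move=> s t cs ct x /=; rewrite k2 mul1r mulr1.
- by move=> *; apply: unitary1.
- by move=> s s' t t' S T *; rewrite /= mul1r mulr1 k2 a2.
- move=> s t k cs ct ck; rewrite b3; have [_ _ -> _] := obj_endo cs.
  by rewrite a3.
- by move=> x /=; rewrite mul1r mulr1 k1.
- exact: unitary1.
- by move=> *; rewrite mulr1.
- by move=> s cs; rewrite b3; have [_ _ -> _] := obj_endo cs; rewrite a3 mulr1.
Qed.

Definition ae_conj a b (ab : inner_pair a b) : autoeq C :=
  Autoeq (ae_conj_ax ab).

Lemma inner_pair1 : inner_pair idfun idfun.
Proof. by split=> //; exact: obj_id. Qed.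

Lemma inner_pairV a b : inner_pair a b -> inner_pair b a.
Proof. by case. Qed.

Lemma inner_pairM a b a' b' : inner_pair a b -> inner_pair a' b' ->
  inner_pair (a \o a') (b' \o b).
Proof.
move=> [ca cb e1 e2] [ca' cb' e1' e2']; split; try exact: obj_comp.
  by rewrite -[LHS]/(a \o (a' \o b') \o b) e1' -[LHS]/(a \o b).
by rewrite -[LHS]/(b' \o (b \o a) \o a') e2 -[LHS]/(b' \o a').
Qed.

Lemma ae_conj1 (ab : inner_pair idfun idfun) : mon_iso (ae_conj ab) (ae_one).
Proof.
exact: mon_iso_strict.
Qed.

Lemma ae_conjE a b (ab : inner_pair a b) :
  [/\ forall s, ae_conj ab s = a \o s \o b,
      forall s t T, ae_mor (ae_conj ab) s t T = a T,
      forall s t, ae_ten (ae_conj ab) s t = 1 & ae_unit (ae_conj ab) = 1].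
Proof. by []. Qed.

Lemma ae_conjM a b a' b' (ab : inner_pair a b) (ab' : inner_pair a' b')
    (ab2 : inner_pair (a \o a') (b' \o b)) :
  mon_iso (ae_conj ab \* ae_conj ab') (ae_conj ab2).
Proof.
have a1 : a 1 = 1 by have [ca _ _ _] := ab; have [_ _ -> _] := obj_endo ca.
by apply: mon_iso_strict => //=; rewrite /aec_ten /aec_unit /= => *; rewrite a1 mulr1.
Qed.

Section Cross.
Variables (F : autoeq C) (a b : M -> M).
Hypothesis ab : inner_pair a b.

Let ca : C a. Proof. by case: ab. Qed.
Let cb : C b. Proof. by case: ab. Qed.
Let eab : a \o b = idfun. Proof. by case: ab. Qed.
Let eba : b \o a = idfun. Proof. by case: ab. Qed.
Let ci : C idfun. Proof. exact: obj_id. Qed.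

Let u := ae_unit F.
Let J := ae_ten F.
Variables w v z : M.
Hypothesis wD : w = st (J a b) * u.
Hypothesis vD : v = F b w.
Hypothesis zD : z = st u * J b a.
Let c x := F b (st w * x * w).

Let wU : unitary w.
Proof.
by rewrite wD; apply: unitaryM; [apply/unitaryV/ae_tenU|exact: ae_unitU].
Qed.

Let ww : w * st w = 1. Proof. by case: wU. Qed.

Let wh : hom idfun (F a \o F b) w.
Proof.
rewrite wD; apply: (homM (t := F idfun)); first exact: ae_unitP.
apply: homV; [by apply: endo_comp; exact: ae_objE|exact: ae_objE|].
by rewrite -eab; exact: ae_tenP.
Qed.

Let wE x : F a (F b x) = w * x * st w.
Proof. by have /= -> := wh x; rewrite -mulrA ww mulr1. Qed.

Let zU : unitary z.
Proof. by rewrite zD; apply: unitaryM; [exact/unitaryV/ae_unitU|exact: ae_tenU]. Qed.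

Let zh : hom (F b \o F a) idfun z.
Proof.
rewrite zD; apply: (homM (t := F idfun)); first by rewrite -eba; exact: ae_tenP.
by apply: homV; [exact: endo_id|exact: ae_objE|exact: ae_unitP].
Qed.

Let cE x : c x = st v * F b x * v.
Proof. by rewrite /c vD ae_objM // ae_objM // ae_objS. Qed.

Let vU : unitary v. Proof. by rewrite vD; apply: unitary_endo => //; exact: ae_objE. Qed.

Let vc x : v * c x = F b x * v.
Proof. by rewrite cE !mulrA; case: vU => _ ->; rewrite mul1r. Qed.

Let cC : C c.
Proof.
have e : c = fun x => st v * F b x * st (st v) by apply/funext => x; rewrite starK.
have vV := unitaryV vU; rewrite e; apply: (obj_replete (ae_objP F cb)).
  by apply: endo_Ad => //; exact: ae_objE.
exact: iso_Ad.
Qed.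

Let Finj x y : F a x = F a y -> x = y.
Proof.
move=> /(congr1 (F b)) e.
have [_ z2] := zU.
have ex : x * z = y * z by have /= <- := zh x; have /= <- := zh y; rewrite e.
by rewrite -[x]mulr1 -z2 mulrA ex -mulrA z2 mulr1.
Qed.

Let Fac x : F a (c x) = x.
Proof. by rewrite /c wE !mulrA ww mul1r -!mulrA ww mulr1. Qed.

Lemma inner_pair_ae : inner_pair (F a) c.
Proof.
split=> //; first exact: ae_objP; apply/funext => x /=; first exact: Fac.
by apply: Finj; rewrite Fac.
Qed.

Let Fav : F a v = w.
Proof. by rewrite vD wE -mulrA ww mulr1. Qed.

Let zE t : C t -> J b (a \o t) * F b (J a t) = z.
Proof.
move=> ct; have := ae_tenA F cb ca ct; rewrite eba zD => <-.
by rewrite -[ae_ten F idfun t]starK ae_unitlE.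
Qed.

Let zv : z * v = 1.
Proof.
rewrite -(zE cb) eab vD -mulrA -ae_objM // wD (mulrA (J a b)).
have [_ ->] := ae_tenU F ca cb; rewrite mul1r; exact: (ae_unitr F cb).
Qed.

Let f s := J (a \o s) b * (J a s * F a (F s v)).

Let fU s : C s -> unitary (f s).
Proof.
move=> cs; have cas := obj_comp ca cs.
apply: unitaryM; first exact: ae_tenU.
apply: unitaryM; first exact: ae_tenU.
by do 2 (apply: unitary_endo; first exact: ae_objE).
Qed.

Let key t : C t -> J b (a \o t \o b) * F b (f t) * v = J t b * F t v.
Proof.
move=> ct; have cat := obj_comp ca ct.
have A : J t b * J b (a \o t) = J b (a \o t \o b) * F b (J (a \o t) b).
  have := ae_tenA F cb cat cb.
  by rewrite -[b \o (a \o t)]/((b \o a) \o t) eba -[idfun \o t]/t.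
rewrite /f !ae_objM // !mulrA -A -(mulrA (J t b)) zE //.
by rewrite -!mulrA; congr (_ * _); rewrite mulrA (zh (F t v)) -mulrA zv mulr1.
Qed.

Lemma ae_cross (h' : inner_pair (F a) c) :
  mon_iso (ae_conj h' \* F) (F \* ae_conj ab).
Proof.
have [p1 p2 p3 p4] := ae_conjE ab; have [q1 q2 q3 q4] := ae_conjE h'.
exists f, (fun s => st (f s)); split=> /=;
  rewrite /aec_obj /aec_mor /aec_ten /aec_unit.
- move=> s cs; have cas := obj_comp ca cs; have [f1 f2] := fU cs; split=> //.
  rewrite p1 q1 /f; apply: (homM (t := F (a \o s) \o F b)); last exact: ae_tenP.
  apply: (homM (t := F a \o F s \o F b)); last first.
    exact: (@homR _ _ (F b)) (ae_tenP F ca cs).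
  move=> x /=; rewrite -!ae_objM //; congr (F a (F s _)); exact: vc.
- move=> s t T cs ct h; have cas := obj_comp ca cs; have cat := obj_comp ca ct.
  have hT := ae_morP F cs ct h.
  have ha : hom (a \o s) (a \o t) (a T) by apply: homI => //; exact: (obj_endo ca).
  rewrite !q2 p2 !p1 /f -!mulrA -ae_objM // -hT.
  have := @ae_tenN _ F a a s t 1 T ca ca cs ct (hom1 a) h.
  rewrite mul1r ae_id // mul1r => N1.
  have := @ae_tenN _ F _ _ b b (a T) 1 cas cat cb cb ha (hom1 b).
  have -> : (a \o s) 1 = 1 by have [_ _ -> _] := obj_endo cas.
  rewrite mulr1 ae_id // ae_obj1 // mulr1 => N2.
  by rewrite ae_objM // (mulrA (J a t)) -N1 !mulrA N2.
- move=> s t cs ct; have cas := obj_comp ca cs; have cat := obj_comp ca ct.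
  have cst := obj_comp cs ct.
  have casb := obj_comp cas cb; have catb := obj_comp cat cb.
  rewrite q2 q3 mulr1 p3 q1 !p1.
  have a1 : a 1 = 1 by have [_ _ -> _] := obj_endo ca.
  have -> : ae_mor F (a \o s \o b \o (a \o t \o b)) (a \o (s \o t) \o b) 1 = 1.
    rewrite -[X in ae_mor F X]/(a \o s \o (b \o a) \o (t \o b)) eba.
    by apply: ae_id; exact: obj_comp (obj_comp ca cst) cb.
  rewrite mul1r.
  have R1 : f s * F a (F s (c (f t))) =
      J (a \o s) b * (J a s * F a (F s (F b (f t) * v))).
    by rewrite /f -!mulrA -!ae_objM // -vc.
  have A1 : J (a \o s \o b) (a \o t \o b) * J (a \o s) b =
      J (a \o s) (t \o b) * F (a \o s) (J b (a \o t \o b)).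
    have := ae_tenA F cas cb catb.
    by rewrite -[b \o (a \o t \o b)]/((b \o a) \o (t \o b)) eba.
  have T1 x : F (a \o s) x * J a s = J a s * F a (F s x).
    by have /(_ x) /= -> := ae_tenP F ca cs.
  rewrite [X in _ = _ * X]R1 mulrA A1 -!mulrA (mulrA (F (a \o s) _)) T1.
  rewrite -(mulrA (J a s)) -!ae_objM // (mulrA (J b _)) key //.
  have T2 x : F (s \o t) x * J s t = J s t * F s (F t x).
    by have /(_ x) /= -> := ae_tenP F cs ct.
  rewrite T2 !ae_objM //.
  have A2 : J (a \o s) t * J a s = J a (s \o t) * F a (J s t).
    exact: ae_tenA.
  have A3 : J (a \o (s \o t)) b * J (a \o s) t =
      J (a \o s) (t \o b) * F (a \o s) (J t b).
    exact: (ae_tenA F cas ct cb).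
  rewrite (mulrA (J a (s \o t))) -A2 -(mulrA (J (a \o s) t)) mulrA A3.
  rewrite -[LHS]mulrA; congr (_ * _).
  by rewrite mulrA T1 -mulrA.
- rewrite q2 q4 mulr1 p4 p1.
  have -> : ae_mor F idfun (a \o idfun \o b) 1 = 1.
    by rewrite -[a \o idfun \o b]/(a \o b) eab ae_id.
  have a1 : a 1 = 1 by have [_ _ -> _] := obj_endo ca.
  rewrite mul1r /f -!mulrA -ae_objM //.
  have -> : F idfun v * ae_unit F = ae_unit F * v by have /= <- := ae_unitP F v.
  rewrite ae_objM // Fav (mulrA (J a idfun)) ae_unitr // mul1r.
  rewrite -[a \o idfun]/a wD mulrA; have [_ ->] := ae_tenU F ca cb.
  by rewrite mul1r.
Qed.

End Cross.

(* Equality in Out(C): monoidal isomorphism up to inner autoequivalences. *)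
Definition out_eq (F K : autoeq C) : Prop :=
  exists a b (ab : inner_pair a b), mon_iso F (ae_conj ab \* K).

Lemma out_of_iso F K : mon_iso F K -> out_eq F K.
Proof.
move=> h; exists idfun, idfun, inner_pair1; apply: mon_iso_trans h _.
apply: mon_iso_trans (mon_iso_sym (ae_mul1 K)) _.
by apply: ae_mulCr; apply: mon_iso_sym; apply: ae_conj1.
Qed.

Lemma out_refl F : out_eq F F.
Proof. by apply: out_of_iso; apply: mon_iso_refl. Qed.

Lemma out_sym F K : out_eq F K -> out_eq K F.
Proof.
move=> [a [b [ab h]]]; exists b, a, (inner_pairV ab).
have ba := inner_pairV ab.
apply: mon_iso_sym; apply: mon_iso_trans (ae_mulCl _ h) _.
apply: mon_iso_trans (ae_mulA _ _ _) _.
apply: mon_iso_trans (ae_mul1 K); apply: ae_mulCr.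
have e := inner_pairM (inner_pairV ab) ab.
apply: mon_iso_trans (ae_conjM _ _ e) _.
have E : b \o a = idfun by have [_ _ _ ->] := ab.
move: e; rewrite E => e; exact: ae_conj1.
Qed.

Lemma out_trans F K L : out_eq F K -> out_eq K L -> out_eq F L.
Proof.
move=> [a [b [ab h]]] [a' [b' [ab' h']]].
exists (a \o a'), (b' \o b), (inner_pairM ab ab').
apply: mon_iso_trans h _; apply: mon_iso_trans (ae_mulCl _ h') _.
apply: mon_iso_trans (ae_mulA _ _ _) _; apply: ae_mulCr; exact: ae_conjM.
Qed.

Lemma out_mul F F' K K' : out_eq F F' -> out_eq K K' ->
  out_eq (F \* K) (F' \* K').
Proof.
move=> [a [b [ab h]]] [a' [b' [ab' h']]].
have hc := inner_pair_ae ab' (erefl _) (erefl (F' b' _)) (erefl _).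
exists (a \o F' a'), (_ \o b), (inner_pairM ab hc).
apply: mon_iso_trans (ae_mulCr _ h) _.
apply: mon_iso_trans (ae_mulCl _ h') _.
apply: mon_iso_trans (mon_iso_sym (ae_mulA _ _ _)) _.
apply: mon_iso_trans (ae_mulCl _ (ae_mulA _ _ _)) _.
apply: mon_iso_trans (ae_mulCl _ (ae_mulCr _ (mon_iso_sym (ae_cross ab' (erefl _) (erefl _) (erefl _) hc)))) _.
apply: mon_iso_trans (ae_mulCl _ (mon_iso_sym (ae_mulA _ _ _))) _.
apply: mon_iso_trans (ae_mulA _ _ _) _.
by apply: ae_mulCr; apply: ae_conjM.
Qed.

Definition out_preGroup : preGroup.
Proof.
refine (@PreGroup (autoeq C) out_eq ae_mul (ae_one)
  out_refl out_sym out_trans out_mul _ _ _ _).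
- by move=> F K L; apply/out_of_iso/ae_mulA.
- by move=> F; apply/out_of_iso/ae_mul1.
- by move=> F; apply/out_of_iso/ae_mulr1.
- by move=> F; have [K h] := ae_inv F; exists K; apply: out_of_iso.
Defined.

Definition Out : groupType := pg_quot out_preGroup.

End Category.
End StarTensor.

Record hilbert (R : realType) := Hilbert {
  hcar :> lmodType R[i];
  ip : hcar -> hcar -> R[i];
  ipL : forall (c : R[i]) x y z, ip x (c *: y + z) = c * ip x y + ip x z;
  ipC : forall x y, ip y x = Num.conj (ip x y);
  ip_ge0 : forall x, 0 <= ip x x;
  ip_eq0 : forall x, ip x x = 0 -> x = 0;
  ip_complete : forall u : nat -> hcar,
    (forall e : R[i], 0 < e -> exists N, forall m n, (N <= m)%N -> (N <= n)%N ->
       ip (u m - u n) (u m - u n) < e) ->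
    exists l, forall e : R[i], 0 < e -> exists N, forall n, (N <= n)%N ->
       ip (u n - l) (u n - l) < e;
  ip_separable : exists u : nat -> hcar, forall x (e : R[i]), 0 < e ->
    exists n, ip (x - u n) (x - u n) < e }.

Section Factor.
Variables (R : realType) (M : starAlg R) (H : hilbert R) (pi : M -> H -> H).
Local Notation st := (@star R M).

Definition bounded_op (A : H -> H) : Prop :=
  (forall (c : R[i]) x y, A (c *: x + y) = c *: A x + A y) /\
  exists k : R[i], forall x, ip (A x) (A x) <= k * ip x x.

Definition commutant (S : (H -> H) -> Prop) : (H -> H) -> Prop :=
  fun A => bounded_op A /\ forall B, S B -> forall x, A (B x) = B (A x).

Definition operators : (H -> H) -> Prop := fun A => exists a, A = pi a.

Definition vonNeumann_rep : Prop :=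
  [/\ forall (c : R[i]) a b x, pi (c *: a + b) x = c *: pi a x + pi b x,
      (forall a b x, pi (a * b) x = pi a (pi b x)) /\ (forall x, pi 1 x = x),
      forall a x y, ip x (pi a y) = ip (pi (st a) x) y,
      forall a, bounded_op (pi a) /\ ((forall x, pi a x = 0) -> a = 0) &
      forall A, commutant (commutant operators) A -> operators A].

Definition factor : Prop :=
  forall a : M, (forall b, a * b = b * a) -> exists c : R[i], a = c%:A.

Definition findim_star_subalg (N : M -> Prop) : Prop :=
  [/\ N 1, forall (c : R[i]) a b, N a -> N b -> N (c *: a + b),
      forall a b, N a -> N b -> N (a * b), forall a, N a -> N (st a) &
      exists (n : nat) (V : 'I_n -> M), forall a, N a ->
        exists c : 'I_n -> R[i], a = \sum_i c i *: V i].

Definition hyperfinite : Prop :=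
  exists N : nat -> M -> Prop,
  [/\ forall k, findim_star_subalg (N k),
      forall k a, N k a -> N k.+1 a &
      forall A, commutant (commutant (fun B => exists k a, N k a /\ B = pi a)) A <->
                operators A].

Definition normal_state (phi : M -> R[i]) : Prop :=
  phi 1 = 1 /\
  exists xi : nat -> H, forall a (e : R[i]), 0 < e ->
    exists N, forall n, (N <= n)%N ->
      `|phi a - \sum_(i < n) ip (xi i) (pi a (xi i))| < e.

Definition faithful_state (phi : M -> R[i]) : Prop :=
  forall a, phi (st a * a) = 0 -> a = 0.

(* t belongs to the spectrum of the modular operator D of phi, for t > 0.  In
   the GNS space of phi, D is the positive selfadjoint operator of the closure
   of the quadratic form x |-> phi (x x^* ) on M, so <D^(1/2) y, D^(1/2) x> is
   phi (x y^* ) while <y, x> is phi (y^* x); M is a core of D^(1/2) and t is in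
   the spectrum iff the form <D^(1/2) y, D^(1/2) x> - t <y, x> has approximate
   null vectors x for the graph norm of D^(1/2). *)
Definition in_modular_spectrum (phi : M -> R[i]) (t : R[i]) : Prop :=
  forall e : R[i], 0 < e -> exists x,
    phi (st x * x) + phi (x * st x) = 1 /\
    forall y, `|phi (x * st y) - t * phi (st y * x)| ^+ 2 <=
              e * (phi (st y * y) + phi (y * st y)).

(* Connes' invariant S(M), the intersection of the spectra of the modular
   operators of the faithful normal states, is the whole half-line [0, +oo);
   0 then belongs to it because spectra are closed. *)
Definition typeIII1 : Prop :=
  forall phi, normal_state phi -> faithful_state phi ->
  forall t : R[i], 0 < t -> in_modular_spectrum phi t.

End Factor.

Definition hyperfinite_III1_factor (R : realType) (M : starAlg R) : Prop :=
  exists (H : hilbert R) (pi : M -> H -> H),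
    [/\ vonNeumann_rep pi, factor M, hyperfinite pi & typeIII1 pi].

Local Close Scope complex_scope.

Section Gamma.
Variables (R : realType) (G : finZmodType).
Implicit Types (om : G -> G -> R[i]) (g h k p : G).

Definition cocycle om : Prop :=
  (forall g h, `|om g h| = 1) /\
  (forall g h k, om h k * om g (h + k) = om g h * om (g + h) k).

Definition cohomologous om om' : Prop :=
  exists la : G -> R[i], (forall g, `|la g| = 1) /\
    (forall g h, om' g h = om g h * (la g * la h / la (g + h))).

(* Representatives (om, p, theta) of the elements ([om], p + 2G) theta of
   (H^2(G, T) x G/2G) x| Aut(G). *)
Record gamma_rep := GammaRep {
  g_coc : G -> G -> R[i];
  g_pt : G;
  g_aut : {perm G};
  g_cocP : cocycle g_coc;
  g_autP : {morph g_aut : x y / x + y} }.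

Implicit Types c : gamma_rep.

Definition gamma_eq c c' : Prop :=
  [/\ cohomologous (g_coc c) (g_coc c'),
      exists q, g_pt c' = g_pt c + q *+ 2 &
      g_aut c = g_aut c'].

Lemma autV (t : {perm G}) : {morph t : x y / x + y} ->
  {morph (t^-1)%g : x y / x + y}.
Proof. by move=> tD x y; apply: (@perm_inj _ t); rewrite tD !permKV. Qed.

Lemma aut0 (t : {perm G}) : {morph t : x y / x + y} -> t 0 = 0.
Proof. by move=> tD; apply: (addrI (t 0)); rewrite -tD !addr0. Qed.

Lemma autN (t : {perm G}) : {morph t : x y / x + y} -> {morph t : x / - x}.
Proof.
by move=> tD x; apply: (addrI (t x)); rewrite -tD !subrr aut0.
Qed.

Lemma autMn (t : {perm G}) n : {morph t : x y / x + y} ->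
  {morph t : x / x *+ n}.
Proof.
move=> tD x; elim: n => [|n IH]; first by rewrite !mulr0n aut0.
by rewrite !mulrS tD IH.
Qed.

Lemma g_mul_cocP c c' : cocycle (fun g h => g_coc c g h *
  g_coc c' ((g_aut c)^-1%g g) ((g_aut c)^-1%g h)).
Proof.
have [u1 a1] := g_cocP c; have [u2 a2] := g_cocP c'.
have D := autV (@g_autP c).
split=> [g h|g h k]; first by rewrite normrM u1 u2 mulr1.
by rewrite !D mulrACA a1 a2 mulrACA.
Qed.

Lemma g_mul_autP c c' : {morph (g_aut c' * g_aut c)%g : x y / x + y}.
Proof. by move=> x y; rewrite !permM !g_autP. Qed.

(* ([om], p, theta) ([om'], p', theta')
   = ([om] theta([om']), p + theta(p'), theta \o theta');
   the product of {perm G} composes from left to right. *)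
Definition gamma_mul c c' : gamma_rep :=
  GammaRep (g_pt c + g_aut c (g_pt c')) (g_mul_cocP c c')
           (@g_mul_autP c c').

Lemma cocycle1 : cocycle (fun _ _ => 1).
Proof. by split=> *; rewrite ?normr1. Qed.

Lemma autP1 : {morph (1%g : {perm G}) : x y / x + y}.
Proof. by move=> x y; rewrite !perm1. Qed.

Definition gamma_one : gamma_rep := GammaRep (0) cocycle1 autP1.

Lemma norm1_neq0 (z : R[i]) : `|z| = 1 -> z != 0.
Proof. by move=> z1; rewrite -normr_eq0 z1 oner_eq0. Qed.

Lemma coh_refl om : cohomologous om om.
Proof.
by exists (fun=> 1); split=> *; rewrite ?normr1 // divr1 !mulr1.
Qed.

Lemma coh_sym om om' : cohomologous om om' -> cohomologous om' om.
Proof.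
move=> [la [l1 l2]]; have n g : la g != 0 by apply: norm1_neq0.
exists (fun g => (la g)^-1); split=> [g|g h]; first by rewrite normfV l1 invr1.
by rewrite l2; field; rewrite !n.
Qed.

Lemma coh_mul om1 om2 om1' om2' : cohomologous om1 om1' ->
  cohomologous om2 om2' ->
  cohomologous (fun g h => om1 g h * om2 g h) (fun g h => om1' g h * om2' g h).
Proof.
move=> [la [l1 l2]] [mu [m1 m2]]; exists (fun g => la g * mu g).
split=> [g|g h]; first by rewrite normrM l1 m1 mulr1.
rewrite l2 m2 mulrACA; congr (_ * _).
by rewrite mulrACA -invfM (mulrACA (la g)).
Qed.

Lemma coh_trans om1 om2 om3 :
  cohomologous om1 om2 -> cohomologous om2 om3 -> cohomologous om1 om3.
Proof.
move=> [la [l1 l2]] [mu [m1 m2]]; exists (fun g => la g * mu g).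
split=> [g|g h]; first by rewrite normrM l1 m1 mulr1.
rewrite m2 l2 -mulrA; congr (_ * _).
by rewrite mulrACA -invfM (mulrACA (la g)).
Qed.

Lemma coh_aut (t : {perm G}) om om' : {morph t : x y / x + y} ->
  cohomologous om om' ->
  cohomologous (fun g h => om (t g) (t h)) (fun g h => om' (t g) (t h)).
Proof.
by move=> tD [la [l1 l2]]; exists (la \o t); split=> //= g h; rewrite l2 tD.
Qed.

Lemma gamma_refl c : gamma_eq c c.
Proof.
by split=> //; [apply: coh_refl|exists 0; rewrite mul0rn addr0].
Qed.

Lemma gamma_sym c c' : gamma_eq c c' -> gamma_eq c' c.
Proof.
move=> [h1 [q h2] h3]; split=> //; first exact: coh_sym.
by exists (- q); rewrite h2 mulNrn addrK.
Qed.

Lemma gamma_trans c1 c2 c3 : gamma_eq c1 c2 -> gamma_eq c2 c3 -> gamma_eq c1 c3.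
Proof.
move=> [h1 [q h2] h3] [k1 [r k2] k3]; split; first exact: coh_trans h1 k1.
  by exists (q + r); rewrite k2 h2 mulrnDl [RHS]addrA.
by rewrite h3.
Qed.

Lemma gamma_mulC c1 c1' c2 c2' : gamma_eq c1 c1' -> gamma_eq c2 c2' ->
  gamma_eq (gamma_mul c1 c2) (gamma_mul c1' c2').
Proof.
move=> [h1 [q h2] h3] [k1 [r k2] k3]; split=> /=.
- rewrite h3; apply: coh_mul => //; apply: coh_aut => //.
  exact/autV/g_autP.
- exists (q + g_aut c1 r); rewrite h2 k2 -h3 g_autP autMn; last exact: g_autP.
  by rewrite mulrnDl addrACA.
- by rewrite h3 k3.
Qed.

Lemma gamma_eqI c c' : g_coc c =2 g_coc c' -> g_pt c = g_pt c' ->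
  g_aut c = g_aut c' -> gamma_eq c c'.
Proof.
move=> h1 h2 h3; split=> //; last by exists 0; rewrite mul0rn addr0.
exists (fun=> 1); split=> *; rewrite ?normr1 // h1 divr1 !mulr1 //.
Qed.

Definition gamma_preGroup : preGroup.
Proof.
refine (@PreGroup gamma_rep gamma_eq gamma_mul gamma_one
  gamma_refl gamma_sym gamma_trans gamma_mulC _ _ _ _).
- move=> x y z; apply: gamma_eqI => /=; last by rewrite mulgA.
    by move=> g h; rewrite invgM !permM mulrA.
  by rewrite g_autP permM addrA.
- move=> x; apply: gamma_eqI => /=; last by rewrite mulg1.
    by move=> g h; rewrite mul1r invg1 !perm1.
  by rewrite perm1 add0r.
- move=> x; apply: gamma_eqI => /=; last by rewrite mul1g.
    by move=> g h; rewrite mulr1.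
  by rewrite aut0 ?addr0 //; exact: g_autP.
- move=> x; have tD := @g_autP x; have [u1 a1] := g_cocP x.
  have n g h : g_coc x g h != 0 by apply: norm1_neq0.
  have P : cocycle (fun g h => (g_coc x (g_aut x g) (g_aut x h))^-1).
    split=> [g h|g h k]; first by rewrite normfV u1 invr1.
    by rewrite -!invfM !tD a1.
  exists (GammaRep (- ((g_aut x)^-1%g (g_pt x))) P (autV tD)).
  apply: gamma_eqI => /=; last by rewrite mulVg.
    by move=> g h; rewrite !permKV divff.
  by rewrite autN // permKV subrr.
Defined.

Definition Gamma : groupType := pg_quot gamma_preGroup.

Record numdata := NumData {
  eps : G -> G -> R[i];          (* eps h g is epsilon_h(g) *)
  eta : G -> R[i];
  amp : G -> G -> G -> R[i] }.   (* amp g h k is A_g(h, k) *)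

Definition dimH : R := (#|G|%:R + Num.sqrt (#|G|%:R ^+ 2 + 4)) / 2.

Local Notation d := (dimH%:C%C).

Record polynomial_equations (x : numdata) : Prop := PolynomialEquations {
  pe_eps : forall h g, eps x h g = 1 \/ eps x h g = -1;
  pe_eta : forall g, `|eta x g| = 1;
  pe1 : (forall h k g, eps x (h + k) g = eps x h g * eps x k (g + h *+ 2)) /\
        (forall h, eps x h 0 = 1);
  pe2 : (forall g h, eta x (g + h *+ 2) = eta x g) /\
        (forall g, eta x g ^+ 3 = 1);
  pe3 : forall g, \sum_(h : G) amp x g h 0 = - ((eta x g)^* / d);
  pe4 : forall g g' k,
    \sum_(h : G) amp x g (h - g) k * (amp x g' (h - g') k)^* =
    (g == g')%:R - (eta x g)^* * eta x g' / d * (k == 0)%:R;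
  pe5 : forall g h p q, amp x (g + h *+ 2) p q =
    eps x h g * eps x h (g + p) * eps x h (g + q) * eps x h (g + p + q) *
    amp x g p q;
  pe6 : forall g h k, amp x g k h = (amp x g h k)^*;
  pe7 : forall g h k,
    amp x g h k = amp x g (- k) (h - k) * eta x g *
      eps x (- k) (g + h) * eps x (- k) (g + k) * eps x (- k) (g + h + k) /\
    amp x g h k = amp x g (k - h) (- h) * (eta x g)^* *
      eps x (- h) (g + h) * eps x (- h) (g + k) * eps x (- h) (g + h + k);
  pe8 : forall g h k,
    amp x g h k = amp x (g + h) h k * eta x g * eta x (g + k) *
      (eta x (g + h) * eta x (g + h + k))^* * eps x h g * eps x h (g + k) /\
    amp x g h k = amp x (g + k) h k * (eta x g * eta x (g + h))^* *
      eta x (g + k) * eta x (g + h + k) * eps x k g * eps x k (g + h);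
  pe9 : forall g a b p q,
    \sum_(l : G) amp x g (a + b) l * amp x (g - p + a) (- a) (l + p) *
      amp x (g - q + a + b) (- b) (l + q) =
    amp x g (p + a) (q + a + b) * amp x (g - p) (q + b) (p + a + b) *
      eta x g * eta x (g + q + a) * eta x (g + p + q + b) *
      (eta x (g + p) * eta x (g + a + b) * eta x (g + q + a + b))^* *
      eps x p (g - p + a) * eps x (p + a) (g - p + q + b) *
      eps x q (g - q + a + b) * eps x (q + b) (g - q + a) -
    (a == 0)%:R * (b == 0)%:R / d * eta x g * eta x (g + p) * eta x (g + q) }.

Definition gauge_equiv (x y : numdata) : Prop :=
  exists de : G -> R[i],
  [/\ forall g, de g = 1 \/ de g = -1,
      forall h g, eps y h g = de g * de (g + h *+ 2) * eps x h g,
      forall g, eta y g = eta x g &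
      forall g h k, amp y g h k =
        de g * de (g + h) * de (g + k) * de (g + h + k) * amp x g h k].

Definition acts_aut (t : {perm G}) (x y : numdata) : Prop :=
  [/\ forall h g, eps y (t h) (t g) = eps x h g,
      forall g, eta y (t g) = eta x g &
      forall g h k, amp y (t g) (t h) (t k) = amp x g h k].

Definition normalized_cocycle om : Prop :=
  [/\ cocycle om,
      forall g, [/\ om g 0 = 1, om 0 g = 1 & om g (- g) = 1],
      forall g h, om g h * om h g = 1 &
      forall g h, om g h * (om (- g) (- h))^* = 1].

(* The relations acts_H2 om and acts_pt p hold for the data y obtained from x
   by any of the admissible choices; these are all gauge equivalent. *)
Definition acts_H2 om (x y : numdata) : Prop :=
  exists om' (mu : G -> R[i]),
  [/\ cohomologous om om' /\ normalized_cocycle om',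
      (forall g, mu g = 1 \/ mu g = -1) /\ (forall g, mu (g *+ 2) = om' g g),
      forall h g, eps y h g = eps x h g * mu g * mu (g + h *+ 2) *
        (om' h g * om' (g + h) h)^*,
      forall g, eta y g = eta x g &
      forall g h k, amp y g h k =
        amp x g h k * mu (g + k) * mu g * mu (g + h + k) * mu (g + h) *
        (om' (g + k) h * om' h g)^*].

Definition acts_pt p (x y : numdata) : Prop :=
  exists chi nu : G -> R[i],
  [/\ [/\ forall g, `|chi g| = 1, forall g h, chi (g + h) = chi g * chi h &
          forall z, z *+ 2 = 0 -> chi z = eps x z p],
      (forall g, nu g ^+ 2 = chi g) /\
      (forall h, nu (p + h *+ 2) = chi h * eps x h p * nu p),
      forall h g, eps y h g =
        eps x h (p + g) * nu (p + g + h *+ 2) * (nu (p + g) * chi h)^*,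
      forall g, eta y g = eta x (p + g) &
      forall g h k, amp y g h k =
        amp x (p + g) h k * nu (p + g + h + k) * nu (p + g + h) *
        (nu (p + g + k) * nu (p + g) * chi h)^*].

(* The representative ([om], p) theta maps the gauge class of x to itself. *)
Definition stabilizes (c : gamma_rep) (x : numdata) : Prop :=
  exists x1 x2 x3, [/\ acts_aut (g_aut c) x x1, acts_pt (g_pt c) x1 x2,
    acts_H2 (g_coc c) x2 x3 & gauge_equiv x3 x].

Definition Gamma0 (x : numdata) (ga : Gamma) : Prop :=
  exists c : gamma_rep, stabilizes c x /\ pg_class (P := gamma_preGroup) c = ga.

End Gamma.

Section Haagerup.
Variables (R : realType) (M : starAlg R) (C : fusionCat M) (G : finZmodType).
Local Notation st := (@star R M).

(* The simple classes of C are exactly the distinct classes [a g], [a g rho]. *)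
Definition simple_classes (a : G -> M -> M) (rho : M -> M) : Prop :=
  [/\ (forall g, C (a g)) /\ C rho,
      forall s, C s -> (simple s <->
        (exists g, iso (a g) s) \/ (exists g, iso (a g \o rho) s)),
      forall g h, iso (a g) (a h) -> g = h,
      forall g h, iso (a g \o rho) (a h \o rho) -> g = h &
      forall g h, ~ iso (a g) (a h \o rho)].

Definition generalized_haagerup : Prop :=
  exists (a : G -> M -> M) (rho : M -> M),
  [/\ [/\ a 0 = idfun, forall g, invertible C (a g) &
          forall s, invertible C s -> exists g, iso (a g) s],
      [/\ simple rho, ~ invertible C rho & dual rho rho],
      simple_classes a rho,
      [/\ forall g h, iso (a g \o a h) (a (g + h)),
          forall g, iso (a g \o rho) (rho \o a (- g)) &
          dsum (fun o : option G => if o is Some g then a g \o rho else idfun)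
               (rho \o rho)] &
      exists (v v' : G -> G -> M) (w w' : G -> M),
      [/\ forall g h, [/\ hom (a (g + h)) (a g \o a h) (v g h),
            v' g h * v g h = 1 & v g h * v' g h = 1],
          forall g, [/\ hom (a g \o rho) (rho \o a (- g)) (w g),
            w' g * w g = 1 & w g * w' g = 1],
          forall g h k, a g (v h k) * v g (h + k) = v g h * v (g + h) k &
          forall g h, w g * a g (w h) * v g h * w' (g + h) =
                      rho (v (- g) (- h))]].

Definition standard_lifting (rho : M -> M) (al : G -> M -> M) : Prop :=
  [/\ al 0 = idfun,
      forall g h, al (g + h) = al g \o al h,
      simple_classes al rho,
      forall g, al g \o rho = rho \o al (- g) &
      forall z T, z *+ 2 = 0 -> hom rho (rho \o rho) T -> al z T = T].

Local Notation sd := ((Num.sqrt (dimH R G))%:C%C).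

Definition numerical_data (x : numdata R G) : Prop :=
  exists (rho : M -> M) (al : G -> M -> M) (S : M) (T : G -> M),
  [/\ standard_lifting rho al,
      hom idfun (rho \o rho) S /\ isometry S,
      [/\ forall g, hom (al g \o rho) (rho \o rho) (T g) /\ isometry (T g),
          forall g, sd *: (st (T g) * rho S) = T g &
          forall h, al h (T 0) = T (h *+ 2)],
      (forall h g, al h (T g) = eps x h g *: T (g + h *+ 2)) /\
      (forall g, sd *: (st (al g (rho (T g))) * S) = eta x g *: T g) &
      forall g, al g (rho (T g)) =
        eta x g *: (T g * S * st S) + ((eta x g)^* / sd) *: (S * st (T g)) +
        \sum_(h : G) \sum_(k : G)
          amp x g h k *: (T (g + h) * T (g + h + k) * st (T (g + k)))].

End Haagerup.

(* Main.v *)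
(** Strictify [C] by a lifting: an action [al] of [G] and an endomorphism [rho],
    with isometries [S] and [T g] satisfying the Cuntz relations, on which [al] and
    [rho] act by the structure constants [(eps, eta, A)].

    An autoequivalence [F] maps [al g] to [al (theta g)] and [rho] to [al p \o rho]
    up to unitaries. The unitaries for [al] multiply up to a 2-cocycle [om], and
    [([om], p + 2G, theta)] is multiplicative in [F] and changes [p] only by [2G]
    under inner autoequivalences. Transporting [S] and [T] along the unitaries
    yields multiples of [S] and of [T (g + p)], and comparing structure constants
    says precisely that [([om], - p, theta)] stabilizes the gauge class, once [om]
    is normalized; such a normalization exists because the symmetric cocycle
    [om g h * om h g] is the coboundary of a function extending [om z z] on the
    2-torsion.

    Injectivity: when the triple is trivial, [A <> 0] forces the phases on the
    [T g] to form a character up to a constant; absorbing it, [F] fixes [S] and all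
    [T g], hence all morphisms, since these are generated by [S] and the [T g].

    Surjectivity: given a stabilizing triple, perturb [al] and [rho] by unitaries
    realizing the inverse cocycle. The perturbed action is again strict, and its
    rescaled intertwiners have the structure constants of the relabelled lifting.
    The isomorphism between the *-algebras generated by the two sets of
    intertwiners then defines the functor; it is the identity on morphisms between
    simple objects. *)

(* Frames replace bare unitaries because they absorb the tensorators of F: on framed objects the
   tensor product is strictly associative and transport of morphisms is strictly monoidal, so every
   coherence question becomes an equation between phases.

   On the Gamma side the action of G/2G needs square roots of a character and that of H^2 needs half
   signs. These choices are not canonical, so they are merged into one function [tau] with
   [tau g ^+ 2 = K g] before any comparison with functors. The passage from p to -p is harmless
   modulo 2G, since they differ by 2p.

   Surjectivity meets two obstacles. Equal structure constants must give a well-defined map between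
   the generated algebras: this is a uniqueness theorem for Cuntz relations, proved algebraically by
   removing adjoints through right multiplication by long words. And the functor must be defined on
   all objects: each is resolved into words with at most one [rho], between which morphisms are
   scalars, the same in every lifting. The perturbing unitaries come from a twisted regular
   representation on |G| isometries of [M] whose ranges sum to 1. *)
From HB Require Import structures.
From mathcomp Require Import all_boot all_order all_algebra.
From mathcomp Require Import perm spectral boolp classical_sets reals complex ring.
Require Import Defs.

Set Implicit Arguments.
Unset Strict Implicit.
Unset Printing Implicit Defensive.
Import Order.TTheory GRing.Theory Num.Theory.
Local Open Scope ring_scope.

(** * Frames of an autoequivalence *)

Section Frames.
Variables (R : realType) (M : starAlg R) (C : fusionCat M).
Local Notation st := (@star R M).
Implicit Types (F K : autoeq C) (s t : M -> M).

(* A frame is a unitary fmap : F fsrc -> ftgt; the operations below make frames a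
   strict monoid, in which phases can be compared. *)
Record frame := Frame { fsrc : M -> M; ftgt : M -> M; fmap : M }.

Lemma star_scale (c : R[i]) (x : M) : st (c *: x) = (Num.conj c) *: st x.
Proof. exact: starZ. Qed.

Lemma star0 : st 0 = 0.
Proof. by rewrite -[X in st X](scale0r 0) starZ rmorph0 scale0r. Qed.

Lemma star_sum (I : Type) (r : seq I) (P : pred I) (f : I -> M) :
  st (\sum_(i <- r | P i) f i) = \sum_(i <- r | P i) st (f i).
Proof. by apply: (big_morph st _ star0) => x y; rewrite starD. Qed.

Lemma endoD s x y : star_endo s -> s (x + y) = s x + s y :> M.
Proof. by case=> h _ _ _; have := h 1 x y; rewrite !scale1r. Qed.

Lemma endo0 s : star_endo s -> s 0 = 0 :> M.
Proof.
by case=> h _ _ _; apply: (addrI (s 0)); have := h 1 0 0; rewrite !scale1r !addr0.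
Qed.

Lemma endoZ s c x : star_endo s -> s (c *: x) = c *: s x :> M.
Proof. by move=> hs; have [h _ _ _] := hs; rewrite -[c *: x]addr0 h endo0 // addr0. Qed.

Lemma endoM s x y : star_endo s -> s (x * y) = s x * s y :> M.
Proof. by case. Qed.

Lemma endo1 s : star_endo s -> s 1 = 1 :> M.
Proof. by case. Qed.

Lemma endoS s x : star_endo s -> s (st x) = st (s x) :> M.
Proof. by case. Qed.

Lemma endo_sum s (I : Type) (r : seq I) (P : pred I) (f : I -> M) : star_endo s ->
  s (\sum_(i <- r | P i) f i) = \sum_(i <- r | P i) s (f i) :> M.
Proof.
by move=> hs; apply: (big_morph s _ (endo0 hs)) => x y; apply: endoD.
Qed.

Lemma unitaryZ (c : R[i]) (u : M) : `|c| = 1 -> unitary u -> unitary (c *: u).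
Proof.
move=> c1 [u1 u2]; rewrite /unitary star_scale.
have e : (Num.conj c) * c = 1 by rewrite mulrC -normCK c1 expr1n.
by rewrite -!scalerAl -!scalerAr !scalerA u1 u2 e mulrC e scale1r.
Qed.

Lemma homZ s t (c : R[i]) (T : M) : star_endo t -> hom s t T -> hom s t (c *: T).
Proof. by move=> ht h x; rewrite -scalerAl -scalerAr h. Qed.

Definition frame_ok F X :=
  [/\ C (fsrc X), star_endo (ftgt X), hom (F (fsrc X)) (ftgt X) (fmap X)
    & unitary (fmap X)].

Definition ften F X Y := Frame (fsrc X \o fsrc Y) (ftgt X \o ftgt Y)
  (fmap X * F (fsrc X) (fmap Y) * st (ae_ten F (fsrc X) (fsrc Y))).

Definition fone F := Frame idfun idfun (st (ae_unit F)).

Definition fscale (c : R[i]) X := Frame (fsrc X) (ftgt X) (c *: fmap X).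

(** The conjugate of F(T) by the two frames. It lives between the targets, so for targets in a fixed
    lifting it can be compared with the intertwiners of that lifting. *)
Definition fmor F X Y T :=
  fmap Y * ae_mor F (fsrc X) (fsrc Y) T * st (fmap X).

Section One.
Variable F : autoeq C.
Local Notation ok := (frame_ok F).
Local Infix "\*" := (ften F) (at level 40, left associativity).
Implicit Types X Y Z W : frame.

Lemma ok_src X : ok X -> C (fsrc X). Proof. by case. Qed.
Lemma ok_tgt X : ok X -> star_endo (ftgt X). Proof. by case. Qed.
Lemma ok_hom X : ok X -> hom (F (fsrc X)) (ftgt X) (fmap X). Proof. by case. Qed.
Lemma ok_uni X : ok X -> unitary (fmap X). Proof. by case. Qed.
Lemma ok_F X : ok X -> star_endo (F (fsrc X)).
Proof. by move=> /ok_src; apply: ae_objE. Qed.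
Lemma ok_u1 X : ok X -> st (fmap X) * fmap X = 1. Proof. by case/ok_uni. Qed.
Lemma ok_u2 X : ok X -> fmap X * st (fmap X) = 1. Proof. by case/ok_uni. Qed.
Lemma ok_homV X : ok X -> hom (ftgt X) (F (fsrc X)) (st (fmap X)).
Proof. by move=> h; apply: homV; [exact: ok_F|exact: ok_tgt|exact: ok_hom]. Qed.

Lemma ok_obj X : ok X -> C (ftgt X).
Proof.
move=> h; apply: (obj_replete (ae_objP F (ok_src h))); first exact: ok_tgt.
by exists (fmap X); [exact: ok_hom|exact: ok_uni].
Qed.

Lemma fone_ok : ok (fone F).
Proof.
split=> /=; [exact: obj_id|exact: endo_id| |exact/unitaryV/ae_unitU].
by apply: homV; [exact: endo_id|apply: ae_objE; exact: obj_id|exact: ae_unitP].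
Qed.

Lemma ften_ok X Y : ok X -> ok Y -> ok (X \* Y).
Proof.
move=> hX hY; have cX := ok_src hX; have cY := ok_src hY; split=> /=.
- exact: obj_comp.
- by apply: endo_comp; exact: ok_tgt.
- apply: (homM (t := F (fsrc X) \o F (fsrc Y))).
    apply: homV; [apply: endo_comp; exact: ok_F|apply: ae_objE; exact: obj_comp|].
    exact: ae_tenP.
  by apply: homT; [exact: ok_F|exact: ok_hom|exact: ok_hom].
- apply: unitaryM; last by apply/unitaryV/ae_tenU.
  apply: unitaryM; first exact: ok_uni.
  by apply: unitary_endo; [exact: ok_F|exact: ok_uni].
Qed.

Lemma fscale_ok c X : `|c| = 1 -> ok X -> ok (fscale c X).
Proof.
move=> c1 [h1 h2 h3 h4]; split=> //=; [exact: homZ|exact: unitaryZ].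
Qed.

Lemma ftenA X Y Z : ok X -> ok Y -> ok Z -> X \* (Y \* Z) = X \* Y \* Z.
Proof.
move=> hX hY hZ; have [cX cY cZ] := And3 (ok_src hX) (ok_src hY) (ok_src hZ).
rewrite /ften /=; congr Frame.
rewrite !(endoM _ _ (ok_F hX)) -!mulrA; congr (_ * (_ * _)).
rewrite (endoS _ (ok_F hX)) -starM -(ae_tenA F cX cY cZ) starM !mulrA; congr (_ * _).
have := homV (endo_comp (ok_F hX) (ok_F hY)) (ae_objE F (obj_comp cX cY)) (ae_tenP F cX cY).
by move=> /(_ (fmap Z)) /= ->.
Qed.

Lemma ften1l X : ok X -> fone F \* X = X.
Proof.
case: X => s s' e hX; have /= cs := ok_src hX; rewrite /ften /=; congr Frame.
have [u1 u2] := ae_unitU F; rewrite (ae_unitlE F cs) -mulrA.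
by have /= <- := ae_unitP F e; rewrite mulrA u1 mul1r.
Qed.

Lemma ften1r X : ok X -> X \* fone F = X.
Proof.
case: X => s s' e hX; have /= cs := ok_src hX; rewrite /ften /=; congr Frame.
rewrite -mulrA ae_objS // -starM ae_unitr //.
by rewrite st1 mulr1.
Qed.

Lemma fscale1 X : fscale 1 X = X.
Proof. by case: X => s s' e; rewrite /fscale scale1r. Qed.

Lemma fscaleA c d X : fscale c (fscale d X) = fscale (c * d) X.
Proof. by rewrite /fscale /= scalerA. Qed.

Lemma fscale_tenl c X Y : fscale c X \* Y = fscale c (X \* Y).
Proof. by rewrite /ften /fscale /= !scalerAl. Qed.

Lemma fscale_tenr c X Y : ok X -> X \* fscale c Y = fscale c (X \* Y).
Proof.
by move=> hX; rewrite /ften /fscale /= (endoZ _ _ (ok_F hX)) -scalerAr -!scalerAl.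
Qed.

Lemma fmor_hom X Y T : ok X -> ok Y -> hom (fsrc X) (fsrc Y) T ->
  hom (ftgt X) (ftgt Y) (fmor F X Y T).
Proof.
move=> hX hY h; apply: homM (ok_homV hX) _.
apply: homM (ok_hom hY); apply: ae_morP => //; exact: ok_src.
Qed.

Lemma fmor_comp X Y Z T T' : ok X -> ok Y -> ok Z ->
  hom (fsrc X) (fsrc Y) T -> hom (fsrc Y) (fsrc Z) T' ->
  fmor F X Z (T' * T) = fmor F Y Z T' * fmor F X Y T.
Proof.
move=> hX hY hZ h h'; rewrite /fmor.
rewrite (ae_comp F (ok_src hX) (ok_src hY) (ok_src hZ) h h') -!mulrA.
by congr (_ * (_ * _)); rewrite mulrA ok_u1 // mul1r.
Qed.

Lemma fmor1 X : ok X -> fmor F X X 1 = 1.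
Proof. by move=> hX; rewrite /fmor ae_id ?mulr1 ?ok_u2 //; exact: ok_src. Qed.

Lemma fmor_star X Y T : ok X -> ok Y -> hom (fsrc X) (fsrc Y) T ->
  fmor F Y X (st T) = st (fmor F X Y T).
Proof.
move=> hX hY h; rewrite /fmor ae_star //; try exact: ok_src.
by rewrite !starM starK mulrA.
Qed.

Lemma fmor_lin X Y c T T' : ok X -> ok Y ->
  hom (fsrc X) (fsrc Y) T -> hom (fsrc X) (fsrc Y) T' ->
  fmor F X Y (c *: T + T') = c *: fmor F X Y T + fmor F X Y T'.
Proof.
move=> hX hY h h'; rewrite /fmor ae_lin //; try exact: ok_src.
by rewrite mulrDr mulrDl -scalerAr -scalerAl.
Qed.

Lemma hom0 s t : star_endo t -> hom s t (0 : M).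
Proof. by move=> ht x; rewrite mul0r mulr0. Qed.

Lemma homD s t (T T' : M) : hom s t T -> hom s t T' -> hom s t (T + T').
Proof. by move=> h h' x; rewrite mulrDl mulrDr h h'. Qed.

Lemma hom_sum s t (I : Type) (r : seq I) (P : pred I) (T : I -> M) :
  (forall i, hom s t (T i)) -> hom s t (\sum_(i <- r | P i) T i).
Proof.
move=> h x; rewrite mulr_suml mulr_sumr; apply: eq_bigr => i _; exact: h.
Qed.

Lemma fmor0 X Y : ok X -> ok Y -> fmor F X Y 0 = 0.
Proof.
move=> hX hY; have h := hom0 (fsrc X) (obj_endo (ok_src hY)).
have := fmor_lin (-1) hX hY h h; rewrite scaler0 addr0 => e.
by rewrite [LHS]e scaleN1r addNr.
Qed.

Lemma fmorZ X Y c T : ok X -> ok Y -> hom (fsrc X) (fsrc Y) T ->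
  fmor F X Y (c *: T) = c *: fmor F X Y T.
Proof.
move=> hX hY h; rewrite -[c *: T]addr0 fmor_lin ?fmor0 ?addr0 //.
by apply: hom0; exact: (obj_endo (ok_src hY)).
Qed.

Lemma fmorD X Y T T' : ok X -> ok Y ->
  hom (fsrc X) (fsrc Y) T -> hom (fsrc X) (fsrc Y) T' ->
  fmor F X Y (T + T') = fmor F X Y T + fmor F X Y T'.
Proof. by move=> hX hY h h'; rewrite -[T]scale1r fmor_lin // !scale1r. Qed.

Lemma fmor_sum X Y (I : finType) (T : I -> M) : ok X -> ok Y ->
  (forall i, hom (fsrc X) (fsrc Y) (T i)) ->
  fmor F X Y (\sum_i T i) = \sum_i fmor F X Y (T i).
Proof.
move=> hX hY h.
suff: hom (fsrc X) (fsrc Y) (\sum_i T i) /\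
  fmor F X Y (\sum_i T i) = \sum_i fmor F X Y (T i) by case.
elim/big_rec2: _ => [|i y1 y2 _ [h1 <-]].
  by rewrite fmor0 //; split=> //; apply: hom0; exact: (obj_endo (ok_src hY)).
by split; [exact: homD|rewrite fmorD].
Qed.

(** The tensorators inside the product frames cancel those produced by naturality, so transport is
    strictly monoidal. *)
Lemma fmor_ten X X' Y Y' S T : ok X -> ok X' -> ok Y -> ok Y' ->
  hom (fsrc X) (fsrc X') S -> hom (fsrc Y) (fsrc Y') T ->
  fmor F (X \* Y) (X' \* Y') (S * fsrc X T) = fmor F X X' S * ftgt X (fmor F Y Y' T).
Proof.
move=> hX hX' hY hY' hS hT.
have [cX cX' cY cY'] := And4 (ok_src hX) (ok_src hX') (ok_src hY) (ok_src hY').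
rewrite /fmor /= (ae_tensor F cX cX' cY cY' hS hT) !starM starK.
have [J1 J2] := ae_tenU F cX cY; have [J1' J2'] := ae_tenU F cX' cY'.
rewrite !mulrA -(mulrA _ _ (ae_ten F (fsrc X') (fsrc Y'))) J1' mulr1.
rewrite -(mulrA _ (st (ae_ten _ _ _)) (ae_ten _ _ _)) J1 mulr1.
set mS := ae_mor F _ _ S; set mT := ae_mor F _ _ T.
have hmS : hom (F (fsrc X)) (F (fsrc X')) mS by apply: ae_morP.
rewrite -(mulrA (fmap X') (F _ _) mS) -hmS -!mulrA; congr (_ * (_ * _)).
rewrite -!ae_objS // !mulrA -!ae_objM // -(ok_homV hX); congr (_ * _).
Qed.

Lemma fmor_tenl X Y Y' T : ok X -> ok Y -> ok Y' ->
  hom (fsrc Y) (fsrc Y') T ->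
  fmor F (X \* Y) (X \* Y') (fsrc X T) = ftgt X (fmor F Y Y' T).
Proof.
move=> hX hY hY' h; have := fmor_ten hX hX hY hY' (hom1 _) h.
by rewrite mul1r fmor1 // mul1r.
Qed.

Lemma fmor_tenr X X' Y S : ok X -> ok X' -> ok Y ->
  hom (fsrc X) (fsrc X') S -> fmor F (X \* Y) (X' \* Y) S = fmor F X X' S.
Proof.
move=> hX hX' hY h; have := fmor_ten hX hX' hY hY h (hom1 _).
rewrite (endo1 (obj_endo (ok_src hX))) mulr1 fmor1 // => ->.
by rewrite (endo1 (ok_tgt hX)) mulr1.
Qed.

Lemma fmor_scalel c X Y T : fmor F (fscale c X) Y T = (Num.conj c) *: fmor F X Y T.
Proof. by rewrite /fmor /= starZ scalerAr. Qed.

Lemma fmor_scaler c X Y T : fmor F X (fscale c Y) T = c *: fmor F X Y T.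
Proof. by rewrite /fmor /= !scalerAl. Qed.

Lemma fscale_inj c d X : ok X -> fscale c X = fscale d X -> c = d.
Proof.
move=> hX [] /(congr1 (fun z => st (fmap X) * z)).
rewrite -!scalerAr ok_u1 // => /eqP; rewrite -subr_eq0 -scalerBl scaler_eq0 oner_eq0 orbF.
by rewrite subr_eq0 => /eqP.
Qed.

(** One frame composed with the adjoint of the other is an endomorphism of a simple object. The
    cocycles and exchange scalars below all come from here. *)
Lemma frame_scalar X Y : ok X -> ok Y -> fsrc X = fsrc Y -> ftgt X = ftgt Y ->
  simple (ftgt Y) -> exists2 c, `|c| = 1 & X = fscale c Y.
Proof.
case: X Y => s s' e [t t' f] hX hY /= e1 e2 sp; subst s s'.
have [c hc] := sp (e * st f) (homM (ok_homV hY) (ok_hom hX)).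
have ef : e = c *: f.
  rewrite -[e]mulr1 -(ok_u1 hY) /= mulrA hc.
  by rewrite -scalerAl mul1r.
exists c; last by rewrite /fscale ef.
have := ok_u1 hX; rewrite /= ef starZ -scalerAl -scalerAr (ok_u1 hY) scalerA.
move=> /eqP; rewrite -[X in _ == X]scale1r -subr_eq0 -scalerBl scaler_eq0 oner_eq0 orbF.
rewrite subr_eq0 mulrC -normCK => /eqP h; apply/eqP.
by rewrite -(@pexpr_eq1 _ _ 2) // h.
Qed.

End One.

Section Compose.
Variables F K : autoeq C.

(** Meaningful when the source of [Y] is the target of [X]: F(K s) goes to F(s') by the image of the
    first frame, and then to the target of the second. *)
Definition fcomp Y X :=
  Frame (fsrc X) (ftgt Y) (fmap Y * ae_mor F (K (fsrc X)) (ftgt X) (fmap X)).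

Lemma fcomp_ok X Y : frame_ok K X -> frame_ok F Y -> fsrc Y = ftgt X ->
  frame_ok (ae_mul F K) (fcomp Y X).
Proof.
case: X Y => s s' e [t t' f] hX hY /= E; subst t.
have cs := ok_src hX; have cs' := ok_obj hX; split=> //=; first exact: ok_tgt hY.
  apply: homM (ok_hom hY); apply: ae_morP => //; [exact: ae_objP|exact: ok_hom hX].
apply: unitaryM (ok_uni hY) _; apply: ae_unitary => //; first exact: ae_objP.
  exact: ok_hom hX.
exact: ok_uni hX.
Qed.

Lemma fcomp_ten X X' Y Y' : frame_ok K X -> frame_ok K X' ->
  frame_ok F Y -> frame_ok F Y' -> fsrc Y = ftgt X -> fsrc Y' = ftgt X' ->
  ften (ae_mul F K) (fcomp Y X) (fcomp Y' X') = fcomp (ften F Y Y') (ften K X X').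
Proof.
case: X X' Y Y' => s s' e [t t' f] [s1 s1' e'] [t1 t1' f'] hX hX' hY hY' /= E E'.
subst s1 t1; rewrite /ften /fcomp /=; congr Frame.
rewrite /aec_obj /aec_ten.
have [cs ct] := (ok_src hX, ok_src hX'); have [cs' ct'] := (ok_obj hX, ok_obj hX').
rewrite /= in cs ct cs' ct'.
have [cKs cKt] := (ae_objP K cs, ae_objP K ct).
have cKst := obj_comp cKs cKt; have cst' := obj_comp cs' ct'.
have cK2 : C (K (s \o t)) by apply/ae_objP/obj_comp.
have hJ := ae_tenP K cs ct.
have hJ' := homV (endo_comp (ae_objE K cs) (ae_objE K ct)) (obj_endo cK2) hJ.
have hef := homT (ae_objE K cs) (ok_hom hX) (ok_hom hX').
have -> := @ae_comp _ _ _ F _ _ _ _ _ cK2 cKst cst' hJ' hef.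
rewrite (ae_star F cKst cK2 hJ).
rewrite (ae_tensor F cKs cs' cKt ct' (ok_hom hX) (ok_hom hX')).
have [J1 J2] := ae_tenU F cs' ct'.
have [J1' J2'] := ae_tenU F cKs cKt.
rewrite starM -!mulrA; congr (_ * _).
rewrite !(mulrA (st (ae_ten F s' t'))) J1 mul1r.
rewrite ae_objM // -!mulrA.
by rewrite !mulrA; congr (_ * _ * _ * _); apply: ae_morP => //; exact: ok_hom hX.
Qed.

Lemma fcomp_scale c d X Y : frame_ok K X -> frame_ok F Y -> fsrc Y = ftgt X ->
  fcomp (fscale d Y) (fscale c X) = fscale (d * c) (fcomp Y X).
Proof.
case: X Y => s s' e [t t' f] hX hY /= E; subst t.
have cs := ok_src hX; have cs' := ok_obj hX.
rewrite /fcomp /fscale /=; congr Frame.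
have h0 : hom (K s) s' (0 : M) by apply: hom0; exact: ok_tgt hX.
have e0 : ae_mor F (K s) s' 0 = 0.
  have := @ae_lin _ _ _ F (K s) s' (-1) 0 0 (ae_objP K cs) cs' h0 h0.
  by rewrite scaler0 addr0 => ->; rewrite scaleN1r addNr.
have := @ae_lin _ _ _ F (K s) s' c e 0 (ae_objP K cs) cs' (ok_hom hX) h0.
by rewrite !addr0 e0 addr0 => ->; rewrite -scalerAl -scalerAr scalerA.
Qed.

End Compose.

End Frames.

(** * Liftings and their structure constants *)

Section Positivity.
Variables (R : realType) (M : starAlg R).
Hypothesis HM : hyperfinite_III1_factor M.
Local Notation st := (@star R M).

Lemma alg_inj (c d : R[i]) : c%:A = d%:A :> M -> c = d.
Proof.
move=> /eqP; rewrite -subr_eq0 -scalerBl scaler_eq0 oner_eq0 orbF subr_eq0.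
by move/eqP.
Qed.

(** [starAlg] is purely algebraic, so positivity is taken from the faithful representation: [pi T]
    scales squared norms by c, and the Hilbert space has a nonzero vector because 1 is not 0 in
    [M]. *)
Lemma star_pos (T : M) (c : R[i]) : st T * T = c%:A ->
  0 <= c /\ (c = 0 -> T = 0).
Proof.
have [H [pi [[piL [piM pi1] piS piB _] _ _ _]]] := HM.
have pi0 x : pi 0 x = 0.
  by have := piL (-1) 0 0 x; rewrite scaler0 addr0 scaleN1r addNr.
have ipx0 (x : H) : ip x 0 = 0.
  have := ipL (-1) x 0 0; rewrite scaler0 addr0 mulN1r => {1}->.
  exact: addNr.
move=> e.
have ipT x : ip (pi T x) (pi T x) = c * ip x x.
  rewrite -{1}(starK T) -piS -piM e.
  have -> : pi c%:A x = c *: x by have := piL c 1 0 x; rewrite addr0 pi1 pi0 addr0.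
  by have := ipL c x x 0; rewrite addr0 ipx0 addr0.
have [x nx] : exists x : H, x <> 0.
  apply: contrapT => n; have /eqP : (1 : M) = 0.
    by apply: (piB 1).2 => x; apply: contrapT => nx; apply: n; exists (pi 1 x).
  by rewrite oner_eq0.
have px : 0 < ip x x.
  rewrite lt_neqAle ip_ge0 andbT eq_sym; apply/eqP => /ip_eq0; exact: nx.
split.
  by have := ip_ge0 (pi T x); rewrite ipT pmulr_lge0.
move=> c0; apply: (piB T).2 => y; apply: ip_eq0; by rewrite ipT c0 mul0r.
Qed.

(** Schur's lemma. T^* T and T T^* are the same scalar c; if T is not 0 then c is positive, and T
    divided by a square root of c would be a unitary isomorphism. *)
Lemma simple_hom0 s t (T : M) : star_endo s -> star_endo t ->
  simple s -> simple t -> ~ iso s t -> hom s t T -> T = 0.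
Proof.
move=> es et ss stt ni h.
have h' := homV es et h.
have [c ec] := ss _ (homM h h'); have [d ed] := stt _ (homM h' h).
have [c0 cz] := star_pos ec.
have [//|nT] := pselect (T = 0).
have cn : c != 0 by apply/eqP => /cz.
have cd : d = c.
  have : d *: T = c *: T.
    by rewrite -[d *: T]mul1r -scalerAr scalerAl -ed -mulrA ec -scalerAr mulr1.
  move=> /eqP; rewrite -subr_eq0 -scalerBl scaler_eq0 subr_eq0 => /orP [/eqP //|/eqP //].
have sc : exists2 r : R[i], 0 < r & r ^+ 2 = c.
  by exists (sqrtC c); [rewrite sqrtC_gt0 lt_neqAle eq_sym cn|rewrite sqrtCK].
have [r r0 rc] := sc; have rn : r != 0 by rewrite gt_eqF.
have rr : Num.conj r^-1 = r^-1.
  by apply/CrealP; rewrite ger0_real // invr_ge0 ltW.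
case: ni; exists (r^-1 *: T); first exact: homZ.
rewrite /unitary starZ -!scalerAl -!scalerAr !scalerA ec ed cd.
rewrite rr.
rewrite scalerA; have -> : r^-1 / r * c = 1 by rewrite -rc; field.
by rewrite scale1r.
Qed.

End Positivity.

(** * Liftings as Cuntz relations with structure constants *)

Section Cuntz.
Variables (R : realType) (M : starAlg R) (C : fusionCat M) (G : finZmodType).
Local Notation st := (@star R M).
Implicit Types (g h k : G).

Record ldata := Ldata { l_eps : G -> G -> R[i]; l_c : R[i]; l_b : G -> R[i];
  l_eta : G -> R[i]; l_eta2 : G -> R[i]; l_amp : G -> G -> G -> R[i] }.

(* Liftings without the normalizations of standard liftings; the coefficients
   that the normalizations determine are kept as free parameters. *)
Record lift (al : G -> M -> M) (rho : M -> M) (S : M) (T : G -> M) (y : ldata)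
  : Prop := Lift {
  lf_cls : simple_classes C al rho;
  lf_0 : al 0 = idfun;
  lf_D : forall g h, al (g + h) = al g \o al h;
  lf_rho : forall g, al g \o rho = rho \o al (- g);
  lf_S : hom idfun (rho \o rho) S;
  lf_T : forall g, hom (al g \o rho) (rho \o rho) (T g);
  lf_SS : st S * S = 1;
  lf_ST : forall g, st S * T g = 0;
  lf_TT : forall g h, st (T g) * T h = if g == h then 1 else 0;
  lf_full : S * st S + \sum_g T g * st (T g) = 1;
  lf_alS : forall h, al h S = S;
  lf_alT : forall h g, al h (T g) = l_eps y h g *: T (g + h *+ 2);
  lf_rS : rho S = l_c y *: S + \sum_g l_b y g *: (T g * T g);
  lf_rT : forall g, al g (rho (T g)) =
    l_eta y g *: (T g * S * st S) + l_eta2 y g *: (S * st (T g)) +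
    \sum_h \sum_k l_amp y g h k *: (T (g + h) * T (g + h + k) * st (T (g + k))) }.

Section Lift.
Variables (al : G -> M -> M) (rho : M -> M) (S : M) (T : G -> M) (y : ldata).
Hypothesis L : lift al rho S T y.

Lemma lf_Cal g : C (al g). Proof. by have [[]] := lf_cls L. Qed.
Lemma lf_Crho : C rho. Proof. by have [[]] := lf_cls L. Qed.
Lemma lf_Ear g : star_endo (al g). Proof. exact: obj_endo (lf_Cal g). Qed.
Lemma lf_Er : star_endo rho. Proof. exact: obj_endo lf_Crho. Qed.
Lemma lf_TS g : st (T g) * S = 0.
Proof. by rewrite -[LHS]starK starM starK (lf_ST L) star0. Qed.

Lemma lf_bE g : st (T g) * st (T g) * rho S = (l_b y g)%:A.
Proof.
rewrite (lf_rS L) mulrDr -scalerAr -(mulrA _ _ S).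
rewrite lf_TS mulr0 scaler0 add0r mulr_sumr.
rewrite (bigD1 g) //= big1 ?addr0 => [|h nh].
  by rewrite -scalerAr -mulrA (mulrA _ (T g)) (lf_TT L) eqxx mul1r (lf_TT L) eqxx.
by rewrite -scalerAr -mulrA (mulrA _ (T h)) (lf_TT L) eq_sym (negPf nh) mul0r mulr0 scaler0.
Qed.

Lemma lf_epsE h g : st (T (g + h *+ 2)) * al h (T g) = (l_eps y h g)%:A.
Proof. by rewrite (lf_alT L) -scalerAr (lf_TT L) eqxx. Qed.

Lemma lf_SSx x : st S * (S * x) = x.
Proof. by rewrite mulrA (lf_SS L) mul1r. Qed.
Lemma lf_STx g x : st S * (T g * x) = 0.
Proof. by rewrite mulrA (lf_ST L) mul0r. Qed.
Lemma lf_TSx g x : st (T g) * (S * x) = 0.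
Proof. by rewrite mulrA lf_TS mul0r. Qed.
Lemma lf_TTx g h x : st (T g) * (T h * x) = if g == h then x else 0.
Proof. by rewrite mulrA (lf_TT L); case: eqP => _; rewrite ?mul1r ?mul0r. Qed.

Definition lf_cuntz := (lf_SS L, lf_ST L, lf_TS, lf_SSx, lf_STx, lf_TSx).

Lemma lf_rTr g x : al g (rho (T g)) * x =
  l_eta y g *: (T g * (S * (st S * x))) + l_eta2 y g *: (S * (st (T g) * x)) +
  \sum_h \sum_k l_amp y g h k *: (T (g + h) * (T (g + h + k) * (st (T (g + k)) * x))).
Proof.
rewrite (lf_rT L) !mulrDl -!scalerAl -!mulrA; congr (_ + _).
rewrite mulr_suml; apply: eq_bigr => h _; rewrite mulr_suml; apply: eq_bigr => k _.
by rewrite -scalerAl -!mulrA.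
Qed.

Lemma lf_etaE g : st S * (st (T g) * (al g (rho (T g)) * S)) = (l_eta y g)%:A.
Proof.
rewrite lf_rTr !lf_cuntz !mulr0 scaler0 addr0 big1 => [|h _]; last first.
  by apply: big1 => k _; rewrite !lf_cuntz !mulr0 scaler0.
by rewrite addr0 mulr1 -!scalerAr lf_TTx eqxx lf_cuntz.
Qed.

Lemma lf_eta2E g : st S * (al g (rho (T g)) * T g) = (l_eta2 y g)%:A.
Proof.
rewrite lf_rTr !lf_cuntz !mulr0 scaler0 add0r mulrDr mulr_sumr big1 => [|h _]; last first.
  by rewrite mulr_sumr big1 // => k _; rewrite -scalerAr !lf_cuntz scaler0.
by rewrite addr0 -scalerAr !lf_cuntz (lf_TT L) eqxx.
Qed.

Lemma lf_ampE g h k :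
  st (T (g + h + k)) * (st (T (g + h)) * (al g (rho (T g)) * T (g + k))) =
  (l_amp y g h k)%:A.
Proof.
rewrite lf_rTr !lf_cuntz !mulr0 scaler0 add0r !mulrDr -!scalerAr !lf_cuntz mulr0.
rewrite scaler0 add0r !mulr_sumr (bigD1 h) //= [X in _ + X]big1 ?addr0 => [|h' nh].
  rewrite !mulr_sumr (bigD1 k) //= big1 ?addr0 => [|k' nk].
    by rewrite -!scalerAr !lf_TTx !eqxx (lf_TT L) eqxx mulr1 (lf_TT L) eqxx.
  rewrite -!scalerAr (lf_TT L) (can_eq (addKr g)) (negPf nk) !mulr0 !scaler0 //.
rewrite !mulr_sumr big1 // => k' _.
by rewrite -!scalerAr lf_TTx (can_eq (addKr g)) eq_sym (negPf nh) mulr0 scaler0.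
Qed.

End Lift.

(** Each listed coefficient is a compression by S and the T_g of an expression that does not involve
    the data. Two descriptions of one lifting thereby yield equations between structure
    constants. *)
Lemma lift_uniq al rho S T y y' : lift al rho S T y -> lift al rho S T y' ->
  [/\ l_eps y =2 l_eps y', l_b y =1 l_b y', l_eta y =1 l_eta y',
      l_eta2 y =1 l_eta2 y' & forall g h k, l_amp y g h k = l_amp y' g h k].
Proof.
move=> L L'; split=> [h g|g|g|g|g h k]; apply: (@alg_inj _ M).
- by rewrite -(lf_epsE L) (lf_epsE L').
- by rewrite -(lf_bE L) (lf_bE L').
- by rewrite -(lf_etaE L) (lf_etaE L').
- by rewrite -(lf_eta2E L) (lf_eta2E L').
- by rewrite -(lf_ampE L) (lf_ampE L').
Qed.

End Cuntz.

(** * Cuntz relations for standard liftings *)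

Section Standard.
Variables (R : realType) (M : starAlg R) (C : fusionCat M) (G : finZmodType).
Hypothesis HM : hyperfinite_III1_factor M.
Local Notation st := (@star R M).
Local Notation sd := ((Num.sqrt (dimH R G))%:C%C).
Implicit Types (g h k : G).

Definition std_ldata (x : numdata R G) (c : R[i]) : ldata R G :=
  Ldata (eps x) c (fun=> sd^-1) (eta x) (fun g => Num.conj (eta x g) / sd) (amp x).

Lemma dimH_gt0 : 0 < dimH R G.
Proof.
rewrite /dimH divr_gt0 ?ltr0n // ltr_pwDl ?sqrtr_ge0 // ltr0n.
by apply/card_gt0P; exists 0.
Qed.

Lemma sd_neq0 : sd != 0.
Proof. by rewrite -(rmorph0 (real_complex R)) (inj_eq (@complexI _)) sqrtr_eq0 -ltNge dimH_gt0. Qed.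

Lemma sd_sqr : sd ^+ 2 = (dimH R G)%:C%C.
Proof. by rewrite -rmorphXn /= sqr_sqrtr // ltW // dimH_gt0. Qed.

Lemma sd_conj : Num.conj sd = sd.
Proof. by apply/CrealP; rewrite complex_real. Qed.

Section Classes.
Variables (al : G -> M -> M) (rho : M -> M).
Hypothesis cls : simple_classes C al rho.

Lemma cls_al g : simple (al g).
Proof.
have [[ca _] s _ _ _] := cls; apply/(s _ (ca g)); left; exists g.
by exists 1; [exact: hom1|exact: unitary1].
Qed.

Lemma cls_obj g : C (al g \o rho).
Proof. by have [[ca cr] _ _ _ _] := cls; apply: obj_comp. Qed.

Lemma cls_alr g : simple (al g \o rho).
Proof.
have [_ s _ _ _] := cls; apply/(s _ (cls_obj g)); right; exists g.
by exists 1; [exact: hom1|exact: unitary1].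
Qed.

Lemma cls_hom_al g h (T : M) : g <> h -> hom (al g) (al h) T -> T = 0.
Proof.
have [[ca _] _ i _ _] := cls => ngh.
move=> hT; apply: (simple_hom0 HM _ _ (@cls_al g) (@cls_al h) _ hT); try exact: obj_endo (ca _).
by move=> /i.
Qed.

Lemma cls_hom_alr g h (T : M) : g <> h -> hom (al g \o rho) (al h \o rho) T -> T = 0.
Proof.
have [_ _ _ i _] := cls => ngh.
move=> hT; apply: (simple_hom0 HM _ _ (@cls_alr g) (@cls_alr h) _ hT); try exact: obj_endo (cls_obj _).
by move=> /i.
Qed.

Lemma cls_hom_mix g h (T : M) : hom (al g) (al h \o rho) T -> T = 0.
Proof.
have [[ca _] _ _ _ i] := cls.
move=> hT; apply: (simple_hom0 HM _ _ (@cls_al g) (@cls_alr h) _ hT); try exact: obj_endo (cls_obj _).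
  exact: obj_endo (ca _).
exact: i.
Qed.

Lemma cls_hom_mix' g h (T : M) : hom (al h \o rho) (al g) T -> T = 0.
Proof.
have [[ca _] _ _ _ i] := cls => hT.
rewrite -[T]starK (@cls_hom_mix g h (st T)) ?star0 //.
by apply: homV => //; [exact: obj_endo (cls_obj _)|exact: obj_endo (ca _)].
Qed.

End Classes.
Arguments cls_al [al rho] cls g.
Arguments cls_alr [al rho] cls g.

Lemma std_lift (x : numdata R G) : polynomial_equations x -> numerical_data C x ->
  exists rho al S T c, lift C al rho S T (std_ldata x c).
Proof.
move=> Hx [rho [al [S [T [[al0 alD cls alr alT2] [hS iS] [hT sdT alT0] [alT etaT] rT]]]]].
have [[ca cr] _ _ _ _] := cls.
have er := obj_endo cr; have ea g := obj_endo (ca g).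
have err : star_endo (rho \o rho) by exact: endo_comp.
have hrT g := (hT g).1.
have hS0 : hom (al 0) (rho \o rho) S by rewrite al0.
have ST g : st S * T g = 0.
  apply: (cls_hom_mix' cls (g := 0) (h := g)); apply: homM (hrT g) _.
  by apply: homV => //; exact: ea.
have TS g : st (T g) * S = 0 by rewrite -[LHS]starK starM starK ST star0.
have TT g h : st (T g) * T h = if g == h then 1 else 0.
  case: eqP => [->|ngh]; first by have [_ ->] := hT h.
  apply: (cls_hom_alr cls (g := h) (h := g)) => [/esym//|].
  apply: homM (hrT h) _; apply: homV => //; exact: endo_comp.
have TTx g h z : st (T g) * (T h * z) = if g == h then z else 0.
  by rewrite mulrA TT; case: eqP => _; rewrite ?mul1r ?mul0r.
(* Completeness is extracted from a single formula: rho(T_0) is an isometry, and in the expansion of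
   its square the coefficients X_k of T_k^* contribute, by [pe4], the weight 1 - 1/d at k = 0 and 1
   elsewhere. The term S T_0^* supplies the missing 1/d. *)
have full : S * st S + \sum_g T g * st (T g) = 1.
  have iU : st (al 0 (rho (T 0))) * al 0 (rho (T 0)) = 1.
    rewrite -endoS // -endoM // -endoS // -endoM // TT eqxx !endo1 //.
  pose X k := \sum_h amp x 0 h k *: (T h * T (h + k)).
  have XX k k' : st (X k) * X k' = if k == k' then
     (1 - Num.conj (eta x 0) * eta x 0 / (dimH R G)%:C%C * (k == 0)%:R)%:A else 0.
    rewrite /X star_sum mulr_suml.
    transitivity (if k == k' then (\sum_h amp x 0 h k * Num.conj (amp x 0 h k))%:A else 0 : M).
      transitivity (\sum_h (if k == k' then (amp x 0 h k * Num.conj (amp x 0 h k))%:A else 0 : M)).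
        apply: eq_bigr => h _; rewrite mulr_sumr (bigD1 h) //= big1 ?addr0 => [|h' nh].
          rewrite starZ starM -!scalerAl -!scalerAr -mulrA TTx eqxx TT scalerA mulrC.
          rewrite (can_eq (addKr _)).
          by case: eqP => [->|_]; rewrite ?scaler0.
        rewrite starZ starM -!scalerAl -!scalerAr -mulrA TTx.
        by rewrite eq_sym (negPf nh) mulr0 !scaler0.
      case: eqP => _; last by rewrite big1.
      by rewrite -scaler_suml.
    case: eqP => // _; congr (_ *: _); have := pe4 Hx 0 0 k.
    rewrite eqxx => <-; apply: eq_bigr => h _; by rewrite subr0.
  have SX k : st S * X k = 0.
    by rewrite mulr_sumr big1 // => h _; rewrite -scalerAr mulrA ST mul0r scaler0.
  have XS k : st (X k) * S = 0 by rewrite -[LHS]starK starM starK SX star0.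
  have TX k : st (T 0) * X k = amp x 0 0 k *: T k.
    rewrite mulr_sumr (bigD1 0) //= big1 ?addr0 => [|h nh].
      by rewrite -scalerAr TTx eqxx add0r.
    rewrite -scalerAr mulrA TT eq_sym (negPf nh) mul0r scaler0 //.
  have rT' : al 0 (rho (T 0)) = eta x 0 *: (T 0 * S * st S) +
     (Num.conj (eta x 0) / sd) *: (S * st (T 0)) + \sum_k X k * st (T k).
    rewrite rT; congr (_ + _); rewrite exchange_big; apply: eq_bigr => k _.
    by rewrite mulr_suml; apply: eq_bigr => h _; rewrite -scalerAl !add0r.
  have eta1 : Num.conj (eta x 0) * eta x 0 = 1 by rewrite mulrC -normCK (pe_eta Hx) expr1n.
  have SS : st S * S = 1 by exact: iS.
  rewrite -iU {2}rT' !mulrDr rT' !starD !mulrDl.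
  have z1 : st (eta x 0 *: (T 0 * S * st S)) * ((Num.conj (eta x 0) / sd) *: (S * st (T 0))) = 0.
    by rewrite starZ !starM -scalerAl -scalerAr -!mulrA (mulrA (st (T 0)) S) TS mul0r !mulr0 !scaler0.
  have z1' : st ((Num.conj (eta x 0) / sd) *: (S * st (T 0))) * (eta x 0 *: (T 0 * S * st S)) = 0.
    by rewrite -[LHS]starK starM starK z1 star0.
  have z2 : st (eta x 0 *: (T 0 * S * st S)) * (\sum_k X k * st (T k)) = 0.
    rewrite mulr_sumr big1 // => k _.
    rewrite starZ !starM -scalerAl -!mulrA (mulrA (st (T 0))) TX -scalerAl -scalerAr.
    by rewrite (mulrA (st S)) ST mul0r scaler0 mulr0 scaler0.
  have z2' : st (\sum_k X k * st (T k)) * (eta x 0 *: (T 0 * S * st S)) = 0.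
    by rewrite -[LHS]starK starM starK z2 star0.
  have z3 : st ((Num.conj (eta x 0) / sd) *: (S * st (T 0))) * (\sum_k X k * st (T k)) = 0.
    rewrite mulr_sumr big1 // => k _.
    by rewrite starZ !starM -scalerAl -!mulrA (mulrA (st S)) SX mul0r mulr0 scaler0.
  have z3' : st (\sum_k X k * st (T k)) * ((Num.conj (eta x 0) / sd) *: (S * st (T 0))) = 0.
    by rewrite -[LHS]starK starM starK z3 star0.
  rewrite z1 z1' z2 z2' z3 z3' !addr0 !add0r.
  have -> : st (eta x 0 *: (T 0 * S * st S)) * (eta x 0 *: (T 0 * S * st S)) = S * st S.
    rewrite starZ !starM starK -scalerAl -scalerAr scalerA eta1 scale1r -!mulrA.
    by rewrite TTx eqxx (mulrA (st S)) SS mul1r.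
  have -> : st ((Num.conj (eta x 0) / sd) *: (S * st (T 0))) *
     ((Num.conj (eta x 0) / sd) *: (S * st (T 0))) = (dimH R G)%:C%C^-1 *: (T 0 * st (T 0)).
    rewrite starZ !starM starK -scalerAl -scalerAr scalerA -!mulrA (mulrA (st S)) SS mul1r.
    congr (_ *: _); rewrite rmorphM fmorphV /= conjCK sd_conj -sd_sqr.
    by rewrite mulrACA (mulrC (eta x 0)) eta1 mul1r expr2 invfM.
  rewrite -[in RHS]addrA; congr (_ + _).
  have -> : st (\sum_k X k * st (T k)) * (\sum_k X k * st (T k)) =
     \sum_k (1 - (dimH R G)%:C%C^-1 * (k == 0)%:R) *: (T k * st (T k)).
    rewrite star_sum mulr_suml; apply: eq_bigr => k _.
    rewrite mulr_sumr (bigD1 k) //= big1 ?addr0 => [|k' nk].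
      rewrite starM starK -!mulrA (mulrA (st (X k))) XX eqxx eta1 mul1r.
      by rewrite -scalerAl mul1r scalerAr.
    by rewrite starM -!mulrA (mulrA (st (X k))) XX eq_sym (negPf nk) mul0r mulr0.
  rewrite (bigD1 0) //= [in RHS](bigD1 0) //= addrA; congr (_ + _).
    by rewrite -scalerDl eqxx mulr1 addrC subrK scale1r.
  apply: eq_bigr => k /negPf ->; by rewrite mulr0 subr0 scale1r.
have decomp z : z = S * (st S * z) + \sum_g T g * (st (T g) * z).
  rewrite -{1}[z]mul1r -full mulrDl mulr_suml mulrA; congr (_ + _).
  by apply: eq_bigr => g _; rewrite mulrA.
have T0n : forall g, T g <> 0.
  move=> g e; have := TT g g; rewrite e mulr0 eqxx => /eqP; by rewrite eq_sym oner_eq0.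
have alSc h : exists c : R[i], al h S = c *: S.
  have hh : hom idfun (rho \o rho) (al h S).
    move=> z /=; have := congr1 (al h) (hS (al (- h) z)).
    have k1 w : al h (al (- h) w) = w.
      by rewrite -[LHS]/((al h \o al (- h)) w) -alD subrr al0.
    rewrite /= !endoM // k1 => ->; congr (_ * _).
    have k2 w : al h (rho w) = rho (al (- h) w) by exact: (congr1 (@^~ w) (alr h)).
    have k3 w : al (- h) (rho w) = rho (al h w).
      by have := congr1 (@^~ w) (alr (- h)); rewrite opprK.
    by rewrite k2 k3 k1.
  have [c hc] := @obj_id_simple _ _ C _ (homM hh (homV (@endo_id _ _) err hS)).
  exists c; rewrite (decomp (al h S)) hc big1 ?addr0 -?scalerAr ?mulr1 // => g _.
  rewrite (@cls_hom_mix _ _ cls 0 g (st (T g) * al h S)) ?mulr0 //.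
  rewrite al0; apply: homM hh _; apply: homV => //; exact: endo_comp.
(* With al_h S = c S, apply al_{-h} to the normalization of T_0, which becomes that of T_{-2h} up to
   one change: since al_{-h} rho = rho al_h, a factor c appears. So c = 1. *)
have alS h : al h S = S.
  have [c hc] := alSc h; rewrite hc.
  have [c1|] := eqVneq c 1; first by rewrite c1 scale1r.
  have e := sdT (- h *+ 2); move=> /eqP nc; case: nc.
  have e2 := congr1 (al (- h)) (sdT 0).
  rewrite endoZ // endoM // endoS // alT0 in e2.
  have k3 w : al (- h) (rho w) = rho (al h w).
    by have := congr1 (@^~ w) (alr (- h)); rewrite opprK.
  rewrite k3 hc endoZ // -scalerAr scalerA mulrC -scalerA e in e2.
  move/eqP: e2; rewrite -[X in _ == X]scale1r -subr_eq0 -scalerBl scaler_eq0 subr_eq0.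
  by case/orP => /eqP // /T0n.
(* S^* rho(S) is a scalar because [rho] is simple. Its value is not computed: it stays the parameter
   [c], which every move below leaves unchanged. *)
have hrr : hom rho rho (st S * rho S).
  apply: (homM (t := rho \o rho \o rho)).
    have := homI er hS; by apply.
  apply: (@homV _ _ rho (rho \o rho \o rho)) => //; first by do 2 apply: endo_comp => //.
  exact: (@homR _ _ idfun _ rho _ hS).
have srho : simple rho by have := cls_alr cls 0; rewrite al0.
have [c hc] := srho _ hrr.
exists rho, al, S, T, c; split=> //=.
- rewrite {1}(decomp (rho S)) hc -scalerAr mulr1; congr (_ + _).
  apply: eq_bigr => g _; rewrite scalerAr; congr (_ * _).
  by rewrite -{2}(sdT g) scalerA mulVf ?sd_neq0 // scale1r.
Qed.

End Standard.
Arguments cls_al [R M C G al rho] cls g [T].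
Arguments cls_alr [R M C G al rho] cls g [T].

(** * Transport of a lifting along frames *)

Section Twist.
Variables (R : realType) (M : starAlg R) (C : fusionCat M) (G : finZmodType).
Local Notation st := (@star R M).
Implicit Types (g h k : G).

(** [w] measures how far F is from being strict on the group part; strict associativity of [ften]
    makes it a cocycle. *)
Definition graded_frames (F : autoeq C) (A : G -> frame M) (w : G -> G -> R[i]) :=
  [/\ forall g, frame_ok F (A g), forall g h, `|w g h| = 1 &
      forall g h, ften F (A g) (A h) = fscale (w g h) (A (g + h))].

Lemma graded_cocycle (F : autoeq C) A w : graded_frames F A w -> cocycle w.
Proof.
move=> [hA w1 AA]; split=> // g h k.
have := ftenA (hA g) (hA h) (hA k).
rewrite !AA fscale_tenl fscale_tenr // !AA !fscaleA addrA.
exact: fscale_inj (hA _).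
Qed.

Variables (F : autoeq C) (A : G -> frame M) (P : frame M).
Variables (w : G -> G -> R[i]) (k : G -> R[i]).
Hypothesis gA : graded_frames F A w.
Hypothesis A0 : A 0 = fone F.
Hypothesis hP : frame_ok F P.
Hypothesis k1 : forall h, `|k h| = 1.
Hypothesis PA : forall h, ften F P (A h) = fscale (k h) (ften F (A (- h)) P).
Local Infix "\*" := (ften F) (at level 40, left associativity).
Local Notation al g := (fsrc (A g)).
Local Notation al' g := (ftgt (A g)).
Local Notation rho := (fsrc P).
Local Notation rho' := (ftgt P).

Let hA g : frame_ok F (A g). Proof. by case: gA. Qed.
Let w1 g h : `|w g h| = 1. Proof. by case: gA. Qed.
Let AA g h : A g \* A h = fscale (w g h) (A (g + h)). Proof. by case: gA. Qed.

Lemma unit_conj (c : R[i]) : `|c| = 1 -> c * Num.conj c = 1.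
Proof. by move=> c1; rewrite -normCK c1 expr1n. Qed.

Lemma unit_conjl (c : R[i]) : `|c| = 1 -> Num.conj c * c = 1.
Proof. by move=> c1; rewrite mulrC unit_conj. Qed.

Let wl0 g : w 0 g = 1.
Proof.
have := AA 0 g; rewrite A0 ften1l // add0r -[LHS]fscale1 => e.
by rewrite (fscale_inj (hA g) e).
Qed.

Let wr0 g : w g 0 = 1.
Proof.
have := AA g 0; rewrite A0 ften1r // addr0 -[LHS]fscale1 => e.
by rewrite (fscale_inj (hA g) e).
Qed.

(** P is moved past A_g and A_h one at a time, or past A_{g+h} in one go. *)
Lemma twist_k g h : w g h * k (g + h) = k g * k h * w (- g) (- h).
Proof.
have e : P \* (A g \* A h) = P \* A g \* A h by rewrite ftenA.
move: e; rewrite AA fscale_tenr // !PA fscale_tenl -!ftenA // !PA fscale_tenr //.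
rewrite ftenA // AA !fscaleA fscale_tenl fscaleA opprD.
exact: (fscale_inj (ften_ok (hA _) hP)).
Qed.

Lemma twist_k0 : k 0 = 1.
Proof.
have := PA 0; rewrite oppr0 A0 ften1l // ften1r // -[LHS]fscale1 => e.
by rewrite (fscale_inj hP e).
Qed.

Let wgN g : w g (- g) = w (- g) g.
Proof.
have [_ a] := graded_cocycle gA; have := a g (- g) g.
by rewrite addNr subrr wl0 wr0 !mulr1.
Qed.

Lemma unit_neq0 (c : R[i]) : `|c| = 1 -> c != 0.
Proof. by move=> c1; rewrite -normr_eq0 c1 oner_eq0. Qed.

Lemma twist_kN h : k h * k (- h) = 1.
Proof.
have := twist_k h (- h); rewrite subrr twist_k0 opprK wgN mulr1 => e.
by apply: (mulIf (unit_neq0 (w1 (- h) h))); rewrite mul1r -e.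
Qed.

Let APA g h : A g \* P \* A h = fscale (k h * w g (- h)) (A (g - h) \* P).
Proof. by rewrite -ftenA // PA fscale_tenr // ftenA // AA fscale_tenl fscaleA. Qed.

Let PPA h : P \* P \* A h = A h \* (P \* P).
Proof.
rewrite -ftenA // PA fscale_tenr; [|exact: hP].
rewrite ftenA // PA fscale_tenl fscaleA twist_kN fscale1 opprK -ftenA //.
Qed.

Lemma fmor_eqscale c X Y Z (T : M) : X = fscale c Y -> fmor F X Z T = Num.conj c *: fmor F Y Z T.
Proof. by move=> ->; rewrite fmor_scalel. Qed.

Lemma fmor_eqscaleV c X Y Z (T : M) : `|c| = 1 -> X = fscale c Y -> fmor F Y Z T = c *: fmor F X Z T.
Proof. by move=> c1 ->; rewrite fmor_scalel scalerA unit_conj // scale1r. Qed.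

Variables (S : M) (T : G -> M) (y : ldata R G).
Hypothesis L : lift C (fun g => al g) rho S T y.
Hypothesis cls : simple_classes C (fun g => al' g) rho'.

Let hAP g : frame_ok F (A g \* P). Proof. exact: ften_ok. Qed.
Let hPP : frame_ok F (P \* P). Proof. exact: ften_ok. Qed.
Let h1 : frame_ok F (fone F). Proof. exact: fone_ok. Qed.
Let hT g : hom (fsrc (A g \* P)) (fsrc (P \* P)) (T g). Proof. exact: (lf_T L). Qed.
Let hS : hom (fsrc (fone F)) (fsrc (P \* P)) S. Proof. exact: (lf_S L). Qed.
Let hTV g : hom (fsrc (P \* P)) (fsrc (A g \* P)) (st (T g)).
Proof. by apply: homV (hT g); [exact: (obj_endo (ok_src (hAP g)))|exact: (obj_endo (ok_src hPP))]. Qed.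
Let hSV : hom (fsrc (P \* P)) (fsrc (fone F)) (st S).
Proof. by apply: homV hS => //; exact: (obj_endo (ok_src hPP)). Qed.

Definition tw_S := fmor F (fone F) (P \* P) S.
Definition tw_T g := fmor F (A g \* P) (P \* P) (T g).

(** The phase in [A g \* P \* A g = fscale (tw_c g) P], the framed form of al_g rho al_g = rho. *)
Definition tw_c g := k g * w g (- g).

(** Each extra factor is a phase picked up when a word in the A_g and P is brought to the form in
    which an intertwiner was transported. For [l_c] none arises, and for [l_eta] they cancel. *)
Definition twist : ldata R G := Ldata
  (fun h g => l_eps y h g * Num.conj (w h g) * w (g + h *+ 2) (- h) * k h)
  (l_c y)
  (fun g => l_b y g * tw_c g)
  (l_eta y)
  (fun g => l_eta2 y g * Num.conj (tw_c g))
  (fun g h j => l_amp y g h j * Num.conj (w g (- g)) * k h *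
     w (g + h + j) (- h) * w (g + h) (- g)).

Lemma tw_c1 g : `|tw_c g| = 1.
Proof. by rewrite normrM k1 w1 mulr1. Qed.

Let APAP g : A g \* P \* (A g \* P) = fscale (tw_c g) (P \* P).
Proof.
by rewrite (ftenA (hAP g)) // APA fscale_tenl subrr A0 ften1l.
Qed.

(* Tensoring T g on the right moves it to any source with the same underlying
   word; the scalar is the one relating the two frames of that word. *)
Lemma tw_T_right g X Y Z c : frame_ok F X -> `|c| = 1 ->
  A g \* P \* X = fscale c Y -> P \* P \* X = Z -> fmor F Y Z (T g) = c *: tw_T g.
Proof.
move=> hX c1 e <-; rewrite (fmor_eqscaleV _ _ c1 e) fmor_tenr //.
Qed.

Lemma tw_S_right X Z : frame_ok F X -> P \* P \* X = Z -> fmor F X Z S = tw_S.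
Proof. by move=> hX <-; rewrite -{1}(ften1l hX) fmor_tenr. Qed.

Let er : star_endo rho. Proof. exact: lf_Er L. Qed.

Lemma twist_lift : lift C (fun g => al' g) rho' tw_S tw_T twist.
Proof.
have SV : st tw_S = fmor F (P \* P) (fone F) (st S) by rewrite fmor_star.
have TV g : st (tw_T g) = fmor F (P \* P) (A g \* P) (st (T g)) by rewrite fmor_star.
have alD g h : al (g + h) = al g \o al h := lf_D L g h.
have alr g : al g \o rho = rho \o al (- g) := lf_rho L g.
split=> //=.
- by rewrite A0.
- by move=> g h; have := congr1 (@ftgt _ _) (AA g h).
- by move=> g; have := congr1 (@ftgt _ _) (PA (- g)); rewrite /= opprK.
- exact: (fmor_hom h1 hPP hS).
- by move=> g; exact: (fmor_hom (hAP g) hPP (hT g)).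
- by rewrite SV -fmor_comp // (lf_SS L) fmor1.
- by move=> g; rewrite SV -fmor_comp // (lf_ST L) fmor0.
- move=> g h; rewrite TV -fmor_comp // (lf_TT L).
  by case: eqP => [->|_]; rewrite ?fmor1 ?fmor0.
- have -> : tw_S * st tw_S = fmor F (P \* P) (P \* P) (S * st S).
    by rewrite SV -fmor_comp.
  have hTT g : hom (fsrc (P \* P)) (fsrc (P \* P)) (T g * st (T g)).
    exact: homM (hTV g) (hT g).
  have -> : \sum_g tw_T g * st (tw_T g) = fmor F (P \* P) (P \* P) (\sum_g T g * st (T g)).
    by rewrite fmor_sum //; apply: eq_bigr => g _; rewrite TV -fmor_comp.
  rewrite -fmorD //; first by rewrite (lf_full L) fmor1.
    exact: homM hSV hS.
  exact: hom_sum.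
- move=> h; rewrite /tw_S -fmor_tenl // (lf_alS L) ften1r //.
  by rewrite (tw_S_right (hA h) (PPA h)).
- move=> h g; rewrite {1}/tw_T -fmor_tenl // (lf_alT L).
  have e1 : A h \* (A g \* P) = fscale (w h g) (A (h + g) \* P).
    by rewrite ftenA // AA fscale_tenl.
  have e2 := APA (g + h *+ 2) h.
  have e3 : g + h *+ 2 - h = h + g by rewrite mulr2n addrA addrK addrC.
  rewrite e3 in e2.
  have hs : hom (fsrc (A h \* (A g \* P))) (fsrc (A h \* (P \* P))) (T (g + h *+ 2)).
    rewrite e1 -PPA; have := @homR _ _ _ _ (al h) _ (hT (g + h *+ 2)).
    have := congr1 (@fsrc _ _) e2; by rewrite /= => <-.
  rewrite fmorZ //; try exact: ften_ok.
  rewrite (fmor_eqscale _ _ e1).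
  rewrite (tw_T_right (hA h) _ e2 (PPA h)) ?normrM ?k1 ?w1 ?mulr1 //.
  by rewrite !scalerA; congr (_ *: _); rewrite -!mulrA (mulrC (k h)).
- have hPPP := ften_ok hP hPP.
  have hAPP g := ften_ok (hA g) hPP.
  rewrite /tw_S -fmor_tenl // (lf_rS L) ften1r //.
  have hs : hom rho (rho \o (rho \o rho)) S.
    exact: (@homR _ _ _ _ rho _ hS).
  have e1 g : A g \* P \* A g = fscale (tw_c g) P.
    by rewrite APA subrr A0 ften1l.
  have hs1 g : hom rho (al g \o (rho \o rho)) (T g).
    have := @homR _ _ _ _ (al g) _ (hT g); have := congr1 (@fsrc _ _) (e1 g).
    have := congr1 (@fsrc _ _) (PPA g); by rewrite /= => -> ->.
  have hs2 g : hom (al g \o (rho \o rho)) (rho \o (rho \o rho)) (T g).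
    exact: (@homR _ _ _ _ rho _ (hT g)).
  rewrite fmor_lin //; last first.
    by apply: hom_sum => g; apply: homZ (homM (hs1 g) (hs2 g)); do 2 apply: endo_comp => //.
  rewrite (tw_S_right hP (esym (ftenA hP hP hP))); congr (_ + _).
  rewrite fmor_sum //; last first.
    by move=> g; apply: homZ (homM (hs1 g) (hs2 g)); do 2 apply: endo_comp => //.
  apply: eq_bigr => g _.
  rewrite fmorZ //; last exact: homM (hs1 g) (hs2 g).
  rewrite (fmor_comp hP (hAPP g) hPPP (hs1 g) (hs2 g)) -scalerA; congr (_ *: _).
  rewrite (tw_T_right (hA g) (tw_c1 g) (e1 g) (PPA g)) -scalerAr; congr (_ *: (_ * _)).
  by have := fmor_tenr (hAP g) hPP hP (hT g); rewrite -!ftenA.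
- move=> g.
  have hPPP := ften_ok hPP hP.
  have hAPP h := ften_ok (hA h) hPP.
  have hZ := ften_ok (hAPP g) hP.
  have eZ : P \* P \* (A g \* P) = A g \* (P \* P) \* P.
    by rewrite (ftenA hPP) // PPA.
  have hZ' : A g \* (P \* (P \* P)) = A g \* (P \* P) \* P by rewrite !ftenA //; exact: ften_ok.
  rewrite {1}/tw_T -(fmor_tenl hP) // -(fmor_tenl (hA g)); last first.
    by apply: homI.
  1,2: try exact: ften_ok.
  have -> : al g (rho (T g)) = l_eta y g *: (T g * S * st S) + l_eta2 y g *: (S * st (T g)) +
    \sum_h \sum_j l_amp y g h j *: (T (g + h) * T (g + h + j) * st (T (g + j))) := lf_rT L g.
  have e0 : A g \* (P \* (A g \* P)) = fscale (tw_c g) (P \* P).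
    by rewrite ftenA // APAP.
  rewrite (fmor_eqscale _ _ e0) hZ'.
  have t1 : hom (fsrc (P \* P)) (fsrc (A g \* (P \* P) \* P)) (T g).
    have := @homR _ _ _ _ (fsrc (A g \* P)) _ (hT g).
    have := congr1 (@fsrc _ _) (APAP g); have := congr1 (@fsrc _ _) eZ.
    by rewrite /= => -> ->.
  have t2 : hom (fsrc (A g \* P)) (fsrc (A g \* (P \* P) \* P)) S.
    have := @homR _ _ _ _ (fsrc (A g \* P)) _ hS.
    by have := congr1 (@fsrc _ _) eZ; rewrite /= => ->.
  (* The summand T_{g+h} T_{g+h+j} T_{g+j}^* passes through the words al_{g+j} rho and al_h rho^2.
     [e3] and [e4] rewrite these so that each T acts on the leftmost letters only, and record the
     resulting phases. *)
  have e3 h j : A (g + h + j) \* P \* A h = fscale (k h * w (g + h + j) (- h)) (A (g + j) \* P).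
    by rewrite APA; congr (fscale _ (A _ \* _)); rewrite addrAC addrK.
  have e4 h : A (g + h) \* P \* (A g \* P) = fscale (k g * w (g + h) (- g)) (A h \* (P \* P)).
    rewrite (ftenA (hAP _)) // APA fscale_tenl -ftenA //; congr (fscale _ (A _ \* _)).
    by rewrite addrC addrA addNr add0r.
  have t3 h j : hom (fsrc (A (g + j) \* P)) (fsrc (A h \* (P \* P))) (T (g + h + j)).
    have := @homR _ _ _ _ (al h) _ (hT (g + h + j)).
    by have := congr1 (@fsrc _ _) (e3 h j); have := congr1 (@fsrc _ _) (PPA h); rewrite /= => -> ->.
  have t4 h : hom (fsrc (A h \* (P \* P))) (fsrc (A g \* (P \* P) \* P)) (T (g + h)).
    have := @homR _ _ _ _ (fsrc (A g \* P)) _ (hT (g + h)).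
    by have := congr1 (@fsrc _ _) (e4 h); have := congr1 (@fsrc _ _) eZ; rewrite /= => -> ->.
  have ez : star_endo (fsrc (A g \* (P \* P) \* P)) by exact: obj_endo (ok_src hZ).
  have m1 : hom (fsrc (P \* P)) (fsrc (A g \* (P \* P) \* P)) (T g * S * st S).
    by apply: (homM hSV); apply: (homM hS).
  have m2 : hom (fsrc (P \* P)) (fsrc (A g \* (P \* P) \* P)) (S * st (T g)).
    exact: homM (hTV g) t2.
  have m3 h j : hom (fsrc (P \* P)) (fsrc (A g \* (P \* P) \* P))
      (T (g + h) * T (g + h + j) * st (T (g + j))).
    by apply: (homM (hTV _)); apply: (homM (t3 h j)).
  have m3' h j := homZ (l_amp y g h j) ez (m3 h j).
  have m4 h : hom (fsrc (P \* P)) (fsrc (A g \* (P \* P) \* P)) (\sum_j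
      l_amp y g h j *: (T (g + h) * T (g + h + j) * st (T (g + j)))) by exact: hom_sum.
  have m12 := homL (l_eta y g) ez m1 (homZ (l_eta2 y g) ez m2).
  rewrite (fmorD hPP hZ m12 (hom_sum (index_enum G) xpredT m4)).
  rewrite (fmor_lin _ hPP hZ m1 (homZ (l_eta2 y g) ez m2)).
  rewrite (fmorZ _ hPP hZ m2) !scalerDr; congr (_ + _ + _).
  + rewrite scalerA mulrC -scalerA; congr (_ *: _).
    rewrite -(mulrA (T g)) -(mulrA (tw_T g)) SV (fmor_comp hPP hPP hZ (homM hSV hS) t1) (fmor_comp hPP h1 hPP hSV hS).
    rewrite (tw_T_right (hAP g) (tw_c1 g) (APAP g) eZ).
    by rewrite -scalerAl scalerA unit_conjl ?tw_c1 // scale1r.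
  + rewrite scalerA mulrC; congr (_ *: _).
    rewrite TV (fmor_comp hPP (hAP g) hZ (hTV g) t2); congr (_ * _).
    exact: (tw_S_right (hAP g) eZ).
  + rewrite (fmor_sum hPP hZ) ?scaler_sumr; last by move=> h; exact: hom_sum.
    apply: eq_bigr => h _; rewrite (fmor_sum hPP hZ) ?scaler_sumr //.
    apply: eq_bigr => j _; rewrite (fmorZ _ hPP hZ) // scalerA.
    rewrite (fmor_comp hPP (hAP (g + j)) hZ) //; last exact: homM (t3 h j) (t4 h).
    rewrite (fmor_comp (hAP (g + j)) (hAPP h) hZ) // TV.
    rewrite (tw_T_right (hA h) _ (e3 h j) (PPA h)) ?normrM ?k1 ?w1 ?mulr1 //.
    rewrite (tw_T_right (hAP g) _ (e4 h) eZ) ?normrM ?k1 ?w1 ?mulr1 //.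
    have scl (a b : R[i]) (u v z : M) : a *: u * (b *: v) * z = (a * b) *: (u * v * z).
      by rewrite -scalerAl -scalerAl -scalerAr -scalerAl scalerA.
    rewrite scl scalerA; congr (_ *: _).
    rewrite /tw_c rmorphM /=; have := unit_conjl (k1 g).
    have id7 (a b c d u v z : R[i]) : a * b = 1 ->
        a * c * d * (b * u * (v * z)) = d * c * v * z * u.
      move=> ab; transitivity (a * b * (d * c * v * z * u)); first by ring.
      by rewrite ab mul1r.
    exact: id7.
Qed.

End Twist.

(** * Rescaling the T_g, replacing rho by al_p rho, relabelling G *)

Section Moves.
Variables (R : realType) (M : starAlg R) (C : fusionCat M) (G : finZmodType).
Local Notation st := (@star R M).
Implicit Types (g h k : G) (x : numdata R G) (al : G -> M -> M) (rho : M -> M).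

Definition shift_data p x : numdata R G :=
  NumData (fun h g => eps x h (g + p)) (fun g => eta x (g + p))
          (fun g h k => amp x (g + p) h k).

Definition relabel_data (t : {perm G}) x : numdata R G :=
  NumData (fun h g => eps x ((t^-1)%g h) ((t^-1)%g g)) (fun g => eta x ((t^-1)%g g))
          (fun g h k => amp x ((t^-1)%g g) ((t^-1)%g h) ((t^-1)%g k)).

Definition rescale_ldata (t : G -> R[i]) (y : ldata R G) : ldata R G := Ldata
  (fun h g => l_eps y h g * t g * Num.conj (t (g + h *+ 2))) (l_c y)
  (fun g => l_b y g * Num.conj (t g) ^+ 2) (l_eta y)
  (fun g => l_eta2 y g * t g ^+ 2)
  (fun g h k => l_amp y g h k * t g * Num.conj (t (g + h)) *
     Num.conj (t (g + h + k)) * t (g + k)).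

Lemma rescale_lift al rho S T y t : (forall g, `|t g| = 1) ->
  lift C al rho S T y -> lift C al rho S (fun g => t g *: T g) (rescale_ldata t y).
Proof.
move=> t1 L; have tt g := unit_conj (t1 g); have tt' g := unit_conjl (t1 g).
have er := lf_Er L; have ea := lf_Ear L.
have err : star_endo (rho \o rho) by exact: endo_comp.
have TV g : T g = Num.conj (t g) *: (t g *: T g) by rewrite scalerA tt' scale1r.
split=> /=.
- exact: lf_cls L.
- exact: lf_0 L.
- exact: lf_D L.
- exact: lf_rho L.
- exact: lf_S L.
- move=> g; apply: homZ => //; exact: lf_T L g.
- exact: lf_SS L.
- by move=> g; rewrite -scalerAr (lf_ST L) scaler0.
- move=> g h; rewrite starZ -scalerAl -scalerAr scalerA (lf_TT L).
  by case: eqP => [->|_]; rewrite ?scaler0 // tt' scale1r.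
- rewrite -(lf_full L); congr (_ + _); apply: eq_bigr => g _.
  by rewrite starZ -scalerAl -scalerAr scalerA tt scale1r.
- exact: lf_alS L.
- move=> h g; rewrite endoZ // (lf_alT L) {1}(TV (g + h *+ 2)) !scalerA.
  by congr (_ *: _); rewrite (mulrC (t g)).
- rewrite (lf_rS L); congr (_ + _); apply: eq_bigr => g _.
  rewrite -scalerAl -scalerAr !scalerA; congr (_ *: _).
  have id2 (b t0 c : R[i]) : c * t0 = 1 -> b = b * c ^+ 2 * t0 * t0.
    by move=> e; transitivity (b * (c * t0) ^+ 2); [rewrite e expr1n mulr1|ring].
  exact: id2.
- move=> g; rewrite (endoZ _ _ er) (endoZ _ _ (ea g)) (lf_rT L) !scalerDr; congr (_ + _ + _).
  + by rewrite scalerA mulrC -scalerA -!scalerAl.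
  + rewrite starZ -scalerAr !scalerA; congr (_ *: _).
    by rewrite mulrC -mulrA expr2 -mulrA tt mulr1.
  + rewrite scaler_sumr; apply: eq_bigr => h _; rewrite scaler_sumr; apply: eq_bigr => k _.
    have scl (a b d : R[i]) (u v z : M) :
        a *: u * (b *: v) * st (d *: z) = (a * b * Num.conj d) *: (u * v * st z).
      by rewrite starZ -scalerAl -scalerAl -scalerAr -scalerAr -scalerAl !scalerA mulrAC.
    have id6 (m e a a' b b' d d' : R[i]) : a' * a = 1 -> b' * b = 1 -> d * d' = 1 ->
        e * m = m * e * a' * b' * d * (a * b * d').
      move=> e1 e2 e3; transitivity (m * e * (a' * a) * (b' * b) * (d * d')); last by ring.
      by rewrite e1 e2 e3 !mulr1 mulrC.
    rewrite scl !scalerA; congr (_ *: _).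
    exact: id6.
Qed.

Lemma shift_cls al rho p : al 0 = idfun -> (forall g h, al (g + h) = al g \o al h) ->
  simple_classes C al rho -> simple_classes C al (al p \o rho).
Proof.
move=> al0 alD [[ca cr] s i j n].
have e g : al g \o (al p \o rho) = al (g + p) \o rho by rewrite alD.
split=> //.
- by split=> //; apply: obj_comp.
- move=> t ct; apply: (iff_trans (s t ct)); split=> -[[g hg]|[g hg]]; [left|right|left|right].
  + by exists g.
  + by exists (g - p); rewrite e subrK.
  + by exists g.
  + by exists (g + p); rewrite -e.
- by move=> g h; rewrite !e => /j /addIr.
- by move=> g h; rewrite e; apply: n.
Qed.

(** al_p rho has the same square as [rho], so S and the T_g survive and only the index of T moves.
    Applying al_p to rho(S) multiplies each T_g T_g by the square of a sign, which is 1. *)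
Lemma shift_lift x c al rho S T p : (forall h g, eps x h g = 1 \/ eps x h g = -1) ->
  lift C al rho S T (std_ldata x c) ->
  lift C al (al p \o rho) S (fun g => T (g + p)) (std_ldata (shift_data p x) c).
Proof.
move=> e1 L; have alD := lf_D L; have ea := lf_Ear L.
have rr : (al p \o rho) \o (al p \o rho) = rho \o rho.
  rewrite {2}(lf_rho L p) -[LHS]/(al p \o (rho \o rho) \o al (- p)).
  have -> : al p \o (rho \o rho) = (rho \o rho) \o al p.
    rewrite -[LHS]/((al p \o rho) \o rho) (lf_rho L p).
    by rewrite -[LHS]/(rho \o (al (- p) \o rho)) (lf_rho L (- p)) opprK.
  by rewrite -[LHS]/((rho \o rho) \o (al p \o al (- p))) -alD subrr (lf_0 L).
have e g : al g \o (al p \o rho) = al (g + p) \o rho by rewrite alD.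
split=> //=.
- by apply: shift_cls; [exact: lf_0 L|exact: lf_D L|exact: lf_cls L].
- exact: lf_0 L.
- move=> g; rewrite e -[RHS]/(al p \o (rho \o al (- g))) -(lf_rho L g).
  by rewrite -[RHS]/(al p \o al g \o rho) -alD addrC.
- by rewrite rr; exact: lf_S L.
- by move=> g; rewrite e rr; exact: lf_T L _.
- exact: lf_SS L.
- by move=> g; exact: lf_ST L _.
- by move=> g h; rewrite (lf_TT L) (inj_eq (addIr p)).
- rewrite -[RHS](lf_full L); congr (_ + _).
  by rewrite [RHS](reindex_inj (addIr p)).
- exact: lf_alS L.
- by move=> h g; rewrite (lf_alT L) addrAC.
- rewrite (lf_rS L) endoD // endoZ // (lf_alS L); congr (_ + _).
  rewrite endo_sum // [RHS](reindex_inj (addIr p)); apply: eq_bigr => g _.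
  rewrite endoZ // endoM // (lf_alT L) -scalerAl -scalerAr !scalerA /=.
  rewrite -addrA -mulr2n; congr (_ *: _).
  by have [->|->] := e1 p g; rewrite ?mulr1 // !mulrN1 opprK.
- move=> g; have := lf_rT L (g + p); rewrite alD /= => ->; congr (_ + _).
  apply: eq_bigr => h _; apply: eq_bigr => k _.
  by rewrite !(addrAC g p) (addrAC (g + h) p).
Qed.

Lemma relabel_lift x c al rho S T (t : {perm G}) : {morph t : g h / g + h} ->
  lift C al rho S T (std_ldata x c) ->
  lift C (fun g => al ((t^-1)%g g)) rho S (fun g => T ((t^-1)%g g))
    (std_ldata (relabel_data t x) c).
Proof.
move=> tD L; have sD := autV tD; set s := (t^-1)%g in sD *.
have sb : injective s := @perm_inj _ s.
have [cr clS i j n] := lf_cls L.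
split=> //=.
- split=> //.
  + by case: cr.
  + move=> r cr'; apply: (iff_trans (clS r cr')); split=> -[[g hg]|[g hg]];
      [left|right|left|right]; try by exists (s g).
      by exists (t g); rewrite /s permK.
    by exists (t g); rewrite /s permK.
  + by move=> g h /i /sb.
  + by move=> g h /j /sb.
- by rewrite (aut0 sD); exact: lf_0 L.
- by move=> g h; rewrite sD; exact: lf_D L _ _.
- by move=> g; rewrite (autN sD); exact: lf_rho L _.
- exact: lf_S L.
- by move=> g; exact: lf_T L _.
- exact: lf_SS L.
- by move=> g; exact: lf_ST L _.
- by move=> g h; rewrite (lf_TT L) (inj_eq sb).
- by rewrite -[RHS](lf_full L); congr (_ + _); rewrite [RHS](reindex_inj sb).
- by move=> h; exact: lf_alS L _.
- by move=> h g; rewrite (lf_alT L) sD (autMn _ sD).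
- by rewrite {1}(lf_rS L); congr (_ + _); rewrite (reindex_inj sb).
- move=> g; rewrite (lf_rT L); congr (_ + _).
  rewrite (reindex_inj sb); apply: eq_bigr => h _.
  by rewrite (reindex_inj sb); apply: eq_bigr => k _; rewrite !sD.
Qed.

End Moves.

(** * The element of Gamma attached to an autoequivalence *)

Section Describe.
Variables (R : realType) (M : starAlg R) (C : fusionCat M) (G : finZmodType).
Local Notation st := (@star R M).
Implicit Types (g h k : G) (F K : autoeq C) (s t : M -> M).
Local Infix "\*" := ae_mul (at level 40, left associativity).

Lemma iso_refl s : iso s s.
Proof. by exists 1; [exact: hom1|exact: unitary1]. Qed.

Lemma iso_ten s s' t t' : star_endo s -> star_endo s' -> iso s s' -> iso t t' ->
  iso (s \o t) (s' \o t').
Proof.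
move=> es es' [u hu uu] [v hv vv]; exists (u * s v).
  exact: homT.
by apply: unitaryM => //; apply: unitary_endo.
Qed.

Lemma ae_mor0 F s t : C s -> C t -> ae_mor F s t 0 = 0.
Proof.
move=> cs ct; have h := hom0 s (obj_endo ct).
have := ae_lin F (-1) cs ct h h; rewrite scaler0 addr0 => ->.
by rewrite scaleN1r addNr.
Qed.

Lemma ae_iso_refl F s t : C s -> C t -> iso (F s) (F t) -> iso s t.
Proof.
move=> cs ct [X hX uX]; have [T hT e] := ae_full cs ct hX.
exists T => //; apply: (ae_unitary_refl (F := F) cs ct hT); by rewrite e.
Qed.

Lemma ae_simple F s : C s -> simple s -> simple (F s).
Proof.
move=> cs ss X hX; have [T hT e] := ae_full cs cs hX.
have [c ec] := ss T hT; exists c; rewrite -e ec -[c%:A]addr0.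
rewrite (ae_lin F c cs cs (hom1 s) (hom0 s (obj_endo cs))) ae_id //.
by rewrite ae_mor0 ?addr0.
Qed.

Variables (al : G -> M -> M) (rho : M -> M) (S : M) (T : G -> M) (y : ldata R G).
Hypothesis HM : hyperfinite_III1_factor M.
Hypothesis L : lift C al rho S T y.

Let cal g : C (al g). Proof. exact: lf_Cal L g. Qed.
Let ea g : star_endo (al g). Proof. exact: lf_Ear L g. Qed.
Let er : star_endo rho. Proof. exact: lf_Er L. Qed.
Let crho : C rho. Proof. exact: lf_Crho L. Qed.
Let al0 : al 0 = idfun. Proof. exact: lf_0 L. Qed.
Let alD g h : al (g + h) = al g \o al h. Proof. exact: lf_D L g h. Qed.
Let alr g : al g \o rho = rho \o al (- g). Proof. exact: lf_rho L g. Qed.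
Let cls : simple_classes C al rho. Proof. exact: lf_cls L. Qed.
Let car g : C (al g \o rho). Proof. exact: obj_comp. Qed.
Let ear g : star_endo (al g \o rho). Proof. exact: obj_endo. Qed.

Lemma alK g x : al g (al (- g) x) = x.
Proof. by have := congr1 (@^~ x) (alD g (- g)); rewrite subrr al0 /= => <-. Qed.

Lemma alNK g x : al (- g) (al g x) = x.
Proof. by have := alK (- g) x; rewrite opprK. Qed.

(* If al g rho were invertible then rho would be surjective, so the projection
   S S^* would be central. *)
Lemma rho_not_invertible g s t : C s -> C t -> iso (al g \o rho) s ->
  iso (s \o t) idfun -> False.
Proof.
move=> cs ct [U hU [U1 U2]] [W hW [W1 W2]].
have rsurj z : exists x, rho x = z.
  pose v := W * (U * al g z * st U) * st W; exists (t v).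
  have e1 : s (t v) = U * al g z * st U.
    have := hW v; rewrite /= => /(congr1 (fun z => st W * z)).
    by rewrite mulrA W1 mul1r => ->; rewrite /v -!mulrA W1 mulr1 !mulrA W1 mul1r.
  have e2 : al g (rho (t v)) = al g z.
    have := hU (t v); rewrite /= e1 => /(congr1 (fun z => st U * z)).
    by rewrite mulrA U1 mul1r -!mulrA U1 mulr1 mulrA U1 mul1r.
  by rewrite -[LHS](alNK g) e2 alNK.
have [c hc] : exists c : R[i], S * st S = c%:A.
  apply: (@obj_id_simple _ _ C) => x /=.
  have [x1 <-] := rsurj x; have [x2 <-] := rsurj x1.
  have h := homM (homV (@endo_id _ _) (endo_comp er er) (lf_S L)) (lf_S L).
  exact: h x2.
have : c *: T 0 = 0.
  by rewrite -[T 0]mul1r scalerAl -hc -mulrA (lf_ST L) mulr0.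
move/eqP; rewrite scaler_eq0 => /orP [/eqP c0|/eqP T0].
  have S0 : S = 0 by rewrite -[S]mulr1 -(lf_SS L) mulrA hc c0 scale0r mul0r.
  by have := lf_SS L; rewrite S0 mulr0 => /eqP; rewrite eq_sym oner_eq0.
by have := lf_TT L 0 0; rewrite T0 mulr0 eqxx => /eqP; rewrite eq_sym oner_eq0.
Qed.

(** Frames are indexed by their targets, so the cocycle lives on the target side. This matches
    [gamma_mul], which pulls the second cocycle back along the inverse of the first automorphism. *)
Definition describes F (c : gamma_rep R G) := exists A P,
  [/\ graded_frames F A (g_coc c),
      forall g, fsrc (A g) = al ((g_aut c)^-1%g g) /\ ftgt (A g) = al g,
      frame_ok F P & fsrc P = rho /\ ftgt P = al (g_pt c) \o rho].

Lemma ae_invertible F g : iso (F (al g) \o F (al (- g))) idfun.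
Proof.
apply: (iso_trans (t := F (al g \o al (- g)))).
  by exists (ae_ten F (al g) (al (- g))); [exact: ae_tenP|exact: ae_tenU].
rewrite -alD subrr al0; apply: iso_sym => //.
- by apply: ae_objE; exact: obj_id.
- by exists (ae_unit F); [exact: ae_unitP|exact: ae_unitU].
Qed.

(** F(al_g) is simple and invertible, and no al_h rho is invertible, so it is some al_h. Injectivity
    holds because F reflects isomorphism. *)
Lemma ae_perm F : exists2 t : {perm G}, {morph t : g h / g + h} &
  forall g, iso (F (al g)) (al (t g)).
Proof.
have H g : exists h, iso (F (al g)) (al h).
  have cF := ae_objP F (cal g); have [_ sp _ _ _] := cls.
  have /(sp _ cF) := ae_simple (F := F) (cal g) (cls_al cls g).
  case=> [[h hh]|[h hh]]; first by exists h; apply: iso_sym => //; exact: ae_objE.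
  by case: (rho_not_invertible cF (ae_objP F (cal (- g))) hh (ae_invertible F g)).
have [f hf] := choice H; have [_ _ ali _ _] := cls.
have eF g : star_endo (F (al g)) by exact: ae_objE.
have fi : injective f.
  move=> g h e; apply: ali; apply: (ae_iso_refl (F := F)) => //.
  apply: iso_trans (hf g) _; rewrite e; exact: iso_sym.
exists (perm fi) => [g h|g]; rewrite !permE //.
apply: ali; apply: (iso_trans (t := F (al (g + h)))); first exact: iso_sym.
rewrite !alD; apply: (iso_trans (t := F (al g) \o F (al h))).
  apply: iso_sym => //; [exact: endo_comp|exact/ae_objE/obj_comp|].
  by exists (ae_ten F (al g) (al h)); [exact: ae_tenP|exact: ae_tenU].
exact: iso_ten.
Qed.

(** Were F(rho) some al_h, it would be the image of an invertible object, since the permutation of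
    [ae_perm] is onto, and F would reflect this to an isomorphism between rho and that object. *)
Lemma ae_rho F : exists p, iso (F rho) (al p \o rho).
Proof.
have [t _ ht] := ae_perm F; have cF := ae_objP F crho; have [_ sp _ _ nm] := cls.
have srho : simple rho by have := cls_alr cls 0; rewrite al0.
have eF g : star_endo (F (al g)) by exact: ae_objE.
have /(sp _ cF) := ae_simple (F := F) crho srho.
case=> [[h hh]|[h hh]]; last by exists h; apply: iso_sym => //; exact: ae_objE.
case: (nm ((t^-1)%g h) 0); rewrite al0; apply: (ae_iso_refl (F := F)) => //.
apply: iso_trans (ht _) _; rewrite permKV; exact: hh.
Qed.

Lemma describes_exists F : exists c, describes F c.
Proof.
have [t tD ht] := ae_perm F; have [p hp] := ae_rho F.
have hu g : exists u, hom (F (al ((t^-1)%g g))) (al g) u /\ unitary u.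
  by have [u h1 h2] := ht ((t^-1)%g g); exists u; move: h1; rewrite permKV.
have [u uP] := choice hu; pose A g := Frame (al ((t^-1)%g g)) (al g) (u g).
have hA g : frame_ok F (A g) by have [h1 h2] := uP g; split=> /=; [exact: cal|exact: ea| |].
have hw (gh : G * G) : exists c : R[i], `|c| = 1 /\
    ften F (A gh.1) (A gh.2) = fscale c (A (gh.1 + gh.2)).
  have [c c1 ec] := frame_scalar (ften_ok (hA gh.1) (hA gh.2)) (hA (gh.1 + gh.2))
    (esym (etrans (congr1 al (autV tD _ _)) (alD _ _))) (esym (alD _ _)) (cls_al cls _).
  by exists c.
have [w wP] := choice hw.
have gA : graded_frames F A (fun g h => w (g, h)).
  by split=> // g h; [exact: (wP (g, h)).1|exact: (wP (g, h)).2].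
have [v hv uv] := hp.
exists (GammaRep p (graded_cocycle gA) tD), A, (Frame rho (al p \o rho) v).
by split=> //; split=> //=; exact: ear.
Qed.

Lemma describes_iso F K c c' : mon_iso F K -> describes F c -> describes K c' ->
  gamma_eq c c'.
Proof.
move=> [e [e' [H1 H2 H3 H4]]].
move=> [A [P [[hA w1 AA] sA hP [sP tP]]]] [B [Q [[hB v1 BB] sB hQ [sQ tQ]]]].
have [_ _ ali alri _] := cls.
(* The monoidal isomorphism, read in the two frames, is a nonzero morphism between the targets. For
   distinct simple targets there is none, so automorphisms and points agree exactly. *)
have trans X Y : frame_ok F X -> frame_ok K Y -> fsrc X = fsrc Y ->
    [/\ hom (ftgt X) (ftgt Y) (fmap Y * e (fsrc X) * st (fmap X)) &
        fmap Y * e (fsrc X) * st (fmap X) <> 0].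
  move=> hX hY eXY; have cX := ok_src hX; have [h1 h2 h3] := H1 _ cX; split.
    apply: homM (ok_homV hX) _; apply: homM h1 _; rewrite eXY; exact: (ok_hom hY).
  move=> z; have : (fmap X * e' (fsrc X) * st (fmap Y)) *
      (fmap Y * e (fsrc X) * st (fmap X)) = 1.
    rewrite -!mulrA (mulrA (st (fmap Y))) (ok_u1 hY) mul1r.
    by rewrite (mulrA (e' _)) h2 mul1r (ok_u2 hX).
  by rewrite z mulr0 => /eqP; rewrite eq_sym oner_eq0.
have et : g_aut c = g_aut c'.
  apply/permP => g; apply: contrapT => n.
  have [] := trans (A (g_aut c g)) (B (g_aut c' g)) (hA _) (hB _).
    by rewrite (sA _).1 (sB _).1 !permK.
  by rewrite (sA _).2 (sB _).2 => h []; exact: (cls_hom_al HM cls n h).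
have ep : g_pt c = g_pt c'.
  apply: contrapT => n; have [] := trans P Q hP hQ; first by rewrite sP sQ.
  by rewrite tP tQ => h []; exact: (cls_hom_alr HM cls n h).
have sAB g : fsrc (A g) = fsrc (B g) by rewrite (sA g).1 (sB g).1 et.
have hla g : exists la : R[i], la != 0 /\ fmap (B g) * e (fsrc (A g)) = la *: fmap (A g).
  have [h n] := trans (A g) (B g) (hA g) (hB g) (sAB g).
  move: h n; rewrite (sA g).2 (sB g).2 => h n; have [la hl] := cls_al cls g h.
  exists la; first split.
    by apply/eqP => z; apply: n; rewrite hl z scale0r.
  by rewrite -[fmap (A g)]mul1r scalerAl -hl -!mulrA (ok_u1 (hA g)) mulr1.
have [la laP] := choice hla.
have la0 g : la g != 0 by case: (laP g).
have laE g : fmap (B g) * e (fsrc (A g)) = la g *: fmap (A g) by case: (laP g).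
have key g h : g_coc c' g h * la (g + h) = la g * la h * g_coc c g h.
  have cg := ok_src (hA g); have ch := ok_src (hA h).
  have e1 : fmap (ften K (B g) (B h)) * e (fsrc (A g) \o fsrc (A h)) =
      (la g * la h) *: fmap (ften F (A g) (A h)).
    rewrite /= -(sAB g) -(sAB h) -!mulrA.
    have [JK _] := ae_tenU K cg ch; have [_ JF] := ae_tenU F cg ch.
    have -> : st (ae_ten K (fsrc (A g)) (fsrc (A h))) * e (fsrc (A g) \o fsrc (A h)) =
        e (fsrc (A g)) * F (fsrc (A g)) (e (fsrc (A h))) * st (ae_ten F (fsrc (A g)) (fsrc (A h))).
      rewrite -[LHS]mulr1 -JF !mulrA -(mulrA _ (e _) (ae_ten F _ _)) H3 //.
      by rewrite (mulrA (st _)) JK mul1r.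
    have [he _ _] := H1 _ cg.
    rewrite !mulrA -(mulrA (fmap (B g))) -he !mulrA laE -(mulrA _ (F _ _) (F _ _)).
    rewrite -ae_objM // laE endoZ; last exact: ae_objE.
    by rewrite -!scalerAl -scalerAr -!scalerAl scalerA.
  have es : fsrc (A g) \o fsrc (A h) = fsrc (A (g + h)).
    by have := congr1 (@fsrc _ _) (AA g h).
  move: e1; rewrite AA BB es /= -scalerAl laE !scalerA => /(congr1 (fun z => z * st (fmap (A (g + h))))).
  by rewrite -!scalerAl (ok_u2 (hA _)) => /alg_inj.
split=> //; last by exists 0; rewrite mul0rn addr0.
have nn g : `|la g| != 0 by rewrite normr_eq0.
(* [mon_iso] does not ask for unitary components, so [la] need not have modulus 1. Its modulus is
   multiplicative because both cocycles are unimodular, and dividing by it leaves the coboundary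
   unchanged. *)
exists (fun g => la g / `|la g|); split=> [g|g h].
  by rewrite normf_div normr_id divff.
have [_ _ _ wn] : [/\ True, True, True & `|la (g + h)| = `|la g| * `|la h|].
  split=> //; have := congr1 Num.norm (key g h); rewrite !normrM w1 v1.
  by rewrite mul1r mulr1.
have E : g_coc c' g h = la g * la h * g_coc c g h / la (g + h).
  by rewrite -key mulfK.
have := nn g; have := nn h; have := la0 (g + h); rewrite E wn.
move: (`|la g| : R[i]) (`|la h| : R[i]) => a b n1 n2 n3.
by field; rewrite n1 n2 n3.
Qed.

End Describe.

(** * The injective homomorphism from Out(C) to Gamma *)

Section OutMap.
Variables (R : realType) (M : starAlg R) (C : fusionCat M) (G : finZmodType).
Local Notation st := (@star R M).
Implicit Types (g h k : G) (F K : autoeq C) (s t : M -> M).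
Local Infix "\*" := ae_mul (at level 40, left associativity).

Variables (al : G -> M -> M) (rho : M -> M) (S : M) (T : G -> M) (y : ldata R G).
Hypothesis HM : hyperfinite_III1_factor M.
Hypothesis L : lift C al rho S T y.
Local Notation describes := (@describes R M C G al rho).

Let cal g : C (al g). Proof. exact: lf_Cal L g. Qed.
Let ea g : star_endo (al g). Proof. exact: lf_Ear L g. Qed.
Let er : star_endo rho. Proof. exact: lf_Er L. Qed.
Let crho : C rho. Proof. exact: lf_Crho L. Qed.
Let al0 : al 0 = idfun. Proof. exact: lf_0 L. Qed.
Let alD g h : al (g + h) = al g \o al h. Proof. exact: lf_D L g h. Qed.
Let alr g : al g \o rho = rho \o al (- g). Proof. exact: lf_rho L g. Qed.
Let cls : simple_classes C al rho. Proof. exact: lf_cls L. Qed.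

(** The composite frame of rho leads from F(K rho) through F(al_{p'} rho) to al_{theta(p')} al_p
    rho, whence the point p + theta(p'). *)
Lemma describes_mul F K c c' : describes F c -> describes K c' ->
  describes (F \* K) (gamma_mul c c').
Proof.
move=> [A [P [[hA w1 AA] sA hP [sP tP]]]] [B [Q [[hB v1 BB] sB hQ [sQ tQ]]]].
have tD := @g_autP _ _ c; have sD := autV tD.
have hAP := ften_ok (hA (g_aut c (g_pt c'))) hP.
have E1 g : fsrc (A g) = ftgt (B ((g_aut c)^-1%g g)) by rewrite (sA g).1 (sB _).2.
have E2 : fsrc (ften F (A (g_aut c (g_pt c'))) P) = ftgt Q.
  by rewrite /= (sA _).1 permK sP tQ.
exists (fun g => fcomp F K (A g) (B ((g_aut c)^-1%g g))).
exists (fcomp F K (ften F (A (g_aut c (g_pt c'))) P) Q); split.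
- split=> [g|g h|g h].
  + exact: fcomp_ok (hB _) (hA g) (E1 g).
  + by rewrite /= normrM w1 v1 mulr1.
  + rewrite fcomp_ten // AA BB -sD fcomp_scale //=.
- by move=> g; rewrite /= (sB _).1 (sA g).2 invgM permM.
- exact: fcomp_ok hQ hAP E2.
- split=> //=; rewrite (sA _).2 tP -[LHS]/(al _ \o al _ \o rho).
  by rewrite -alD addrC.
Qed.

Definition gamma_shift (p : G) : gamma_rep R G := GammaRep p (cocycle1 R G) (@autP1 G).

Lemma inner_pair_iso a b : inner_pair C a b -> exists q, iso (al q) a.
Proof.
move=> [ca cb eab eba].
have sa : simple a.
  move=> X hX; apply: (@obj_id_simple _ _ C) => z /=.
  by have := hX (b z); have := congr1 (@^~ z) eab; rewrite /= => ->.
have [_ sp _ _ _] := cls; have /(sp _ ca) := sa.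
case=> [[q hq]|[q hq]]; first by exists q.
case: (rho_not_invertible L ca cb hq); rewrite eab; exact: iso_refl.
Qed.

(** The invertible a is al_q up to Ad U, and al_q rho al_{-q} = al_{2q} rho: this is the origin of
    the quotient by 2G. The frames al_g(U) U^* undo the conjugation by U. *)
Lemma describes_conj a b (ab : inner_pair C a b) q : iso (al q) a ->
  describes (ae_conj ab) (gamma_shift (q *+ 2)).
Proof.
have [ca cb eab eba] := ab; have ea' := obj_endo ca.
move=> [U hU [U1 U2]].
have uu : unitary U by split.
have aE z : a z * U = U * al q z by rewrite hU.
have qb z : al q (b z) = st U * z * U.
  have := hU (b z); have := congr1 (@^~ z) eab; rewrite /= => -> e.
  by rewrite -mulrA -e mulrA U1 mul1r.
have aE' z : a z = U * al q z * st U by rewrite hU -mulrA U2 mulr1.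
exists (fun g => Frame (al g) (al g) (al g U * st U)).
exists (Frame rho (al (q *+ 2) \o rho) (al (q *+ 2) (rho U) * st U)).
have ef g : frame_ok (ae_conj ab) (Frame (al g) (al g) (al g U * st U)).
  split=> //=; last by apply: unitaryM (unitaryV uu); apply: unitary_endo.
  move=> z /=; rewrite aE' -[al q (al g (b z))]/((al q \o al g) (b z)) -alD addrC alD /= qb.
  rewrite -!mulrA (mulrA (st U)) U1 mul1r !mulrA -endoM // !mulrA U2 mul1r.
  by rewrite endoM.
split.
- split=> // [g h|g h]; first by rewrite normr1.
  rewrite fscale1 /ften /=; congr Frame; first by rewrite alD.
    by rewrite alD.
  have /= -> := ok_hom (ef g) (al h U * st U).
  by rewrite st1 mulr1 mulrA -endoM // -mulrA U1 mulr1 alD.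
- by move=> g; rewrite /= invg1 perm1.
- split=> //=; first by apply: endo_comp.
    move=> z /=; have e w : al q (rho w) = al (q *+ 2) (rho (al q w)).
      rewrite mulr2n alD /= -[al q (rho (al q w))]/((al q \o rho) (al q w)) alr /=.
      by rewrite (alNK L).
    rewrite aE' e qb -!mulrA (mulrA (st U)) U1 mul1r !mulrA -!endoM // !mulrA U2 mul1r.
    by rewrite !endoM.
  by apply: unitaryM (unitaryV uu); do 2 apply: unitary_endo => //.
- by [].
Qed.

Lemma describes_out F K c c' : out_eq F K -> describes F c -> describes K c' ->
  gamma_eq c c'.
Proof.
move=> [a [b [ab h]]] dF dK; have [q hq] := inner_pair_iso ab.
have dq := describes_conj ab hq.
apply: gamma_trans (describes_iso HM L h dF (describes_mul dq dK)) _.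
split=> /=.
- exists (fun=> 1); split=> *; first by rewrite normr1.
  by rewrite invg1 !perm1 !mul1r divr1 ?mulr1.
- by exists (- q); rewrite perm1 addrAC -mulrnDl subrr mul0rn add0r.
- by rewrite mulg1.
Qed.

Lemma describes_coh F c c' : describes F c -> cohomologous (g_coc c) (g_coc c') ->
  g_pt c = g_pt c' -> g_aut c = g_aut c' -> describes F c'.
Proof.
move=> [A [P [[hA w1 AA] sA hP [sP tP]]]] [la [la1 laE]] ep et.
exists (fun g => fscale (la g) (A g)), P; split; rewrite -?ep -?et //; split.
- by move=> g; apply: fscale_ok.
- by case: (g_cocP c').
- move=> g h; rewrite fscale_tenl fscale_tenr // AA !fscaleA laE.
  have n : la (g + h) != 0 by apply: unit_neq0.
  by congr fscale; field.
Qed.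

Lemma out_reduction :
  (forall F, describes F (gamma_one R G) -> out_eq F (ae_one C)) ->
  exists f : Out C -> Gamma R G,
    [/\ {morph f : u v / (u * v)%g >-> (u * v)%g}, injective f &
        forall ga, (exists u, f u = ga) <->
          exists F c, describes F c /\ pg_class (P := gamma_preGroup R G) c = ga].
Proof.
move=> ker; have [c cP] := choice (describes_exists L).
pose f (u : Out C) : Gamma R G := pg_class (P := gamma_preGroup R G) (c (pg_repr u)).
have cE F : gamma_eq (c (pg_repr (pg_class (P := out_preGroup C) F))) (c F).
  by apply: describes_out (cP _) (cP _); exact: (@pg_repr_class (out_preGroup C)).
have fM : {morph f : u v / (u * v)%g >-> (u * v)%g}.
  move=> u v; rewrite /f.
  have -> : (pg_class (P := gamma_preGroup R G) (c (pg_repr u)) *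
     pg_class (P := gamma_preGroup R G) (c (pg_repr v)))%g =
     pg_class (P := gamma_preGroup R G) (gamma_mul (c (pg_repr u)) (c (pg_repr v))).
    exact: pg_class_mul.
  apply/pg_classP; apply: gamma_trans (cE _) _.
  apply: describes_out (out_refl _) (cP _) (describes_mul (cP _) (cP _)).
have f1 : f 1%g = 1%g by apply: (mulgI (f 1%g)); rewrite -fM !mulg1.
have fker u : f u = 1%g -> u = 1%g.
  move=> /pg_classP; rewrite -[u]pg_reprK; move: (pg_repr u) => F.
  move=> /(gamma_trans (gamma_sym (cE F))) /= [e1 [q e2] e3].
  (* The class of F is trivial, but its point is only an element of 2G. Conjugation by al_q makes it
     0 on the nose, and [describes_coh] then makes the cocycle equal to 1. *)
  have ab : inner_pair C (al q) (al (- q)).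
    by split=> //; rewrite -alD ?subrr ?addNr.
  have dq := describes_conj ab (iso_refl _).
  have d1 := describes_mul dq (cP F).
  have d2 : describes (ae_conj ab \* F) (gamma_one R G).
    apply: describes_coh d1 _ _ _ => /=.
    - have [la [l1 l2]] := e1; exists la; split=> // g h.
      by rewrite invg1 !perm1 mul1r -l2.
    - by rewrite perm1 [RHS]e2 addrC.
    - by rewrite mulg1.
  apply/pg_classP; apply: out_trans (ker _ d2); apply: out_sym.
  by exists (al q), (al (- q)), ab; apply: mon_iso_refl.
exists f; split=> // [u v e|ga].
  have e1 : f (u * v^-1)%g = 1%g by rewrite fM e -fM mulgV f1.
  by apply: (mulIg v^-1%g); rewrite (fker _ e1) mulgV.
split=> [[u <-]|[F [d [dF <-]]]]; first by exists (pg_repr u), (c (pg_repr u)).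
exists (pg_class (P := out_preGroup C) F); apply/pg_classP.
exact: gamma_trans (cE F) (describes_out (out_refl _) (cP F) dF).
Qed.

End OutMap.

(** * Normalized cocycles *)

Section TwistedCharacters.
Variables (R : realType) (G : finZmodType).
Implicit Types (g h k : G) (s : G -> G -> R[i]).

Lemma stable_common_eigenvector (n : nat) (V : 'M[R[i]]_n) (As : seq 'M[R[i]]_n) :
  V != 0 -> {in As, forall A, stablemx V A} ->
  {in As &, forall A B, comm_mx A B} ->
  exists v : 'rV[R[i]]_n, [/\ v != 0, (v <= V)%MS & {in As, forall A, stablemx v A}].
Proof.
move=> V0 sV cA.
have [] := @common_eigenvector R[i] (\rank V) [seq restrictmx V B | B <- As].
- by rewrite lt0n mxrank_eq0.
- move=> _ _ /mapP [B Bin ->] /mapP [B' Bin' ->].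
  by rewrite /comm_mx -?conjmxM ?inE ?stablemx_row_base ?sV // cA.
move=> v v0 /allP vP; exists (v *m row_base V); split.
- by rewrite mulmx_free_eq0 ?row_base_free.
- by rewrite mulmx_sub // eq_row_base.
move=> A Ain; rewrite -stablemx_restrict ?sV ?vP //.
by apply/mapP; exists A.
Qed.

(** Writes a symmetric cocycle as a coboundary with prescribed values of La on a subgroup. The
    twisted translations X_g commute, and the eigenvalues of a joint eigenvector are a solution up
    to modulus; choosing the eigenvector in the range of P imposes the prescribed values. *)
Lemma twisted_character s (H : pred G) (L0 : G -> R[i]) :
  cocycle s -> (forall g h, s g h = s h g) ->
  H 0 -> (forall z z', H z -> H z' -> H (z + z')) -> (forall z, H z -> H (- z)) ->
  (forall z, H z -> `|L0 z| = 1) ->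
  (forall z z', H z -> H z' -> L0 z * L0 z' = s z z' * L0 (z + z')) ->
  exists La : G -> R[i], [/\ forall g, `|La g| = 1,
    forall g h, La g * La h = s g h * La (g + h) & forall z, H z -> La z = L0 z].
Proof.
move=> [s1 sC] sS H0 HD HN L1 LD.
pose n := #|G|; pose e (i : 'I_n) : G := enum_val i.
pose X g : 'M[R[i]]_n := \matrix_(i, j) (if e j == e i + g then s (e i) g else 0).
have eK g : e (enum_rank g) = g by rewrite /e enum_rankK.
have XX g h : X g *m X h = s g h *: X (g + h).
  apply/matrixP => i j; rewrite !mxE (bigD1 (enum_rank (e i + g))) //= big1 => [|l nl].
    rewrite !mxE eK eqxx addr0 addrA; case: eqP => _; last by rewrite !mulr0.
    by rewrite -sC.
  rewrite !mxE; case: eqP => [el|]; last by rewrite mul0r.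
  by move: nl; rewrite -el /e enum_valK eqxx.
have comm g h : comm_mx (X g) (X h) by rewrite /comm_mx !XX sS addrC.
(* A multiple of the projection onto the joint eigenspace where X_z acts by L0 z for every z in
   H. *)
pose P : 'M[R[i]]_n := \sum_(z | H z) (L0 z)^-1 *: X z.
have L0n z : H z -> L0 z != 0 by move=> /L1 h; rewrite -normr_eq0 h oner_eq0.
have PX z : H z -> P *m X z = L0 z *: P.
  move=> Hz; rewrite /P mulmx_suml scaler_sumr.
  rewrite [RHS](reindex_inj (addIr z)) /=.
  have e1 w : H (w + z) = H w.
    by apply/idP/idP => h; [rewrite -(addrK z w); apply: HD (HN _ Hz)|exact: HD].
  rewrite (eq_bigl _ _ e1); apply: eq_bigr => w Hw.
  rewrite -scalemxAl XX !scalerA; congr (_ *: _).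
  have := LD _ _ Hw Hz; have := L0n _ Hw; have := L0n _ (HD _ _ Hw Hz) => n1 n2 E.
  by apply: (mulIf n1); rewrite mulfVK // -mulrA -E mulrA mulVf // mul1r.
have P0 : P != 0.
  apply/eqP => /matrixP /(_ (enum_rank 0) (enum_rank 0)).
  rewrite summxE mxE (bigD1 0) //= big1 => [|z /andP [Hz nz]].
    rewrite !mxE eK !addr0 eqxx => /eqP; rewrite mulf_eq0 invr_eq0.
    by rewrite (negPf (L0n _ H0)) /= -normr_eq0 s1 oner_eq0.
  by rewrite !mxE eK add0r eq_sym (negPf nz) mulr0.
have [] := @stable_common_eigenvector n P [seq X g | g <- enum G] P0.
- move=> _ /mapP [g _ ->].
  have -> : P *m X g = X g *m P.
    rewrite /P mulmx_suml mulmx_sumr; apply: eq_bigr => z _.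
    by rewrite -scalemxAl -scalemxAr; congr (_ *: _); exact: comm z g.
  exact: submxMl.
- by move=> _ _ /mapP [g _ ->] /mapP [h _ ->].
move=> v [v0 vP vX].
have hla g : exists a, v *m X g = a *: v.
  have h : stablemx v (X g) by apply: vX; apply/mapP; exists g; rewrite // mem_enum.
  by have /sub_rVP [a ea] := h; exists a.
have [la laE] := choice hla.
have vinj a b : a *: v = b *: v -> a = b.
  move=> /eqP; rewrite -subr_eq0 -scalerBl scaler_eq0 (negPf v0) orbF subr_eq0.
  by move/eqP.
have laM g h : la g * la h = s g h * la (g + h).
  apply: vinj; transitivity (v *m X g *m X h); last by rewrite -mulmxA XX -scalemxAr laE scalerA.
  by rewrite laE -scalemxAl laE scalerA.
have laH z : H z -> la z = L0 z.
  move=> Hz; apply: vinj; rewrite -laE; have /submxP [u ->] := vP.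
  by rewrite -mulmxA PX // scalemxAr.
have lan g : la g != 0.
  apply/eqP => e0; have := laM g (- g); rewrite e0 mul0r subrr => /esym/eqP.
  by rewrite mulf_eq0 -normr_eq0 s1 oner_eq0 laH // (negPf (L0n _ H0)).
exists (fun g => la g / `|la g|); split=> [g|g h|z Hz].
- by rewrite normf_div normr_id divff // normr_eq0.
- have := congr1 Num.norm (laM g h); rewrite !normrM s1 mul1r => <-.
  by rewrite mulrACA laM -mulrA -invfM.
- by rewrite laH // L1 // divr1.
Qed.

End TwistedCharacters.

Section NormalizedCocycles.
Variables (R : realType) (G : finZmodType).
Implicit Types (g h k : G) (om : G -> G -> R[i]).

Lemma coboundary_cocycle om (la : G -> R[i]) : cocycle om -> (forall g, `|la g| = 1) ->
  cocycle (fun g h => om g h * (la g * la h / la (g + h))).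
Proof.
move=> [o1 oC] l1; have n g : la g != 0 by rewrite -normr_eq0 l1 oner_eq0.
split=> [g h|g h k]; first by rewrite !normrM normfV !l1 o1 invr1 !mulr1.
transitivity (om h k * om g (h + k) * (la g * la h * la k / la (g + (h + k)))).
  by field; rewrite !n.
by rewrite oC addrA; field; rewrite !n.
Qed.

Section Normalize.
Variable om : G -> G -> R[i].
Hypothesis oC : cocycle om.
Hypothesis o0 : om 0 0 = 1.

Let o1 g h : `|om g h| = 1. Proof. by case: oC. Qed.
Let on g h : om g h != 0. Proof. by rewrite -normr_eq0 o1 oner_eq0. Qed.
Let oA g h k : om h k * om g (h + k) = om g h * om (g + h) k. Proof. by case: oC. Qed.

Lemma coc0l g : om 0 g = 1.
Proof.
by have := oA 0 0 g; rewrite !add0r o0 mul1r => e; apply: (mulfI (on 0 g)); rewrite mulr1.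
Qed.

Lemma coc0r g : om g 0 = 1.
Proof.
by have := oA g 0 0; rewrite !addr0 o0 mul1r => e; apply: (mulfI (on g 0)); rewrite mulr1.
Qed.

Lemma cocN g : om g (- g) = om (- g) g.
Proof. by have := oA g (- g) g; rewrite addNr subrr coc0l coc0r !mulr1. Qed.

Lemma cocN_inv : (forall g, om g (- g) = 1) -> forall g h, om h g * om (- g) (- h) = 1.
Proof.
move=> oN g h; have := oA h g (- (h + g)).
have -> : g - (h + g) = - h by rewrite opprD addrCA subrr addr0.
rewrite !oN !mulr1 => <-; have := oA g (- g) (- h).
by rewrite subrr coc0l oN mulr1 -opprD addrC (addrC h) mulrC.
Qed.

(** This makes z to om(z,z) admissible as [L0] in [twisted_character], for the symmetric cocycle
    om(g,h) om(h,g) and the subgroup of 2-torsion. *)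
Lemma coc_sym_square z z' : z *+ 2 = 0 -> z' *+ 2 = 0 ->
  om z z * om z' z' = om z z' * om z' z * om (z + z') (z + z').
Proof.
rewrite !mulr2n => e e'; have := oA z z' (z + z').
have -> : z' + (z + z') = z by rewrite addrCA e' addr0.
have := oA z' z' z; rewrite e' coc0l mulr1 (addrC z' z) => E1 E2.
by rewrite -[RHS]mulrA mulrCA -E2 mulrA E1 mulrC.
Qed.

End Normalize.

(** The coboundary of la multiplies om(g,h) om(h,g) by that of la^2, so la must be a square root of
    1/La, with La trivializing the symmetric cocycle. Its values on the 2-torsion make om(z,z)
    trivial there; elsewhere the root is free at one of g and -g, and om(g,-g) = 1 fixes the
    other. *)
Lemma normalize0 om : cocycle om -> om 0 0 = 1 -> exists om', cohomologous om om' /\ normalized_cocycle om'.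
Proof.
move=> oC o0; have [o1 oA] := oC.
have on g h : om g h != 0 by rewrite -normr_eq0 o1 oner_eq0.
pose s g h := om g h * om h g.
have sC : cocycle s.
  split=> [g h|g h k]; first by rewrite normrM !o1 mulr1.
  rewrite /s mulrACA oA [RHS]mulrACA; congr (_ * _).
  by rewrite (addrC h k) -oA (addrC h g) mulrC.
have sS g h : s g h = s h g by rewrite /s mulrC.
pose H : pred G := fun z => z *+ 2 == 0.
have [|||||La [La1 LaM LaH]] := @twisted_character R G s H (fun z => om z z) sC sS.
- by rewrite /H mul0rn.
- by move=> z z' /eqP e /eqP e'; rewrite /H mulrnDl e e' addr0.
- by move=> z /eqP e; rewrite /H mulNrn e oppr0.
- by move=> z _; exact: o1.
- by move=> z z' /eqP e /eqP e'; exact: (coc_sym_square oC o0).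
have La0 : La 0 = 1 by rewrite LaH ?o0 // /H mul0rn.
have Lan g : La g != 0 by rewrite -normr_eq0 La1 oner_eq0.
have LaN g : La g * La (- g) = om g (- g) ^+ 2.
  by rewrite LaM subrr La0 mulr1 /s -(cocN oC o0).
pose r g := sqrtC (La g)^-1.
have r2 g : r g ^+ 2 = (La g)^-1 by rewrite /r sqrtCK.
(* The rank comparison selects one element of each pair g, -g. On the 2-torsion the second branch
   applies, which also yields la 0 = 1. *)
pose la g := if (enum_rank g < enum_rank (- g)%R)%N then r g
  else (r (- g) * om g (- g))^-1.
have la2 g : la g ^+ 2 = (La g)^-1.
  rewrite /la; case: ifP => _ //; rewrite exprVn exprMn r2 -LaN; congr (_^-1).
  by rewrite mulrCA mulVf ?mulr1.
have lan g : la g != 0.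
  apply/eqP => e; have := la2 g; rewrite e expr0n => /esym/eqP.
  by rewrite invr_eq0 (negPf (Lan g)).
have la1 g : `|la g| = 1.
  by apply/eqP; rewrite -(@pexpr_eq1 _ _ 2) // -normrX la2 normfV La1 invr1.
have la0 : la 0 = 1.
  by rewrite /la oppr0 ltnn /r La0 invr1 sqrtC1 o0 mulr1 invr1.
have laN g : la g * la (- g) * om g (- g) = 1.
  have [e|ne] := eqVneq g (- g).
    rewrite -e -expr2 la2 LaH ?mulVf //.
    by rewrite /H mulr2n {2}e subrr.
  have rn w : r w != 0 by rewrite /r sqrtC_eq0 invr_eq0.
  rewrite /la opprK; case: ltngtP => [_|_|e].
  - by rewrite -(cocN oC o0); field; rewrite rn on.
  - by field; rewrite rn on.
  - by case/eqP: ne; exact/enum_rank_inj/val_inj.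
exists (fun g h => om g h * (la g * la h / la (g + h))); split.
  by exists la.
have C' := coboundary_cocycle oC la1.
have N' g : om g (- g) * (la g * la (- g) / la (g - g)) = 1.
  by rewrite subrr la0 divr1 mulrC.
have S' g h : om g h * (la g * la h / la (g + h)) * (om h g * (la h * la g / la (h + g))) = 1.
  rewrite (addrC h g); have es : s g h = La g * La h / La (g + h) by rewrite LaM mulfK.
  transitivity (s g h * la g ^+ 2 * la h ^+ 2 / la (g + h) ^+ 2); first by rewrite /s; field.
  by rewrite es !la2; field; rewrite !Lan.
split=> //.
- by move=> g; rewrite (coc0l oC o0) (coc0r oC o0) add0r addr0 la0 mulr1 !mul1r divff.
- move=> g h; pose w a b := om a b * (la a * la b / la (a + b)).
  rewrite -[LHS]/(w g h * Num.conj (w (- g) (- h))).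
  have w0 : w 0 0 = 1 by rewrite /w o0 addr0 la0 divr1 !mulr1.
  have wN a : w a (- a) = 1 by exact: N'.
  (* Antisymmetry and om(g,-g) = 1 together imply invariance under negating both arguments. *)
  have E1 := cocN_inv C' w0 wN g h; have E2 : w g h * w h g = 1 := S' g h.
  have -> : w (- g) (- h) = w g h by rewrite -[LHS]mul1r -E2 -mulrA E1 mulr1.
  by have [w1 _] := C'; exact: unit_conj (w1 g h).
Qed.

Lemma normalized_exists om : cocycle om ->
  exists om', cohomologous om om' /\ normalized_cocycle om'.
Proof.
move=> oC; have [o1 _] := oC; pose c := (om 0 0)^-1.
have c1 : `|c| = 1 by rewrite normfV o1 invr1.
have cn : om 0 0 != 0 by rewrite -normr_eq0 o1 oner_eq0.
pose om1 g h := om g h * (c * c / c).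
have C1 : cocycle om1 by exact: coboundary_cocycle oC (fun=> c1).
have [|om' [h1 h2]] := normalize0 C1.
  by rewrite /om1 /c mulfK ?invr_eq0 // divff.
by exists om'; split=> //; apply: coh_trans h1; exists (fun=> c).
Qed.

End NormalizedCocycles.

(** * Stabilizers of gauge classes *)

Section Stabilizer.
Variables (R : realType) (G : finZmodType).
Implicit Types (g h k p : G) (x : numdata R G).

Lemma conj_unit (z : R[i]) : `|z| = 1 -> Num.conj z = z^-1.
Proof.
by move=> z1; apply: (mulfI (unit_neq0 z1)); rewrite unit_conj // divff // unit_neq0.
Qed.

Section Identities.
Variable om : G -> G -> R[i].
Hypothesis oN : normalized_cocycle om.

Let oC : cocycle om. Proof. by case: oN. Qed.
Let o1 g h : `|om g h| = 1. Proof. by case: oC. Qed.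
Let on g h : om g h != 0. Proof. exact: unit_neq0. Qed.
Let oA g h k : om h k * om g (h + k) = om g h * om (g + h) k. Proof. by case: oC. Qed.

Lemma nc_0r g : om g 0 = 1. Proof. by case: oN => _ /(_ g) []. Qed.
Lemma nc_0l g : om 0 g = 1. Proof. by case: oN => _ /(_ g) []. Qed.
Lemma nc_N g : om g (- g) = 1. Proof. by case: oN => _ /(_ g) []. Qed.
Lemma nc_opp g h : om h g = (om g h)^-1.
Proof. by case: oN => _ _ e _; apply: (mulfI (on g h)); rewrite e divff. Qed.
Lemma nc_NN g h : om (- g) (- h) = om g h.
Proof.
case: oN => _ _ _ e; have := e g h; rewrite conj_unit // => E.
by apply: (mulIf (invr_neq0 (on (- g) (- h)))); rewrite E divff.
Qed.

Lemma nc_addr h g p : om h (g + p) = om h g * om (h + g) p * om p g.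
Proof.
by have := oA h g p; rewrite (nc_opp p g) => <-; rewrite mulrAC mulVf // mul1r.
Qed.

Lemma nc_addl h g p : om (g + p) h = om g h * om (g + h) p * om p g * om p h ^+ 2.
Proof.
have e := oA g p h; rewrite (addrC p h) nc_addr in e.
have -> : om (g + p) h = om p h * (om g h * om (g + h) p * om p h) / om g p.
  by rewrite e mulrAC divff // mul1r.
by rewrite (nc_opp g p); field; exact: on.
Qed.

(** For an antisymmetric cocycle om(p,h)^2 is the quotient of om(p,h) by om(h,p), the alternating
    bicharacter of its class. This is why K is a character exactly when chi is. *)
Lemma nc_sqM p h k : om p (h + k) ^+ 2 = om p h ^+ 2 * om p k ^+ 2.
Proof.
have e : om p (h + k) = om p h ^+ 2 * om p k ^+ 2 / om p (h + k).
  rewrite {1}nc_addr (addrC p h) nc_addl (nc_opp p (h + k)) (nc_opp h k).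
  by field; rewrite !on.
rewrite expr2 {1}e mulfVK //.
Qed.

Lemma nc_sqN p h : om (- p) h ^+ 2 = (om p h ^+ 2)^-1.
Proof.
have e : om h (- p) ^+ 2 * om h p ^+ 2 = 1.
  by rewrite -nc_sqM addNr nc_0r expr1n.
rewrite (nc_opp h (- p)) (nc_opp h p) !exprVn invrK.
by apply: (mulfI (expf_neq0 2 (on h (- p)))); rewrite divff ?e // expf_neq0.
Qed.

Lemma nc_sand h a p : om h (a + p) * om (a + p + h) h =
  om p a * om (a + h *+ 2) p * om h a * om (a + h) h * om p h ^+ 2.
Proof.
rewrite nc_addr (addrAC a p h) (nc_addl h (a + h) p) -addrA -mulr2n.
by rewrite (addrC h a) (nc_opp (a + h) p); field; rewrite !on.
Qed.

Lemma nc_diag z : om z z * om z z = 1.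
Proof. by rewrite {1}nc_opp mulVf. Qed.

(** om(g,g) depends only on 2g, which makes a sign mu with mu(2g) = om(g,g) possible. *)
Lemma nc_diag_torsion g z : z *+ 2 = 0 -> om (g + z) (g + z) = om g g.
Proof.
move=> z2; have zN : z = - z by apply: (addrI z); rewrite subrr -mulr2n.
have ez : om z z = 1 by rewrite {2}zN nc_N.
rewrite nc_addr nc_addl addrAC -addrA -mulr2n.
have e1 := oA (g *+ 2) z z; rewrite ez -mulr2n z2 nc_0r mul1r in e1.
have e2 : om z g ^+ 2 * om z g ^+ 2 = 1.
  by rewrite (nc_opp g z) !exprVn -invfM -nc_sqM -mulr2n z2 nc_0r expr1n invr1.
rewrite addrA -mulr2n.
transitivity (om g g * (om (g *+ 2) z * om (g *+ 2 + z) z) *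
  (om z g ^+ 2 * om z g ^+ 2)); first by ring.
by rewrite -e1 e2 !mulr1.
Qed.

End Identities.

(* The relations defining the stabilizer with the choices mu, nu, chi and de merged:
   K h = chi h * om p h ^+ 2 and tau g = de (g + p) * mu (g + p) * nu g * om p g,
   where p is minus the point of the triple. *)
Definition system (om : G -> G -> R[i]) p (tau K : G -> R[i]) (x1 x : numdata R G) :=
  [/\ [/\ forall g, `|tau g| = 1, forall g, `|K g| = 1,
          forall g h, K (g + h) = K g * K h & forall g, tau g ^+ 2 = K g],
      forall h g, eps x1 h g = eps x h (g + p) * tau g * (tau (g + h *+ 2))^-1 *
        om h g * om (g + h) h * K h,
      forall g, eta x1 g = eta x (g + p) &
      forall g h k, amp x1 g h k = amp x (g + p) h k * tau g * (tau (g + h))^-1 *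
        (tau (g + h + k))^-1 * tau (g + k) * K h * om (g + k) h * om h g].

Lemma sign_inv (z : R[i]) : z = 1 \/ z = -1 -> z = z^-1.
Proof. by case=> ->; rewrite ?invrN invr1. Qed.

Lemma sign_unit (z : R[i]) : z = 1 \/ z = -1 -> `|z| = 1.
Proof. by case=> ->; rewrite ?normrN normr1. Qed.

Lemma system_of_stabilizes (c : gamma_rep R G) x : stabilizes c x ->
  exists om tau K, [/\ cohomologous (g_coc c) om, normalized_cocycle om &
    system om (- g_pt c) tau K (relabel_data (g_aut c) x) x].
Proof.
move=> [x1 [x2 [x3 [[a1 a2 a3] [chi [nu [[c1 cM cz] [nu2 nup] b1 b2 b3]]]
  [om [mu [[coh oN] [mu1 mu2] d1 d2 d3]]] [de [de1 e1 e2 e3]]]]]].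
set t := g_aut c in a1 a2 a3 *; set q := g_pt c in cz nup b1 b2 b3 *.
have [[o1 _] _ _ _] := oN; have on g h : om g h != 0 by exact: unit_neq0.
have nu1 g : `|nu g| = 1.
  by apply/eqP; rewrite -(@pexpr_eq1 _ _ 2) // -normrX nu2 c1.
have nun g : nu g != 0 by exact: unit_neq0.
have eqg g : q + (g - q) = g by rewrite addrC subrK.
have chin g : chi g != 0 by exact: unit_neq0.
have mun g : mu g != 0 by apply/unit_neq0/sign_unit.
have den g : de g != 0 by apply/unit_neq0/sign_unit.
have muV g := sign_inv (mu1 g); have deV g := sign_inv (de1 g).
have dd g : de g * de g = 1 by rewrite {2}deV divff.
have mm g : mu g * mu g = 1 by rewrite {2}muV divff.
have x1e h g : eps (relabel_data t x) h g = eps x1 h g by rewrite /= -a1 !permKV.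
have x1a g h k : amp (relabel_data t x) g h k = amp x1 g h k by rewrite /= -a3 !permKV.
exists om, (fun g => de (g - q) * mu (g - q) * nu g * om (- q) g),
  (fun h => chi h * om (- q) h ^+ 2); split=> //; split.
- split=> [g|g|g h|g].
  + by rewrite !normrM nu1 o1 (sign_unit (mu1 _)) (sign_unit (de1 _)) !mulr1.
  + by rewrite normrM normrX c1 o1 expr1n mulr1.
  + by rewrite cM (nc_sqM oN) mulrACA.
  + rewrite !exprMn nu2; congr (_ * _).
    by rewrite {1}expr2 {2}deV divff // {1}expr2 {2}muV divff // !mul1r.

- move=> h g; rewrite x1e e1 d1 b1.
  rewrite !eqg !rmorphM /= !conj_unit // (addrAC g _ (- q)).
  have X := nc_sand oN h g (- q); rewrite (nc_opp oN (- q) (g + _)) in X.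
  (* Squares of signs and the quotient of the two sides of [nc_sand], all equal to 1, are inserted
     so that the rest is an identity of fractions. The amplitudes are treated alike. *)
  transitivity (eps x1 h g * (de (g - q) * de (g - q)) * (mu (g - q) * mu (g - q)) *
    (om (- q) g / om (- q) (g + h *+ 2) * om h g * om (g + h) h * om (- q) h ^+ 2 /
     (om h (g - q) * om (g - q + h) h))).
    by rewrite dd mm -X divff ?mulf_neq0 // !mulr1.
  by field; rewrite !(den, mun, nun, on, chin).
- move=> g; rewrite e2 d2 b2 eqg /= -a2 permKV //.
- move=> g h k; rewrite x1a e3 d3 b3 !eqg !rmorphM /= !conj_unit //.
  rewrite !(addrAC _ _ (- q)).
  have X := nc_addr oN h g (- q).
  have Y := nc_addl oN h (g + k) (- q).
  rewrite (addrC h g) (nc_opp oN (- q) (g + h)) in X.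
  rewrite (addrAC g k h) (nc_opp oN (- q) (g + h + k)) (addrAC g k (- q)) in Y.
  transitivity (amp x1 g h k * (de (g - q) * de (g - q)) * (mu (g - q) * mu (g - q)) *
    (de (g - q + k) * de (g - q + k)) * (mu (g - q + k) * mu (g - q + k)) *
    (om h g / om (- q) (g + h) * om (- q) g / om h (g - q)) *
    (om (g + k) h / om (- q) (g + h + k) * om (- q) (g + k) * om (- q) h ^+ 2 / om (g - q + k) h)).
    by rewrite !dd !mm -X -Y !divff // !mulr1.
  by field; rewrite !(den, mun, nun, on, chin).
Qed.

Lemma half_sign om : normalized_cocycle om ->
  exists mu : G -> R[i], (forall g, mu g = 1 \/ mu g = -1) /\
    forall g, mu (g *+ 2) = om g g.
Proof.
move=> oN; exists (fun a => if [pick g | g *+ 2 == a] is Some g then om g g else 1).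
split=> g; case: pickP => [h /eqP hg|n].
- have /eqP := nc_diag oN h; rewrite -expr2 sqrf_eq1.
  by case/orP => /eqP; [left|right].
- by left.
- have z2 : (g - h) *+ 2 = 0 by rewrite mulrnBl hg subrr.
  by rewrite -(nc_diag_torsion oN h z2) addrC subrK.
- by have := n g; rewrite eqxx.
Qed.

(** The merged formulas are solved for chi and nu with trivial gauge; any half sign serves as mu. *)
Lemma stabilizes_of_system (c : gamma_rep R G) x om tau K :
  (forall h, eps x h 0 = 1) -> cohomologous (g_coc c) om -> normalized_cocycle om ->
  system om (- g_pt c) tau K (relabel_data (g_aut c) x) x -> stabilizes c x.
Proof.
move=> e0 coh oN [[t1 K1 KD tK] sE sEta sA].
set t := g_aut c in sE sEta sA *; set q := g_pt c in sE sEta sA *.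
set x1 := relabel_data t x in sE sEta sA.
have A1 : acts_aut t x x1 by split=> *; rewrite /= !permK.
clearbody x1.
have [mu [mu1 mu2]] := half_sign oN.
have [[o1 _] _ _ _] := oN; have on g h : om g h != 0 by exact: unit_neq0.
have taun g : tau g != 0 by exact: unit_neq0.
have Kn g : K g != 0 by exact: unit_neq0.
have mun g : mu g != 0 by apply/unit_neq0/sign_unit.
have mm g : mu g * mu g = 1 by rewrite {2}(sign_inv (mu1 g)) divff.
pose p := - q; pose chi h := K h / om p h ^+ 2.
pose nu g := tau g * om g p * mu (g + p).
have chi1 h : `|chi h| = 1 by rewrite /chi normf_div normrX K1 o1 expr1n divr1.
have nu1 g : `|nu g| = 1 by rewrite !normrM t1 o1 (sign_unit (mu1 _)) !mulr1.
have nuE g : nu g = tau g * om g p * mu (g + p) by [].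
have chiE h : chi h = K h / om p h ^+ 2 by [].
clearbody nu chi.
have K0 : K 0 = 1.
  by apply: (mulfI (Kn 0)); rewrite -KD addr0 mulr1.
pose x2 := NumData
  (fun h g => eps x1 h (q + g) * nu (q + g + h *+ 2) * Num.conj (nu (q + g) * chi h))
  (fun g => eta x1 (q + g))
  (fun g h k => amp x1 (q + g) h k * nu (q + g + h + k) * nu (q + g + h) *
    Num.conj (nu (q + g + k) * nu (q + g) * chi h)).
pose x3 := NumData
  (fun h g => eps x2 h g * mu g * mu (g + h *+ 2) * Num.conj (om h g * om (g + h) h))
  (eta x2)
  (fun g h k => amp x2 g h k * mu (g + k) * mu g * mu (g + h + k) * mu (g + h) *
    Num.conj (om (g + k) h * om h g)).
have eqg g : q + g + p = g by rewrite addrAC subrr add0r.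
have psq h : om p h ^+ 2 != 0 by rewrite expf_neq0.
exists x1, x2, x3; split.
- exact: A1.
- exists chi, nu; split=> //; split=> //.
  + by move=> g h; rewrite !chiE KD (nc_sqM oN); field; rewrite !on.
  + move=> z z2; rewrite sE /= subrr e0 mul1r z2 addr0 divff // mul1r chiE.
    have zN : - z = z by apply: (addrI z); rewrite subrr -mulr2n.
    have ez : om z z = 1 by rewrite -{2}zN (nc_N oN).
    rewrite (addrC q z) (nc_addl oN) ez -mulr2n z2 (nc_0l oN) (nc_sqN oN) (nc_opp oN q z).
    by field; rewrite on.
  + move=> g; rewrite nuE chiE !exprMn tK expr2 (nc_opp oN p g).
    by rewrite [mu _ ^+ 2]expr2 mm mulr1; field; rewrite on.
  (* By eps_h(0) = 1, the system at g = q expresses eps_h(q) of the relabelled data through tau, om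
     and K alone. The rest follows from tau^2 = K and the bicharacter om^2. *)
  + move=> h; rewrite sE /= subrr e0 mul1r !nuE.
    have mu0 : mu 0 = 1 by have := mu2 0; rewrite mul0rn (nc_0r oN).
    have b1 : q + h *+ 2 + p = h *+ 2 by rewrite addrAC subrr add0r.
    have oqp : om q p = 1 by exact: nc_N.
    rewrite b1 subrr mu0 mu2 oqp !mulr1; set b := q + h *+ 2.
    have e1 : om b p = (om (h *+ 2) q)^-1.
      have [[_ oA] _ _ _] := oN; have := oA (h *+ 2) q p.
      rewrite oqp subrr (nc_0r oN) mulr1 => e; rewrite /b addrC.
      by apply: (mulfI (on (h *+ 2) q)); rewrite -e divff.
    have e4 : om q h ^+ 2 = (om p h ^+ 2)^-1 by rewrite (nc_sqN oN) invrK.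
    have e2 : om (h *+ 2) q ^+ 2 = (om p h ^+ 2) ^+ 2.
      rewrite (nc_opp oN q) exprVn mulr2n (nc_sqM oN) e4 -expr2 exprVn invrK //.
    have e3 : om (q + h) h = om h h * om (h *+ 2) q * om q h ^+ 3.
      by rewrite addrC (nc_addl oN) -mulr2n; ring.
    have e5 : tau b ^+ 2 = tau q ^+ 2 * K h ^+ 2 by rewrite !tK KD mulr2n KD.
    have e6 : (om (h *+ 2) q)^-1 = om (h *+ 2) q / (om p h ^+ 2) ^+ 2.
      by rewrite -e2; field; rewrite on.
    rewrite e1 e6 e3 (nc_opp oN q h) chiE.
    transitivity (tau q ^+ 2 * K h ^+ 2 / tau b * om h h * om (h *+ 2) q * om q h ^+ 2 / om p h ^+ 2).
      by rewrite -e5 e4; field; rewrite !(on, taun).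
    by field; rewrite !(on, taun).
- exists om, mu; split=> //.
- exists (fun=> 1); split=> [g|h g|g|g h k].
  + by left.
  + rewrite !mul1r /x3 /x2 /= !rmorphM /= !conj_unit // sE -/p eqg.
    have X := nc_sand oN h (q + g) p; rewrite eqg (nc_opp oN (q + g) p) in X.
    rewrite !nuE !chiE (addrAC (q + g) _ p) eqg.
    transitivity (eps x h g * (mu (g + h *+ 2) * mu (g + h *+ 2)) *
      ((om (q + g) p)^-1 * om (q + g + h *+ 2) p * om h (q + g) * om (q + g + h) h *
        om p h ^+ 2 / (om h g * om (g + h) h))).
      by rewrite mm -X divff ?mulf_neq0 // !mulr1.
    by field; rewrite !(mun, on, taun, Kn).
  + by rewrite /x3 /x2 /= sEta -/p eqg.
  + rewrite !mul1r /x3 /x2 /= !rmorphM /= !conj_unit // sA -/p eqg.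
    have X := nc_addr oN h (q + g) p; rewrite eqg (nc_opp oN (q + g) p) in X.
    have Y := nc_addl oN h (q + g + k) p.
    rewrite (addrAC _ k p) eqg (nc_opp oN (q + g + k) p) (addrC h) (addrAC _ k h) in X Y.
    have Z j : q + g + j + p = g + j by rewrite addrAC eqg.
    have Z2 : q + g + h + k + p = g + h + k by rewrite addrAC Z.
    rewrite !nuE !chiE !Z Z2 eqg.
    transitivity (amp x g h k * (mu (g + h + k) * mu (g + h + k)) * (mu (g + h) * mu (g + h)) *
      (om h (q + g) * om (q + g + h) p / om (q + g) p / om h g) *
      (om (q + g + k) h * om (q + g + h + k) p / om (q + g + k) p * om p h ^+ 2 / om (g + k) h)).
      by rewrite !mm -X -Y !divff // !mulr1.
    by field; rewrite !(mun, on, taun, Kn).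
Qed.

End Stabilizer.

(** * From the frames of an autoequivalence to the system of phases *)

Section SystemOfFrames.
Variables (R : realType) (M : starAlg R) (C : fusionCat M) (G : finZmodType).
Local Notation st := (@star R M).
Implicit Types (g h k : G) (F K : autoeq C) (s t : M -> M).

Lemma nc_back om g h : @normalized_cocycle R G om -> om (g + h) (- h) = (om g h)^-1.
Proof.
move=> oN; have [[o1 oA] _ _ _] := oN; have := oA g h (- h).
rewrite (nc_N oN) subrr (nc_0r oN) mulr1 => e.
by apply: (mulfI (unit_neq0 (o1 g h))); rewrite -e divff // unit_neq0.
Qed.

Variables (al : G -> M -> M) (rho : M -> M) (S : M) (T : G -> M).
Hypothesis HM : hyperfinite_III1_factor M.

Section HomSpaces.
Variable y : ldata R G.
Hypothesis L : lift C al rho S T y.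

Let ea g : star_endo (al g). Proof. exact: lf_Ear L g. Qed.
Let er : star_endo rho. Proof. exact: lf_Er L. Qed.
Let err : star_endo (rho \o rho). Proof. exact: endo_comp. Qed.
Let cls : simple_classes C al rho. Proof. exact: lf_cls L. Qed.

Lemma lf_expand (x : M) : x = S * (st S * x) + \sum_g T g * (st (T g) * x).
Proof.
rewrite -{1}[x]mul1r -(lf_full L) mulrDl mulr_suml mulrA; congr (_ + _).
by apply: eq_bigr => g _; rewrite mulrA.
Qed.

Lemma lf_S_unique X : hom idfun (rho \o rho) X -> isometry X ->
  exists2 c : R[i], `|c| = 1 & X = c *: S.
Proof.
move=> hX iX; have [c hc] := @obj_id_simple _ _ C _ (homM hX (homV (@endo_id _ _) err (lf_S L))).
have e : X = c *: S.
  rewrite {1}(lf_expand X) hc big1 ?addr0 -?scalerAr ?mulr1 // => g _.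
  rewrite (@cls_hom_mix _ _ _ _ HM _ _ cls 0 g (st (T g) * X)) ?mulr0 //.
  rewrite (lf_0 L); apply: homM hX _; apply: homV => //; last exact: lf_T L g.
  exact: endo_comp.
exists c => //; move: iX; rewrite /isometry e starZ -scalerAl -scalerAr (lf_SS L) scalerA.
move=> h; have {}h : Num.conj c * c = 1.
  by apply: (@alg_inj _ M); rewrite h scale1r.
by apply/eqP; rewrite -(@pexpr_eq1 _ _ 2) // normCK mulrC h.
Qed.

Lemma lf_T_unique g X : hom (al g \o rho) (rho \o rho) X -> isometry X ->
  exists2 c : R[i], `|c| = 1 & X = c *: T g.
Proof.
move=> hX iX.
have hTX h := homM hX (homV (endo_comp (ea h) er) err (lf_T L h)).
have [c hc] := cls_alr cls g (hTX g).
have e : X = c *: T g.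
  have hSX : st S * X = 0.
    apply: (@cls_hom_mix' _ _ _ _ HM _ _ cls 0 g); rewrite (lf_0 L).
    by apply: homM hX _; apply: homV (lf_S L).
  rewrite {1}(lf_expand X) hSX mulr0 add0r (bigD1 g) //= big1 => [|h nh].
    by rewrite addr0 hc -scalerAr mulr1.
  rewrite (cls_hom_alr HM cls _ (hTX h)) ?mulr0 //.
  by move/eqP: nh => nh e; apply: nh.
exists c => //; move: iX; rewrite /isometry e starZ -scalerAl -scalerAr (lf_TT L) eqxx scalerA.
move=> h; have {}h : Num.conj c * c = 1.
  by apply: (@alg_inj _ M); rewrite h scale1r.
by apply/eqP; rewrite -(@pexpr_eq1 _ _ 2) // normCK mulrC h.
Qed.

End HomSpaces.

Variables (x : numdata R G) (c : R[i]).
Hypothesis Hx : polynomial_equations x.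
Hypothesis L : lift C al rho S T (std_ldata x c).
Local Notation describes := (@describes R M C G al rho).

Let al0 : al 0 = idfun. Proof. exact: lf_0 L. Qed.
Let alD g h : al (g + h) = al g \o al h. Proof. exact: lf_D L g h. Qed.
Let alr g : al g \o rho = rho \o al (- g). Proof. exact: lf_rho L g. Qed.
Let cls : simple_classes C al rho. Proof. exact: lf_cls L. Qed.

Section Normalized.
Variables (F : autoeq C) (ga : gamma_rep R G).
Variables (A : G -> frame M) (P : frame M).
Let t := g_aut ga.
Let om := g_coc ga.
Let p := g_pt ga.
Hypothesis oN : normalized_cocycle om.
Hypothesis gA : graded_frames F A om.
Hypothesis sA : forall g, fsrc (A g) = al ((t^-1)%g g) /\ ftgt (A g) = al g.
Hypothesis hP : frame_ok F P.
Hypothesis sP : fsrc P = rho /\ ftgt P = al p \o rho.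

Let hA g : frame_ok F (A g). Proof. by case: gA. Qed.
Let AA g h : ften F (A g) (A h) = fscale (om g h) (A (g + h)). Proof. by case: gA. Qed.
Let tD : {morph t : g h / g + h}. Proof. exact: g_autP. Qed.
Let sD : {morph (t^-1)%g : g h / g + h}. Proof. exact: autV tD. Qed.

(** A_0 is a phase times the unit frame, and om(0,0) = 1 makes it idempotent, so the phase is 1. *)
Lemma frame_zero : A 0 = fone F.
Proof.
have sid : simple (@idfun M) by exact: (@obj_id_simple _ _ C).
have [||a a1 ea] := frame_scalar (hA 0) (fone_ok F) _ _ sid.
- by rewrite (sA 0).1 (aut0 sD) al0.
- by rewrite (sA 0).2 al0.
have := AA 0 0; rewrite (nc_0r oN) addr0 fscale1 ea fscale_tenl.
rewrite fscale_tenr; last exact: fone_ok.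
rewrite ften1l; last exact: fone_ok.
rewrite fscaleA => /(fscale_inj (fone_ok F)) e.
have -> : a = 1 by apply: (mulfI (unit_neq0 a1)); rewrite e mulr1.
exact: fscale1.
Qed.

Lemma exchange_scalars : exists k : G -> R[i], (forall h, `|k h| = 1) /\
  forall h, ften F P (A h) = fscale (k h) (ften F (A (- h)) P).
Proof.
have H h : exists k : R[i], `|k| = 1 /\ ften F P (A h) = fscale k (ften F (A (- h)) P).
  have [|||k k1 ek] := frame_scalar (ften_ok hP (hA h)) (ften_ok (hA (- h)) hP); last by exists k.
  - rewrite /= sP.1 !(sA _).1 alr; congr (rho \o al _).
    by rewrite (autN sD) opprK.
  - rewrite /= sP.2 !(sA _).2 -[LHS]/(al p \o (rho \o al h)) -[X in rho \o al X]opprK -alr.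
    by rewrite -[LHS]/(al p \o al (- h) \o rho) -alD addrC alD.
  - rewrite /= sP.2 (sA _).2 -[_ \o _]/(al (- h) \o al p \o rho) -alD; exact: cls_alr cls _.
by have [k kP] := choice H; exists k; split=> h; have [] := kP h.
Qed.

Let rr : (al p \o rho) \o (al p \o rho) = rho \o rho.
Proof.
rewrite -[LHS]/(al p \o ((rho \o al p) \o rho)) -[X in rho \o al X]opprK -alr.
by rewrite -[LHS]/(al p \o al (- p) \o (rho \o rho)) -alD subrr al0.
Qed.

(** Transport multiplies S by a phase a, and scaling P by b multiplies the result by b^2; so b is a
    square root of the conjugate of a. *)
Lemma normalized_rho_frame : exists P', [/\ frame_ok F P', fsrc P' = rho, ftgt P' = al p \o rho &
  fmor F (fone F) (ften F P' P') S = S].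
Proof.
have h1 := fone_ok F; have hPP := ften_ok hP hP.
have hS : hom (fsrc (fone F)) (fsrc (ften F P P)) S by rewrite /= sP.1; exact: lf_S L.
have hS' := fmor_hom h1 hPP hS.
have [||a a1 ea] := lf_S_unique L (X := fmor F (fone F) (ften F P P) S).
- by move: hS'; rewrite /= sP.2 rr.
- by rewrite /isometry -fmor_star // -fmor_comp // ?(lf_SS L) ?fmor1 //; apply: homV hS => //;
     exact: obj_endo (ok_src hPP).
pose b := sqrtC (Num.conj a).
have b2 : b ^+ 2 = Num.conj a by exact: sqrtCK.
have b1 : `|b| = 1.
  by apply/eqP; rewrite -(@pexpr_eq1 _ _ 2) // -normrX b2 norm_conjC a1.
exists (fscale b P); split=> //=; try by case: sP.
  exact: fscale_ok.
rewrite fscale_tenl fscale_tenr // fscaleA fmor_scaler ea scalerA -expr2 b2.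
by rewrite unit_conjl // scale1r.
Qed.

Hypothesis fS : fmor F (fone F) (ften F P P) S = S.

Lemma frame_T_scalar g : exists2 a : R[i], `|a| = 1 &
  fmor F (ften F (A g) P) (ften F P P) (T ((t^-1)%g g)) = a *: T (g + p).
Proof.
have hAP := ften_ok (hA g) hP; have hPP := ften_ok hP hP.
have hT : hom (fsrc (ften F (A g) P)) (fsrc (ften F P P)) (T ((t^-1)%g g)).
  by rewrite /= sP.1 (sA g).1; exact: lf_T L _.
apply: (lf_T_unique L).
- by have := fmor_hom hAP hPP hT; rewrite /= sP.2 (sA g).2 rr alD.
- rewrite /isometry -fmor_star // -fmor_comp // ?(lf_TT L) ?eqxx ?fmor1 //.
  by apply: homV hT; [exact: obj_endo (ok_src hAP)|exact: obj_endo (ok_src hPP)].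
Qed.

(** The transported intertwiners form one lifting with two descriptions: the twist of the relabelled
    data and, since they are tau(g) T_{g+p}, the rescaled shift of the original data. [lift_uniq]
    compares them. *)
Lemma system_of_frames : exists tau kap, system om p tau kap (relabel_data t x) x /\
  (forall g, fmor F (ften F (A g) P) (ften F P P) (T ((t^-1)%g g)) = tau g *: T (g + p)) /\
  forall h, ften F P (A h) = fscale (kap h)^-1 (ften F (A (- h)) P).
Proof.
have [k [k1 PA]] := exchange_scalars.
have H g : exists a : R[i], `|a| = 1 /\
    fmor F (ften F (A g) P) (ften F P P) (T ((t^-1)%g g)) = a *: T (g + p).
  by have [a a1 e] := frame_T_scalar g; exists a.
have [tau tauP] := choice H.
have tau1 g : `|tau g| = 1 by case: (tauP g).
have tauE g := (tauP g).2.
have [[o1 oA] _ _ _] := oN.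
have L1 : lift C (fun g => fsrc (A g)) (fsrc P) S (fun g => T ((t^-1)%g g))
    (std_ldata (relabel_data t x) c).
  have -> : (fun g => fsrc (A g)) = (fun g => al ((t^-1)%g g)).
    by apply/funext => g; rewrite (sA g).1.
  rewrite sP.1; exact: relabel_lift.
have eA : (fun g => ftgt (A g)) = al by apply/funext => g; rewrite (sA g).2.
have cls' : simple_classes C (fun g => ftgt (A g)) (ftgt P).
  by rewrite eA sP.2; apply: shift_cls.
have L2 := twist_lift gA frame_zero hP k1 PA L1 cls'.
rewrite eA sP.2 in L2.
have L3 := rescale_lift tau1 (shift_lift p (pe_eps Hx) L).
have eT : tw_T F A P (fun g => T ((t^-1)%g g)) = (fun g => tau g *: T (g + p)).
  by apply/funext => g; exact: tauE.
have eS : tw_S F P S = S := fS.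
rewrite eS eT in L2.
have [ueps ub ueta ueta2 uamp] := lift_uniq L2 L3.
(* The coefficients of T_g T_g in rho(S) start as the inverse of [sd] in both descriptions, so k =
   tau^-2. Thus K is tau^2, as the system demands. *)
have kE g : k g = (tau g ^+ 2)^-1.
  have := ub g; rewrite /= /tw_c (nc_N oN) mulr1 conj_unit // => /mulfI ->.
    by rewrite exprVn.
  by rewrite invr_eq0 sd_neq0.
have on g h : om g h != 0 by exact: unit_neq0.
have taun g : tau g != 0 by exact: unit_neq0.
exists tau, (fun h => tau h ^+ 2); split; last by split=> // h; rewrite PA kE.
split=> //.
- split=> // [g|g h]; first by rewrite normrX tau1 expr1n.
  have := twist_k gA hP PA g h; rewrite (nc_NN oN) !kE mulrC => /(mulIf (on _ _)) e.
  by apply: invr_inj; rewrite [RHS]invfM.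
- move=> h g; have := ueps h g; rewrite /= !conj_unit // kE.
  have -> : om (g + h *+ 2) (- h) = (om (g + h) h)^-1.
    by rewrite mulr2n addrA (nc_back _ _ oN).
  move=> <-; by field; rewrite !(on, taun).
- move=> g h j; have := uamp g h j; rewrite /= (nc_N oN) rmorph1 !conj_unit // kE mulr1.
  rewrite (addrAC g h j) (nc_back (g + j) h oN) (addrAC g j h).
  have -> : om (g + h) (- g) = (om h g)^-1 by rewrite addrC (nc_back _ _ oN).
  rewrite /= => <-; by field; rewrite !(on, taun).
Qed.

End Normalized.

Lemma stabilizes_of_describes F ga : describes F ga ->
  exists ga', stabilizes ga' x /\ gamma_eq ga' ga.
Proof.
move=> dF; have [om [coh oN]] := normalized_exists (g_cocP ga).
have oC : cocycle om by case: oN.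
pose ga1 := GammaRep (g_pt ga) oC (@g_autP _ _ ga).
have [A [P [gA sA hP sP]]] : describes F ga1 by exact: describes_coh dF _ _ _.
have [P' [hP' sP1 sP2 fS]] := normalized_rho_frame hP sP.
have [tau [kap [sys _]]] := system_of_frames (ga := ga1) oN gA sA hP' (conj sP1 sP2) fS.
(* A system at p belongs to the stabilizing point -p, and p = -p + 2p. *)
exists (GammaRep (- g_pt ga) oC (@g_autP _ _ ga)); split.
  apply: (stabilizes_of_system (om := om) (tau := tau) (K := kap)) => //=.
  - by case: (pe1 Hx).
  - exact: coh_refl.
  - by rewrite opprK.
split=> //=; first exact: coh_sym.
by exists (g_pt ga); rewrite mulr2n addKr.
Qed.

End SystemOfFrames.

(** * Morphisms generated by a lifting *)

Section Words.
Variables (R : realType) (M : starAlg R) (C : fusionCat M) (G : finZmodType).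
Local Notation st := (@star R M).
Implicit Types (g h k : G) (s t : M -> M).

(* The word (g, m) stands for al g \o rho^m. *)
Definition word : Type := (G * nat)%type.
Implicit Types w v u : word.

(** The sign acquired by h when al_h moves past m copies of [rho]. *)
Definition wsgn (m : nat) h : G := if odd m then - h else h.
Definition wmul w v : word := (w.1 + wsgn w.2 v.1, (w.2 + v.2)%N).

Lemma wsgnS m h : wsgn m.+1 h = wsgn m (- h).
Proof. by rewrite /wsgn /=; case: odd; rewrite //= opprK. Qed.

Definition wd (al : G -> M -> M) (rho : M -> M) w : M -> M :=
  al w.1 \o iter w.2 rho.

Section Lifted.
Variables (al : G -> M -> M) (rho : M -> M) (S : M) (T : G -> M) (y : ldata R G).
Hypothesis L : lift C al rho S T y.
Hypothesis HM : hyperfinite_III1_factor M.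
Local Notation wd := (wd al rho).

Let cal g : C (al g). Proof. exact: lf_Cal L g. Qed.
Let crho : C rho. Proof. exact: lf_Crho L. Qed.
Let alD g h : al (g + h) = al g \o al h. Proof. exact: lf_D L g h. Qed.
Let alr g : al g \o rho = rho \o al (- g). Proof. exact: lf_rho L g. Qed.
Let cls : simple_classes C al rho. Proof. exact: lf_cls L. Qed.

Lemma wd_obj w : C (wd w).
Proof.
apply: obj_comp => //; elim: w.2 => [|m IH]; first exact: obj_id.
exact: (obj_comp crho IH).
Qed.

Lemma wd_endo w : star_endo (wd w). Proof. exact: obj_endo (wd_obj w). Qed.

Lemma iter_al m h : iter m rho \o al h = al (wsgn m h) \o iter m rho.
Proof.
elim: m h => [|m IH] h //.
rewrite -[LHS]/(rho \o (iter m rho \o al h)) IH.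
rewrite -[LHS]/((rho \o al (wsgn m h)) \o iter m rho).
have -> : wsgn m h = - wsgn m.+1 h by rewrite wsgnS /wsgn; case: odd; rewrite ?opprK.
by rewrite -alr.
Qed.

Lemma wd_mul w v : wd w \o wd v = wd (wmul w v).
Proof.
case: w v => [g m] [h k]; rewrite /wd /wmul /= alD.
rewrite -[LHS]/(al g \o (iter m rho \o al h) \o iter k rho) iter_al.
by apply/funext => z /=; rewrite iterD.
Qed.

Lemma wd_S g m : hom (wd (g, m)) (wd (g, m.+2)) (wd (g, m) S).
Proof.
have -> : wd (g, m.+2) = wd (g, m) \o (rho \o rho).
  by apply/funext => z; rewrite /wd /= -!iterSr.
exact: (homI (wd_endo _) (lf_S L)).
Qed.

Lemma wd_T g m h : hom (wd (g + wsgn m h, m.+1)) (wd (g, m.+2)) (wd (g, m) (T h)).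
Proof.
have -> : wd (g, m.+2) = wd (g, m) \o (rho \o rho).
  by apply/funext => z; rewrite /wd /= -!iterSr.
have -> : wd (g + wsgn m h, m.+1) = wd (g, m) \o (al h \o rho).
  rewrite -[al h \o rho]/(wd (h, 1%N)) wd_mul /wmul /= addn1 //.
exact: (homI (wd_endo _) (lf_T L h)).
Qed.

Lemma wd_simple_hom w v X : (w.2 <= 1)%N -> (v.2 <= 1)%N -> hom (wd w) (wd v) X ->
  exists c : R[i], X = c *: (if w == v then 1 else 0).
Proof.
have e0 g : wd (g, 0%N) = al g by [].
have e1 g : wd (g, 1%N) = al g \o rho by [].
case: w v => [g [|[|m]]] [h [|[|k]]] //= _ _; rewrite ?e0 ?e1 => hX.
- case: eqP => [[e]|ne].
    by move: hX; rewrite e => /(cls_al cls) [c ->]; exists c.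
  exists 0; rewrite scale0r; apply: (cls_hom_al HM cls) hX => e; apply: ne.
  by rewrite e.
- by exists 0; rewrite scale0r; exact: (cls_hom_mix HM cls) hX.
- by exists 0; rewrite scale0r; exact: (cls_hom_mix' HM cls) hX.
- case: eqP => [[e]|ne].
    by move: hX; rewrite e => /(cls_alr cls) [c ->]; exists c.
  exists 0; rewrite scale0r; apply: (cls_hom_alr HM cls) hX => e; apply: ne.
  by rewrite e.
Qed.

(* S and the T g resolve rho \o rho, so a morphism from a word to a simple word
   factors through shorter words. *)
Lemma word_hom_ind (Q : word -> word -> M -> Prop) :
  (forall w, Q w w 1) ->
  (forall w v c X Y, Q w v X -> Q w v Y -> Q w v (c *: X + Y)) ->
  (forall w v u X Y, Q w v X -> Q v u Y -> Q w u (Y * X)) ->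
  (forall w v, Q w v 0) ->
  (forall w v X, hom (wd w) (wd v) X -> Q w v X -> Q v w (st X)) ->
  (forall g m, Q (g, m) (g, m.+2) (wd (g, m) S)) ->
  (forall g m h, Q (g + wsgn m h, m.+1) (g, m.+2) (wd (g, m) (T h))) ->
  forall w v X, (v.2 <= 1)%N -> hom (wd w) (wd v) X -> Q w v X.
Proof.
move=> q1 qL qM q0 qV qS qT w v X hv; move: w X.
have qZ w u c Y : Q w u Y -> Q w u (c *: Y).
  by move=> h; rewrite -[c *: Y]addr0; apply: qL.
have qD w u Y Z : Q w u Y -> Q w u Z -> Q w u (Y + Z).
  by move=> h h'; rewrite -[Y]scale1r; apply: qL.
have base w X : (w.2 <= 1)%N -> hom (wd w) (wd v) X -> Q w v X.
  move=> hw /(wd_simple_hom hw hv) [c ->]; apply: qZ.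
  by case: eqP => [->|_].
have IH m g X : (forall g' X', hom (wd (g', m)) (wd v) X' -> Q (g', m) v X') ->
    (forall g' X', hom (wd (g', m.+1)) (wd v) X' -> Q (g', m.+1) v X') ->
    hom (wd (g, m.+2)) (wd v) X -> Q (g, m.+2) v X.
  move=> H0 H1 hX; have e := wd_endo (g, m).
  have -> : X = X * wd (g, m) S * st (wd (g, m) S) +
      \sum_h X * wd (g, m) (T h) * st (wd (g, m) (T h)).
    rewrite -[LHS]mulr1 -(endo1 e) -(lf_full L) endoD // endoM // endoS // endo_sum //.
    rewrite mulrDr mulrA mulr_sumr; congr (_ + _); apply: eq_bigr => h _.
    by rewrite endoM // endoS // mulrA.
  apply: (qD).
    apply: (qM _ (g, m)); first by apply: qV (qS g m); exact: wd_S.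
    by apply: H0; apply: homM (wd_S g m) hX.
  apply: (big_ind (Q (g, m.+2) v)); [exact: q0|exact: qD|move=> h _].
  apply: (qM _ (g + wsgn m h, m.+1)); first by apply: qV (qT g m h); exact: wd_T.
  by apply: H1; apply: homM (wd_T g m h) hX.
have main m : (forall g X, hom (wd (g, m)) (wd v) X -> Q (g, m) v X) /\
    (forall g X, hom (wd (g, m.+1)) (wd v) X -> Q (g, m.+1) v X).
  elim: m => [|m [h0 h1]]; first by split=> g X; apply: base.
  by split=> // g X; apply: IH.
by move=> [g m] X; apply: (main m).1.
Qed.

(** Words with at most one [rho] represent the simple objects, so this is a decomposition into
    simples with representatives taken from the lifting. *)
Definition resolution (s : M -> M) (n : nat) (W : 'I_n -> word) (V : 'I_n -> M) :=
  [/\ forall i, ((W i).2 <= 1)%N, forall i, hom (wd (W i)) s (V i),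
      forall i j, st (V i) * V j = if i == j then 1 else 0 &
      \sum_i V i * st (V i) = 1].

Lemma resolution_exists s : C s -> exists n W V, @resolution s n W V.
Proof.
move=> cs; have [n [t [tP [V [V1 V2 V3]]]]] := obj_semisimple cs.
have [_ sp _ _ _] := cls.
have H i : exists wu : word * M, [/\ (wu.1.2 <= 1)%N, hom (wd wu.1) (t i) wu.2 & unitary wu.2].
  have [ct st_] := tP i; have /(sp _ ct) := st_.
  case=> [[g [u hu uu]]|[g [u hu uu]]]; first by exists ((g, 0%N), u).
  by exists ((g, 1%N), u).
have [wu wuP] := choice H.
exists n, (fun i => (wu i).1), (fun i => V i * (wu i).2); split.
- by move=> i; case: (wuP i).
- by move=> i; have [_ hu _] := wuP i; apply: homM hu _.
- move=> i j; rewrite starM -mulrA (mulrA (st (V i))) V2.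
  have [_ _ [u1 _]] := wuP i.
  by case: eqP => [<-|_]; rewrite ?mul1r ?mul0r ?mulr0.
- rewrite -V3; apply: eq_bigr => i _; have [_ _ [_ u2]] := wuP i.
  by rewrite starM -mulrA (mulrA (wu i).2) u2 mul1r.
Qed.

End Lifted.
End Words.

(** * Autoequivalences that fix the generating intertwiners are trivial *)

Section Rigidity.
Variables (R : realType) (M : starAlg R) (C : fusionCat M) (G : finZmodType).
Local Notation st := (@star R M).
Implicit Types (g h k : G) (s t : M -> M) (w v : word G).

Lemma complete_ext (I : finType) (U : I -> M) (X Y : M) :
  \sum_i U i * st (U i) = 1 -> (forall i, X * U i = Y * U i) -> X = Y.
Proof.
move=> e h; rewrite -[X]mulr1 -[Y]mulr1 -e !mulr_sumr.
by apply: eq_bigr => i _; rewrite !mulrA h.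
Qed.

Lemma complete_extl (I : finType) (U : I -> M) (X Y : M) :
  \sum_i U i * st (U i) = 1 -> (forall i, st (U i) * X = st (U i) * Y) -> X = Y.
Proof.
move=> e h; rewrite -[X]mul1r -[Y]mul1r -e !mulr_suml.
by apply: eq_bigr => i _; rewrite -!mulrA h.
Qed.

Variables (al : G -> M -> M) (rho : M -> M) (S : M) (T : G -> M) (y : ldata R G).
Hypothesis L : lift C al rho S T y.
Hypothesis HM : hyperfinite_III1_factor M.
Variables (F : autoeq C) (A : G -> frame M) (P : frame M).
Hypothesis gA : graded_frames F A (fun _ _ => 1).
Hypothesis sA : forall g, fsrc (A g) = al g /\ ftgt (A g) = al g.
Hypothesis hP : frame_ok F P.
Hypothesis sP : fsrc P = rho /\ ftgt P = rho.
Hypothesis PA : forall h, ften F P (A h) = ften F (A (- h)) P.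
Hypothesis A0 : A 0 = fone F.
Hypothesis fS : fmor F (fone F) (ften F P P) S = S.
Hypothesis fT : forall g, fmor F (ften F (A g) P) (ften F P P) (T g) = T g.
Local Notation wd := (wd al rho).

Let hA g : frame_ok F (A g). Proof. by case: gA. Qed.
Let AA g h : ften F (A g) (A h) = A (g + h).
Proof. by case: gA => _ _ ->; rewrite fscale1. Qed.

Definition word_frame w : frame M := iter w.2 (fun X => ften F X P) (A w.1).
Local Notation wf := word_frame.

Let wf_ok w : frame_ok F (wf w).
Proof. by case: w => g m; rewrite /wf /=; elim: m => [|m IH] //=; apply: ften_ok. Qed.

Let wf_src w : fsrc (wf w) = wd w /\ ftgt (wf w) = wd w.
Proof.
have E v : wd v = al v.1 \o iter v.2 rho by [].
case: w => g m; rewrite E /wf /=; elim: m => [|m [IH1 IH2]] /=; first exact: sA.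
rewrite IH1 IH2 sP.1 sP.2.
by split; apply/funext => z /=; rewrite -iterSr.
Qed.

Let wf_A g m h : ften F (wf (g, m)) (A h) = wf (g + wsgn m h, m).
Proof.
elim: m h => [|m IH] h; first exact: AA.
rewrite -[wf (g, m.+1)]/(ften F (wf (g, m)) P) -ftenA // PA ftenA // IH wsgnS //.
Qed.

Let wf_mul w v : ften F (wf w) (wf v) = wf (wmul w v).
Proof.
case: w v => [g m] [h k]; elim: k => [|k IH].
  by rewrite /wmul /= addn0; exact: wf_A.
rewrite -[wf (h, k.+1)]/(ften F (wf (h, k)) P) ftenA // IH /wmul /= addnS //.
Qed.

(** Strict frames allow each generating morphism to be split as a prefix word times S or T_h, so
    that [word_hom_ind] spreads the hypotheses [fS] and [fT]. *)
Let wf_hom w v X : (v.2 <= 1)%N -> hom (wd w) (wd v) X ->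
  fmor F (wf w) (wf v) X = X.
Proof.
pose Q w v X := hom (wd w) (wd v) X /\ fmor F (wf w) (wf v) X = X.
move=> hv hX; suff: Q w v X by case.
have hs w' v' Y : hom (wd w') (wd v') Y -> hom (fsrc (wf w')) (fsrc (wf v')) Y.
  by rewrite (wf_src w').1 (wf_src v').1.
apply: (word_hom_ind L HM (Q := Q)) hv hX.
- by move=> w'; split; [exact: hom1|exact: fmor1].
- move=> w' v' c Y Z [h1 e1] [h2 e2]; split.
    by apply: homL => //; exact: wd_endo L _.
  by rewrite fmor_lin ?e1 ?e2 //; apply: hs.
- move=> w' v' u Y Z [h1 e1] [h2 e2]; split; first exact: homM h1 h2.
  by rewrite (fmor_comp (wf_ok w') (wf_ok v')) ?e1 ?e2 //; apply: hs.
- move=> w' v'; split; last exact: fmor0.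
  by apply: hom0; exact: wd_endo L _.
- move=> w' v' Y h [_ e]; split; first by apply: homV h; exact: wd_endo L _.
  by rewrite fmor_star ?e //; apply: hs.
- move=> g m; split; first exact: (wd_S L).
  have e1 : wf (g, m.+2) = ften F (wf (g, m)) (ften F P P) by rewrite ftenA.
  have e2 : wf (g, m) = ften F (wf (g, m)) (fone F) by rewrite ften1r.
  rewrite e1 {1}e2 -(wf_src (g, m)).1 fmor_tenl ?fS ?(wf_src _).2 //.
  - by rewrite (wf_src _).1.
  - exact: fone_ok.
  - exact: ften_ok.
  - by rewrite /= sP.1; exact: lf_S L.
- move=> g m h; split; first exact: (wd_T L).
  have e1 : wf (g, m.+2) = ften F (wf (g, m)) (ften F P P) by rewrite ftenA.
  have e2 : wf (g + wsgn m h, m.+1) = ften F (wf (g, m)) (ften F (A h) P).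
    by rewrite ftenA // wf_A.
  rewrite e1 e2 -(wf_src (g, m)).1 fmor_tenl ?fT ?(wf_src _).2 //.
  - by rewrite (wf_src _).1.
  - exact: ften_ok.
  - exact: ften_ok.
  - by rewrite /= sP.1 (sA h).1; exact: lf_T L _.
Qed.

Lemma strict_trivial : mon_iso F (ae_one C).
Proof.
have H s : exists r : {n & (('I_n -> word G) * ('I_n -> M))%type},
    C s -> resolution al rho s (projT2 r).1 (projT2 r).2.
  have [cs|ncs] := pselect (C s).
    by have [n [W [V r]]] := resolution_exists L cs; exists (existT _ n (W, V)).
  by exists (existT _ 0%N (fun=> (0, 0%N), fun=> 0)).
have [r rP] := choice H.
pose W s i := (projT2 (r s)).1 i; pose V s i := (projT2 (r s)).2 i.
have {}rP s : C s -> resolution al rho s (W s) (V s) by exact: rP.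
pose f w := fmap (wf w).
have f1 w : st (f w) * f w = 1 by exact: ok_u1 (wf_ok w).
have f2 w : f w * st (f w) = 1 by exact: ok_u2 (wf_ok w).
have fh w : hom (F (wd w)) (wd w) (f w).
  by have := ok_hom (wf_ok w); rewrite (wf_src w).1 (wf_src w).2.
pose Fm := ae_mor F.
(* On a word the frame itself is the required isomorphism; on other objects it is assembled from a
   resolution. [key] shows compatibility with every morphism out of a word, from which naturality,
   monoidality and the unit law follow. *)
pose e s := \sum_i V s i * f (W s i) * st (Fm (wd (W s i)) s (V s i)).
have cw w : C (wd w) by exact: wd_obj L w.
have ew w : star_endo (wd w) by exact: wd_endo L w.
have key s w X : C s -> hom (wd w) s X -> e s * Fm (wd w) s X = X * f w.
  move=> cs hX; have [w1 hV _ VV] := rP s cs.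
  rewrite -[X in _ = X * _]mul1r -VV !mulr_suml; apply: eq_bigr => i _.
  have hVX := homM hX (homV (ew _) (obj_endo cs) (hV i)).
  rewrite /e -!mulrA; congr (_ * _).
  rewrite -(ae_star F (cw _) cs (hV i)) -(ae_comp F (cw w) cs (cw _) hX); last first.
    exact: homV (ew _) (obj_endo cs) (hV i).
  have := wf_hom (w1 i) hVX; rewrite /fmor (wf_src _).1 (wf_src _).1.
  move=> /(congr1 (fun z => z * f w)); rewrite -!mulrA f1 mulr1 => -> //.
have FV s : C s -> \sum_i Fm (wd (W s i)) s (V s i) * st (Fm (wd (W s i)) s (V s i)) = 1.
  move=> cs; have [w1 hV _ VV] := rP s cs; have es := obj_endo cs.
  transitivity (Fm s s (\sum_i V s i * st (V s i))); last by rewrite VV; exact: ae_id.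
  have hVV i : hom s s (V s i * st (V s i)) by apply: homM (hV i); exact: (homV (ew _) es (hV i)).
  suff: hom s s (\sum_i V s i * st (V s i)) /\ \sum_i Fm (wd (W s i)) s (V s i) *
      st (Fm (wd (W s i)) s (V s i)) = Fm s s (\sum_i V s i * st (V s i)) by case.
  apply: (big_ind2 (fun a b => hom s s b /\ a = Fm s s b)).
  - by split; [exact: hom0|rewrite /Fm ae_mor0].
  - move=> a b a' b' [h1 ->] [h2 ->]; split; first exact: homD.
    by have := ae_lin F 1 cs cs h1 h2; rewrite !scale1r /Fm => ->.
  - move=> i _; split=> //; rewrite -(ae_star F (cw _) cs (hV i)).
    by rewrite -(ae_comp F cs (cw _) cs (homV (ew _) es (hV i)) (hV i)).
have FVV s i j : C s -> st (Fm (wd (W s i)) s (V s i)) * Fm (wd (W s j)) s (V s j) =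
    if i == j then 1 else 0.
  move=> cs; have [w1 hV Vd _] := rP s cs; have es := obj_endo cs.
  rewrite -(ae_star F (cw _) cs (hV i)) -(ae_comp F (cw _) cs (cw _) (hV j) (homV (ew _) es (hV i))).
  by rewrite Vd; case: eqP => [->|_]; [exact: ae_id|exact: ae_mor0].
exists e, (fun s => st (e s)); split=> /=.
- move=> s cs; have [w1 hV Vd VV] := rP s cs; have es := obj_endo cs; split.
  + apply: hom_sum => i; apply: (homM (t := F (wd (W s i)))).
      apply: homV; [exact: ae_objE|exact: ae_objE|exact: ae_morP].
    exact: homM (fh _) (hV i).
  + rewrite /e star_sum mulr_suml -(FV s cs); apply: eq_bigr => i _.
    rewrite mulr_sumr (bigD1 i) //= big1 ?addr0 => [|j nj].
      rewrite !starM starK -!mulrA (mulrA (st (V s i))) Vd eqxx mul1r.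
      by rewrite (mulrA (st (f _))) f1 mul1r.
    by rewrite !starM -!mulrA (mulrA (st (V s i))) Vd eq_sym (negPf nj) mul0r !mulr0.
  + rewrite /e star_sum mulr_suml -VV; apply: eq_bigr => i _.
    rewrite mulr_sumr (bigD1 i) //= big1 ?addr0 => [|j nj].
      rewrite !starM starK -!mulrA (mulrA (st (Fm _ _ _))) FVV // eqxx mul1r.
      by rewrite (mulrA (f _)) f2 mul1r.
    by rewrite !starM starK -!mulrA (mulrA (st (Fm _ _ _))) FVV // eq_sym (negPf nj) mul0r !mulr0.
- move=> s t X cs ct hX; apply: (complete_ext (FV s cs)) => i.
  have [w1 hV _ _] := rP s cs.
  rewrite -mulrA -(ae_comp F (cw _) cs ct (hV i) hX) key //; last exact: homM (hV i) hX.
  by rewrite -!mulrA key.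
- move=> s t cs ct; rewrite mul1r.
  have [w1 hV _ _] := rP s cs; have [v1 hV' _ _] := rP t ct.
  (* Monoidality is tested on this complete family, the product of the images of the two
     resolutions. *)
  pose U ij := Fm (wd (W s ij.1)) s (V s ij.1) *
    F (wd (W s ij.1)) (Fm (wd (W t ij.2)) t (V t ij.2)).
  apply: (complete_ext (U := U)) => [|[i j]].
    rewrite -(FV s cs) -(pair_bigA _ (fun i j => U (i, j) * st (U (i, j)))) /=.
    apply: eq_bigr => i _; rewrite /U /=.
    have eFi := ae_objE F (cw (W s i)).
    under eq_bigr => j _ do rewrite starM -!mulrA (mulrA (F _ _)) -(endoS _ eFi) -(endoM _ _ eFi).
    by rewrite -mulr_sumr -mulr_suml -(endo_sum _ _ _ eFi) (FV t ct) endo1 // mul1r.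
  rewrite /U /=; set Xi := wd (W s i); set Xj := wd (W t j).
  have cst := obj_comp cs ct; have cij := obj_comp (cw (W s i)) (cw (W t j)).
  have hT := homT (ew (W s i)) (hV i) (hV' j).
  have eF : star_endo (F Xi) := ae_objE F (cw (W s i)).
  rewrite -mulrA -(ae_tenN F (cw _) cs (cw _) ct (hV i) (hV' j)) mulrA.
  have kst := key (s \o t) (wmul (W s i) (W t j)) (V s i * wd (W s i) (V t j)) cst.
  rewrite -(wd_mul L) in kst; rewrite /Fm in kst; rewrite (kst hT).
  rewrite /f -wf_mul /= !(wf_src _).1.
  have [JJ _] := ae_tenU F (cw (W s i)) (cw (W t j)).
  rewrite -!mulrA JJ mulr1.
  have hFi : hom (F Xi) (F s) (Fm Xi s (V s i)) := ae_morP F (cw (W s i)) cs (hV i).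
  rewrite [in RHS](mulrA (F s _)) -hFi -!mulrA -(endoM _ _ eF) key //.
  rewrite [RHS]mulrA key // (endoM _ _ eF) -!mulrA; congr (_ * _).
  have /= h := fh (W s i) (V t j); rewrite [RHS]mulrA.
  rewrite -/Xi in h; by rewrite h -!mulrA.
- have ci := obj_id C; have e0 : wd (0, 0%N) = idfun.
    by rewrite -[LHS]/(al 0 \o idfun) (lf_0 L).
  have := key idfun (0, 0%N) 1 ci; rewrite e0 => /(_ (hom1 _)).
  rewrite /Fm (ae_id F ci) mulr1 mul1r => ->.
  rewrite /f /wf /= A0 /=; by have [] := ae_unitU F.
Qed.

End Rigidity.

(** * Functors with trivial triple *)

Section Kernel.
Variables (R : realType) (M : starAlg R) (C : fusionCat M) (G : finZmodType).
Implicit Types (g h k : G).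
Variables (al : G -> M -> M) (rho : M -> M) (S : M) (T : G -> M).
Variables (x : numdata R G) (c : R[i]).
Hypothesis HM : hyperfinite_III1_factor M.
Hypothesis Hx : polynomial_equations x.
Hypothesis HA : forall g h k, amp x g h k != 0.
Hypothesis L : lift C al rho S T (std_ldata x c).

Lemma normalized_cocycle1 : @normalized_cocycle R G (fun _ _ => 1).
Proof.
split=> // [|g h|g h]; [exact: cocycle1|by rewrite mulr1|].
by rewrite rmorph1 mulr1.
Qed.

Lemma describes_one_trivial (F : autoeq C) :
  describes al rho F (gamma_one R G) -> out_eq F (ae_one C).
Proof.
move=> [A [P [gA sA hP sP]]]; apply: out_of_iso.
have oN := normalized_cocycle1.
have sA' g : fsrc (A g) = al g /\ ftgt (A g) = al g.
  by have [] := sA g; rewrite /= invg1 perm1.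
have [P' [hP' sP1 sP2 fS]] := normalized_rho_frame (ga := gamma_one R G) HM L hP sP.
have [tau [kap [sys [fT PA]]]] := system_of_frames (ga := gamma_one R G) HM Hx L oN gA sA hP' (conj sP1 sP2) fS.
have [[t1 k1 kD tk] _ _ sAmp] := sys.
have taun g : tau g != 0 by exact: unit_neq0.
have kapn g : kap g != 0 by exact: unit_neq0.
have [hA w1 AA] := gA.
have k0 : kap 0 = 1 by apply: (mulfI (kapn 0)); rewrite -kD addr0 mulr1.
have kN h : kap h * kap (- h) = 1 by rewrite -kD subrr.
have key g h j : tau g * tau (g + j) * kap h = tau (g + h) * tau (g + h + j).
  have := sAmp g h j; rewrite /= invg1 !perm1 addr0 !mulr1 => e.
  apply: (mulfI (HA g h j)); rewrite {2}e; field; by rewrite !taun.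
(* [key] with first argument 0, together with kap = tau^2 and tau(0)^2 = kap(0) = 1, says that
   tau(0) tau is multiplicative. *)
pose ch g := tau 0 * tau g.
have t0 : tau 0 * tau 0 = 1 by rewrite -expr2 tk.
have chM g h : ch g * ch h = ch (g + h).
  have := key 0 g h; rewrite !add0r -tk => e.
  apply: (mulIf (taun g)); rewrite /ch -!mulrA [in RHS](mulrC (tau (g + h))) -e expr2.
  transitivity ((tau 0 * tau 0) * (tau g * tau h * tau g)); first by ring.
  by transitivity ((tau 0 * tau 0) * (tau g * tau h * tau g)); last ring.
have ch1 g : `|ch g| = 1 by rewrite normrM !t1 mulr1.
have ch2 g : ch g * ch g = kap g by rewrite -tk expr2 /ch mulrACA t0 mul1r.
(* Scaling A by [ch] and P by tau(0) removes the phases on the T_g and the exchange scalars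
   together. The transport of S is unaffected because tau(0)^2 = 1. *)
pose A' g := fscale (ch g) (A g).
have hA' g : frame_ok F (A' g) by exact: fscale_ok.
pose P'' := fscale (tau 0) P'.
have hP'' : frame_ok F P'' by exact: fscale_ok.
have PP : ften F P'' P'' = ften F P' P'.
  by rewrite fscale_tenl fscale_tenr // fscaleA t0 fscale1.
have sP'' : fsrc P'' = rho /\ ftgt P'' = rho.
  by split=> //=; rewrite sP2 /= (lf_0 L).
have AP g : ften F (A' g) P'' = fscale (ch g * tau 0) (ften F (A g) P').
  by rewrite fscale_tenl fscale_tenr // fscaleA.
apply: (@strict_trivial _ _ _ _ al rho S T _ L HM F A' P'') => //.
- split=> [g|g h|g h]; [exact: hA'|by rewrite normr1|].
  by rewrite fscale_tenl fscale_tenr // AA fscale1 !fscaleA mulr1 chM.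
- move=> h; rewrite AP fscale_tenl fscale_tenr // PA !fscaleA; congr fscale.
  have : ch h * ch (- h) = 1 by rewrite chM subrr /ch t0.
  move: (ch2 h) (unit_neq0 (ch1 h)); move: (ch h) (ch (- h)) => a b <- na e.
  have -> : b = a^-1 by apply: (mulfI na); rewrite e divff.
  by rewrite invfM mulrA mulfK // mulrC.
- rewrite /A' /ch t0 fscale1; exact: (@frame_zero _ _ _ _ _ _ _ _ _ _ L F (gamma_one R G) A oN gA sA).
- by rewrite PP.
- move=> g; rewrite PP AP fmor_scalel.
  have := fT g; rewrite /= invg1 perm1 addr0 => ->.
  rewrite scalerA /ch mulrAC t0 mul1r.
  by rewrite unit_conjl // scale1r.
Qed.

End Kernel.

(** * Autoequivalences from equal structure constants *)

Section CuntzUniqueness.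
Variables (R : realType) (M : starAlg R) (I : finType).
Local Notation st := (@star R M).
Implicit Types (a b i : I) (w v : seq I) (q : seq I -> R[i]).

(** Noncommutative polynomials in the generators, without adjoints: a coefficient function on words,
    truncated at length n. Splitting off the first letter prepares left division by the adjoint of a
    generator. *)
Fixpoint peval (s : I -> M) n q : M :=
  if n is n'.+1 then (q [::])%:A + \sum_a s a * peval s n' (fun w => q (a :: w))
  else (q [::])%:A.

Definition weval (s : I -> M) w : M := foldr (fun a x => s a * x) 1 w.

Lemma peval_lin s n c q q' :
  peval s n (fun w => c * q w + q' w) = c *: peval s n q + peval s n q'.
Proof.
elim: n q q' => [|n IH] q q' /=; first by rewrite scalerDl scalerA.
rewrite scalerDr addrACA scalerDl scalerA; congr (_ + _).
rewrite scaler_sumr -big_split /=; apply: eq_bigr => a _.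
by rewrite IH mulrDr scalerAr.
Qed.

Lemma peval0 s n q : (forall w, (size w <= n)%N -> q w = 0) -> peval s n q = 0.
Proof.
elim: n q => [|n IH] q h /=; first by rewrite h // scale0r.
rewrite h // scale0r add0r big1 // => a _; rewrite IH ?mulr0 // => w hw.
exact: h.
Qed.

Lemma eq_peval s n q q' : q =1 q' -> peval s n q = peval s n q'.
Proof.
elim: n q q' => [|n IH] q q' e /=; rewrite e //; congr (_ + _).
by apply: eq_bigr => a _; congr (_ * _); apply: IH => w; rewrite e.
Qed.

(** Coefficients of the polynomial multiplied by s_b on the right. *)
Definition pmulr q b w : R[i] :=
  if w is a :: r then if last a r == b then q (belast a r) else 0 else 0.

Lemma peval_pmulr s n q b : peval s n.+1 (pmulr q b) = peval s n q * s b.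
Proof.
elim: n q => [|n IH] q.
  rewrite /= scale0r add0r (bigD1 b) //= big1 => [|a na].
    by rewrite eqxx addr0 -scalerAr mulr1 -scalerAl mul1r.
  by rewrite (negPf na) scale0r mulr0.
rewrite [LHS]/= scale0r add0r [peval s n.+1 q]/= mulrDl mulr_suml.
have -> : (q [::])%:A * s b = \sum_a s a * ((a == b)%:R * q [::])%:A.
  rewrite (bigD1 b) //= big1 ?addr0 => [|a na].
    by rewrite eqxx mul1r -scalerAl mul1r -scalerAr mulr1.
  by rewrite (negPf na) mul0r scale0r mulr0.
rewrite -big_split; apply: eq_bigr => a _ /=.
rewrite -mulrA -IH -mulrDr; congr (_ * _).
rewrite [peval s n.+1 _ in RHS]/= scale0r add0r; congr (_ + _).
by case: eqP; rewrite ?mul1r ?mul0r.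
Qed.

Variable s : I -> M.
Hypothesis ss : forall a b, st (s a) * s b = if a == b then 1 else 0.

Lemma weval_iso w : st (weval s w) * weval s w = 1.
Proof.
elim: w => [|a w IH] /=; first by rewrite st1 mulr1.
by rewrite starM -mulrA (mulrA (st (s a))) ss eqxx mul1r.
Qed.

Lemma peval_left n q a x :
  st (s a) * (peval s n.+1 q * x) =
  q [::] *: (st (s a) * x) + peval s n (fun w => q (a :: w)) * x.
Proof.
rewrite /= mulrDl mulrDr -scalerAl mul1r -scalerAr; congr (_ + _).
rewrite mulr_suml mulr_sumr (bigD1 a) //= big1 => [|b nb].
  by rewrite -mulrA mulrA ss eqxx mul1r addr0.
by rewrite -mulrA mulrA ss eq_sym (negPf nb) mul0r.
Qed.

Hypothesis I2 : forall a, exists b, b != a.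

(** Two or more Cuntz isometries are free, even after restriction to the range of a word. Left
    division by s_a lowers the degree but drags the constant term along; the trailing word v keeps
    the induction closed, as s_a^* either kills its first letter or strips it. *)
Lemma peval_inj n q v : peval s n q * weval s v = 0 ->
  forall w, (size w <= n)%N -> q w = 0.
Proof.
elim: n q v => [|n IH] q v.
  move=> /= e [|//] _; apply: (@alg_inj _ M).
  rewrite -scalerAl mul1r in e.
  by rewrite scale0r -(weval_iso v) scalerAr e mulr0.
have conclude p : p [::] = 0 -> (forall a w, (size w <= n)%N -> p (a :: w) = 0) ->
    forall w, (size w <= n.+1)%N -> p w = 0.
  by move=> e h [|a w] //= hw; apply: h.
elim: v q => [|g v IHv] q e.
  have tail a w : (size w <= n)%N -> q (a :: w) = 0.
    have [b nb] := I2 a; apply: (IH (fun w => q (a :: w)) [:: b]).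
    have := peval_left n q a (s b); rewrite -(mulr1 (peval s n.+1 q)) e mul0r mulr0.
    by rewrite ss eq_sym (negPf nb) scaler0 add0r /= mulr1 => <-.
  apply: conclude => //; apply: (@alg_inj _ M); rewrite scale0r.
  move: e; rewrite mulr1 /= big1 ?addr0 // => a _.
  by rewrite peval0 ?mulr0 // => w; apply: tail.
have others a w : a != g -> (size w <= n)%N -> q (a :: w) = 0.
  move=> na; apply: (IH (fun w => q (a :: w)) (g :: v)).
  have := peval_left n q a (weval s (g :: v)); rewrite e mulr0 /=.
  by rewrite (mulrA (st (s a)) (s g)) ss (negPf na) mul0r scaler0 add0r => <-.
(* Division by s_g strips the first letter of the trailing word, while the quotient is still
   multiplied by s_g on its right. So p has the same degree bound and a shorter trailing word, and
   its coefficient at w followed by g is that of q at g followed by w. *)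
pose p w := (if w is [::] then q [::] else 0) + pmulr (fun w => q (g :: w)) g w.
have ep : peval s n.+1 p * weval s v = 0.
  have -> : peval s n.+1 p = (q [::])%:A + peval s n (fun w => q (g :: w)) * s g.
    pose c w : R[i] := if w is [::] then q [::] else 0.
    have -> : peval s n.+1 p = peval s n.+1 (fun w => 1 * c w + pmulr (fun w => q (g :: w)) g w).
      by apply: eq_peval => w; rewrite mul1r.
    rewrite peval_lin scale1r peval_pmulr; congr (_ + _).
    by rewrite /= big1 ?addr0 // => a _; rewrite peval0 ?mulr0.
  have := peval_left n q g (weval s (g :: v)); rewrite e mulr0 /=.
  rewrite (mulrA (st (s g)) (s g)) ss eqxx mul1r => E.
  by rewrite mulrDl -scalerAl mul1r -mulrA [RHS]E.
have p0 := IHv p ep.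
apply: conclude => [|a w hw].
  by have := p0 [::] isT; rewrite /p /= addr0.
have [->|na] := eqVneq a g; last exact: others.
have := p0 (rcons w g); rewrite size_rcons => /(_ hw).
rewrite /p; case: (w) => [|b r] /=; first by rewrite add0r eqxx.
by rewrite add0r last_rcons eqxx belast_rcons.
Qed.

End CuntzUniqueness.

(** * Well-definedness of the isomorphism between generated algebras *)

Section CuntzTransfer.
Variables (R : realType) (M : starAlg R) (I : finType).
Local Notation st := (@star R M).
Implicit Types (a b i : I) (w v : seq I) (q : seq I -> R[i]).
Variables s s' : I -> M.

(* The graph of the isomorphism between the *-algebras generated by s and s'. *)
Inductive transfer : M -> M -> Prop :=
| transfer_gen i : transfer (s i) (s' i)
| transfer_genV i : transfer (st (s i)) (st (s' i))
| transfer1 : transfer 1 1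
| transfer_lin c x x' y y' : transfer x x' -> transfer y y' ->
    transfer (c *: x + y) (c *: x' + y')
| transferM x x' y y' : transfer x x' -> transfer y y' -> transfer (x * y) (x' * y').

Lemma transferZ c x x' : transfer x x' -> transfer (c *: x) (c *: x').
Proof.
move=> h; have e z : c *: z = (c - 1) *: z + z :> M by rewrite scalerBl scale1r subrK.
by rewrite (e x) (e x'); apply: transfer_lin.
Qed.

Lemma transferD x x' y y' : transfer x x' -> transfer y y' -> transfer (x + y) (x' + y').
Proof. by move=> h h'; rewrite -[x]scale1r -[x']scale1r; apply: transfer_lin. Qed.

Lemma transfer0 : transfer 0 0.
Proof. by rewrite -(scale0r (1 : M)); apply: transferZ; exact: transfer1. Qed.

Lemma transfer_sum (J : Type) (r : seq J) (P : pred J) (X X' : J -> M) :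
  (forall j, transfer (X j) (X' j)) ->
  transfer (\sum_(j <- r | P j) X j) (\sum_(j <- r | P j) X' j).
Proof.
by move=> h; apply: (big_ind2 transfer) => //; [exact: transfer0|exact: transferD].
Qed.

Lemma transferV x x' : transfer x x' -> transfer (st x) (st x').
Proof.
elim=> [i|i||c z z' u u' _ h _ h'|z z' u u' _ h _ h'].
- exact: transfer_genV.
- by rewrite !starK; exact: transfer_gen.
- by rewrite st1; exact: transfer1.
- by rewrite !starD !starZ; exact: transfer_lin.
- by rewrite !starM; exact: transferM.
Qed.

Lemma transfer_endo f f' : star_endo f -> star_endo f' ->
  (forall i, transfer (f (s i)) (f' (s' i))) ->
  forall x x', transfer x x' -> transfer (f x) (f' x').
Proof.
move=> ef ef' h x x'.
elim=> [i|i||c z z' u u' _ h1 _ h2|z z' u u' _ h1 _ h2] //.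
- by rewrite (endoS _ ef) (endoS _ ef'); exact: transferV.
- by rewrite (endo1 ef) (endo1 ef'); exact: transfer1.
- rewrite (endoD _ _ ef) (endoD _ _ ef') (endoZ _ _ ef) (endoZ _ _ ef').
  exact: transfer_lin.
- by rewrite (endoM _ _ ef) (endoM _ _ ef'); exact: transferM.
Qed.

Hypothesis ss : forall a b, st (s a) * s b = if a == b then 1 else 0.
Hypothesis ss' : forall a b, st (s' a) * s' b = if a == b then 1 else 0.
Hypothesis full' : \sum_a s' a * st (s' a) = 1.
Hypothesis I2 : forall a, exists b, b != a.

(** The equality is asked for all large truncations, so that polynomials of different lengths can be
    combined. *)
Definition common_poly x x' := exists q n0, forall n, (n0 <= n)%N ->
  x = peval s n q /\ x' = peval s' n q.

Lemma common_poly_lin c x x' y y' : common_poly x x' -> common_poly y y' ->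
  common_poly (c *: x + y) (c *: x' + y').
Proof.
move=> [q [n0 h]] [r [m0 h']]; exists (fun w => c * q w + r w), (maxn n0 m0) => n.
rewrite geq_max => /andP [/h [-> ->] /h' [-> ->]].
by rewrite !peval_lin.
Qed.

Lemma common_poly0 : common_poly 0 0.
Proof. by exists (fun=> 0), 0%N => n _; rewrite !peval0. Qed.

Lemma common_poly_cons b x x' : common_poly x x' -> common_poly (s b * x) (s' b * x').
Proof.
move=> [q [n0 h]].
exists (fun w => if w is a :: r then (a == b)%:R * q r else 0), n0.+1 => -[//|n].
move=> /h [-> ->] /=; rewrite !scale0r !add0r.
have e u a : u a * peval u n (fun r => (a == b)%:R * q r) = (a == b)%:R *: (u a * peval u n q).
  rewrite (@eq_peval _ _ _ u n _ (fun r => (a == b)%:R * q r + 0)); last by move=> r; rewrite addr0.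
  by rewrite peval_lin (@peval0 _ _ _ u n (fun=> 0)) // addr0 scalerAr.
rewrite (bigD1 b) //= big1 => [|a na]; last by rewrite e (negPf na) scale0r.
rewrite [X in _ /\ _ = X](bigD1 b) //= big1 => [|a na]; last by rewrite e (negPf na) scale0r.
by rewrite !e eqxx !scale1r !addr0.
Qed.

Lemma common_poly_word w : common_poly (weval s w) (weval s' w).
Proof.
elim: w => [|a w IH] /=; last exact: common_poly_cons.
exists (fun w => (w == [::])%:R), 0%N => n _.
have e u : peval u n (fun w => (w == [::])%:R) = 1.
  case: n => [|n] /=; rewrite scale1r // big1 ?addr0 // => a _.
  by rewrite peval0 ?mulr0.
by rewrite !e.
Qed.

(** Right multiplication by a long enough word absorbs the adjoints: x becomes a polynomial in the
    generators, and x' the same polynomial in the other ones. *)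
Definition tame N x x' := forall w, (N <= size w)%N ->
  common_poly (x * weval s w) (x' * weval s' w).

Lemma tame_peval N x x' n q w : tame N x x' -> (N <= size w)%N ->
  common_poly (x * (peval s n q * weval s w)) (x' * (peval s' n q * weval s' w)).
Proof.
elim: n x x' q => [|n IH] x x' q tx hw /=.
  rewrite -!scalerAl !mul1r -!scalerAr -[_ *: _]addr0 -[X in common_poly _ X]addr0.
  by apply: common_poly_lin (tx w hw) common_poly0.
rewrite !mulrDl !mulrDr -!scalerAl !mul1r -!scalerAr.
apply: common_poly_lin (tx w hw) _; rewrite !mulr_suml !mulr_sumr.
apply: (big_ind2 common_poly); first exact: common_poly0.
  by move=> a b a' b' h h'; rewrite -[a]scale1r -[b]scale1r; apply: common_poly_lin.
move=> a _; rewrite -!(mulrA (s a)) -!(mulrA (s' a)) !mulrA -!(mulrA (_ * s _)) -!(mulrA (_ * s' _)).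
apply: IH => // v hv; rewrite -!mulrA.
by apply: (tx (a :: v)); rewrite (leq_trans hv).
Qed.

Lemma transfer_tame x x' : transfer x x' -> exists N, tame N x x'.
Proof.
elim=> [i|i||c z z' u u' _ [N h] _ [N' h']|z z' u u' _ [N h] _ [N' h']].
- by exists 0%N => w _; apply: common_poly_cons; exact: common_poly_word.
- exists 1%N => -[//|a w] _ /=; rewrite !(mulrA (st _)) ss ss'.
  case: eqP => _; rewrite ?mul1r ?mul0r; [exact: common_poly_word|exact: common_poly0].
- by exists 0%N => w _; rewrite !mul1r; exact: common_poly_word.
- exists (maxn N N') => w; rewrite geq_max => /andP [h1 h2].
  by rewrite !mulrDl -!scalerAl; apply: common_poly_lin; [exact: h|exact: h'].
(* The first N' letters turn the right factor into a polynomial; the remaining letters, at least N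
   of them, absorb the adjoints of the left factor. *)
- exists (N' + N)%N => w hw.
  have e (f : I -> M) : weval f w = weval f (take N' w) * weval f (drop N' w).
    rewrite -{1}(cat_take_drop N' w); elim: (take N' w) => [|a r IH] /=; first by rewrite mul1r.
    by rewrite IH mulrA.
  have h1 : (N' <= size (take N' w))%N.
    by rewrite size_take; case: ltnP => // _; apply: leq_trans (leq_addr _ _) hw.
  have h2 : (N <= size (drop N' w))%N by rewrite size_drop leq_subRL ?(leq_trans (leq_addr N N') hw).
  have [q [n0 hq]] := h' _ h1; have [eq1 eq2] := hq n0 (leqnn _).
  rewrite !e -!mulrA (mulrA u) (mulrA u') eq1 eq2.
  exact: (tame_peval _ _ h h2).
Qed.

(** The algebraic substitute for simplicity of the Cuntz algebra. y times any word of length N is a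
    polynomial whose coefficients vanish by [peval_inj], and the words of length N resolve 1. *)
Lemma transfer0_uniq y : transfer 0 y -> y = 0.
Proof.
move=> /transfer_tame [N h].
have z w : size w = N -> y * weval s' w = 0.
  move=> hw; have [|q [n0 hq]] := h w; first by rewrite hw.
  have [e ->] := hq n0 (leqnn _); apply: peval0.
  by apply: (@peval_inj _ _ _ s ss I2 n0 q [::]); rewrite -e mul0r mul0r.
elim: N y z {h} => [|N IH] y z; first by have := z [::] erefl; rewrite /= mulr1.
rewrite -[y]mulr1 -full' mulr_sumr big1 // => a _; rewrite mulrA.
rewrite (IH (y * s' a)) ?mul0r // => w hw.
by rewrite -mulrA; apply: (z (a :: w)); rewrite /= hw.
Qed.

Lemma transfer_uniq x y y' : transfer x y -> transfer x y' -> y = y'.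
Proof.
move=> h h'; have := transfer_lin (-1) h h'; rewrite scaleN1r addNr => /transfer0_uniq.
by move/eqP; rewrite scaleN1r addrC subr_eq0 => /eqP.
Qed.

End CuntzTransfer.

(** * Direct sums of endomorphisms *)

Section DirectSums.
Variables (R : realType) (M : starAlg R) (C : fusionCat M).
Local Notation st := (@star R M).

Definition complete_family (I : finType) (V : I -> M) :=
  (forall i j, st (V i) * V j = if i == j then 1 else 0) /\
  \sum_i V i * st (V i) = 1.

Definition sum_endo (I : finType) (V : I -> M) (t : I -> M -> M) : M -> M :=
  fun x => \sum_i V i * t i x * st (V i).

Lemma sum_endo_hom (I : finType) (V : I -> M) t i : complete_family V ->
  hom (t i) (sum_endo V t) (V i).
Proof.
move=> [VV _] x; rewrite /sum_endo mulr_suml (bigD1 i) //= big1 => [|j nj].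
  by rewrite -!mulrA VV eqxx mulr1 addr0.
by rewrite -mulrA VV (negPf nj) mulr0.
Qed.

(** A complete family of intertwiners determines the endomorphism, which gives equality of objects
    where only isomorphism might be expected. *)
Lemma sum_endo_uniq (I : finType) (V : I -> M) t s : complete_family V ->
  (forall i, hom (t i) s (V i)) -> s = sum_endo V t.
Proof.
move=> [_ V1] h; apply/funext => x; rewrite -[LHS]mulr1 -V1 mulr_sumr.
by apply: eq_bigr => i _; rewrite mulrA -h.
Qed.

Lemma sum_endo_endo (I : finType) (V : I -> M) t : complete_family V ->
  (forall i, star_endo (t i)) -> star_endo (sum_endo V t).
Proof.
move=> [VV V1] et; split.
- move=> c x y; rewrite /sum_endo scaler_sumr -big_split; apply: eq_bigr => i _ /=.
  rewrite (endoD _ _ (et i)) (endoZ _ _ (et i)) mulrDr mulrDl.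
  by rewrite -scalerAr -scalerAl.
- move=> x y; rewrite /sum_endo mulr_suml; apply: eq_bigr => i _.
  rewrite mulr_sumr (bigD1 i) //= big1 => [|j nj].
    rewrite addr0 (endoM _ _ (et i)) -!mulrA (mulrA (st (V i))) VV eqxx mul1r //.
  by rewrite -!mulrA (mulrA (st (V i))) VV eq_sym (negPf nj) mul0r !mulr0.
- by rewrite /sum_endo -[RHS]V1; apply: eq_bigr => i _; rewrite (endo1 (et i)) mulr1.
- move=> x; rewrite /sum_endo star_sum; apply: eq_bigr => i _.
  by rewrite (endoS _ (et i)) !starM starK mulrA.
Qed.

Lemma ord_sum_exists n (t : 'I_n.+1 -> M -> M) : (forall i, C (t i)) ->
  exists2 k, C k & exists2 V, complete_family V & forall i, hom (t i) k (V i).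
Proof.
elim: n t => [|n IH] t ct.
  exists (t ord0) => //; exists (fun=> 1) => [|i]; last by rewrite (ord1 i); exact: hom1.
  split=> [i j|]; first by rewrite !ord1 st1 mulr1.
  by rewrite big_ord_recl big_ord0 st1 mulr1 addr0.
have [k ck [V [VV V1] hV]] := IH (fun i => t (fintype.lift ord0 i)) (fun i => ct _).
have [k' ck' [U [hU UU U1]]] := obj_sum (ct ord0) ck.
exists k' => //; exists (fun i => if unlift ord0 i is Some j then U false * V j else U true).
  split=> [i j|].
    case: (unliftP ord0 i) => [i'|] ->; case: (unliftP ord0 j) => [j'|] ->.
    - rewrite starM -mulrA (mulrA (st (U false))) UU eqxx mul1r VV.
      by rewrite (inj_eq lift_inj).
    - by rewrite starM -mulrA UU mulr0.
    - by rewrite mulrA UU mul0r.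
    - by rewrite UU !eqxx.
  rewrite big_ord_recl unlift_none -[RHS]U1 big_bool; congr (_ + _).
  rewrite -[X in X * st (U false)]mulr1 -V1 mulr_sumr mulr_suml.
  by apply: eq_bigr => i _; rewrite liftK starM !mulrA.
move=> i; case: (unliftP ord0 i) => [j|] ->; last exact: hU true.
by apply: homM (hV j) _; exact: hU false.
Qed.

(** [C] contains some direct sum of the t_i, and the unitary matching its isometries with V brings
    in this one by repleteness. An empty family would force 1 = 0. *)
Lemma sum_endo_obj n (V : 'I_n -> M) t : complete_family V -> (forall i, C (t i)) ->
  C (sum_endo V t).
Proof.
case: n V t => [|n] V t cV ct.
  by case: cV => _; rewrite big_ord0 => /eqP; rewrite eq_sym oner_eq0.
have [k ck [U cU hU]] := ord_sum_exists ct.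
have et i : star_endo (t i) by exact: obj_endo.
have ek := obj_endo ck; have eS := sum_endo_endo cV et.
apply: (obj_replete ck) => //; exists (\sum_i V i * st (U i)).
  apply: hom_sum => i; apply: homM (homV (et i) ek (hU i)) _.
  exact: sum_endo_hom.
have [[UU U1] [VV V1]] := (cU, cV).
split; rewrite star_sum mulr_suml.
- rewrite -U1; apply: eq_bigr => i _; rewrite mulr_sumr (bigD1 i) //= big1 => [|j nj].
    by rewrite addr0 starM starK -!mulrA (mulrA (st (V i))) VV eqxx mul1r.
  by rewrite starM -!mulrA (mulrA (st (V i))) VV eq_sym (negPf nj) mul0r !mulr0.
- rewrite -V1; apply: eq_bigr => i _; rewrite mulr_sumr (bigD1 i) //= big1 => [|j nj].
    by rewrite addr0 starM starK -!mulrA (mulrA (st (U i))) UU eqxx mul1r.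
  by rewrite starM starK -!mulrA (mulrA (st (U i))) UU eq_sym (negPf nj) mul0r !mulr0.
Qed.

End DirectSums.

(** * The functor between two liftings with equal structure constants *)

Section Functor.
Variables (R : realType) (M : starAlg R) (C : fusionCat M) (G : finZmodType).
Local Notation st := (@star R M).
Implicit Types (g h k : G) (s t : M -> M) (w v : word G).
Variables (al al' : G -> M -> M) (rho rho' : M -> M) (S S' : M) (T T' : G -> M).
Variable y : ldata R G.
Hypothesis L : lift C al rho S T y.
Hypothesis L' : lift C al' rho' S' T' y.
Hypothesis HM : hyperfinite_III1_factor M.
Local Notation wo := (wd al rho).
Local Notation wo' := (wd al' rho').

Let gens (S0 : M) (T0 : G -> M) (o : option G) : M := if o is Some g then T0 g else S0.

Let gens_orth S0 T0 al0 rho0 : lift C al0 rho0 S0 T0 y ->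
  forall a b, st (gens S0 T0 a) * gens S0 T0 b = if a == b then 1 else 0.
Proof.
move=> L0 [a|] [b|] /=; [exact: lf_TT L0 _ _|exact: lf_TS L0 _|exact: lf_ST L0 _|].
exact: lf_SS L0.
Qed.

Let tr := transfer (gens S T) (gens S' T').

Let tr_uniq x z z' : tr x z -> tr x z' -> z = z'.
Proof.
apply: transfer_uniq; [exact: gens_orth L|exact: gens_orth L'| |].
  rewrite (bigD1 None) //= (reindex_omap Some id) => [|[g|]] //=.
  by under eq_bigl => g do rewrite eqxx; exact: lf_full L'.
by case=> [g|]; [exists None|exists (Some 0)].
Qed.

Let trS : tr S S'. Proof. exact: (transfer_gen _ _ None). Qed.
Let trT g : tr (T g) (T' g). Proof. exact: (transfer_gen _ _ (Some g)). Qed.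

Let tr_al g x x' : tr x x' -> tr (al g x) (al' g x').
Proof.
apply: transfer_endo; [exact: lf_Ear L g|exact: lf_Ear L' g|case=> [h|]] => /=.
  by rewrite (lf_alT L) (lf_alT L'); apply: transferZ; exact: trT.
by rewrite (lf_alS L) (lf_alS L'); exact: trS.
Qed.

Let tr_rho x x' : tr x x' -> tr (rho x) (rho' x').
Proof.
apply: transfer_endo; [exact: lf_Er L|exact: lf_Er L'|case=> [g|]] => /=; last first.
  rewrite (lf_rS L) (lf_rS L'); apply: transferD; first exact: transferZ trS.
  by apply: transfer_sum => g; apply: transferZ; apply: transferM; exact: trT.
(* The structure constants describe al_g(rho(T_g)), so rho(T_g) is recovered by al_{-g}. *)
have e : rho (T g) = al (- g) (al g (rho (T g))) by rewrite (alNK L).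
have e' : rho' (T' g) = al' (- g) (al' g (rho' (T' g))) by rewrite (alNK L').
rewrite e e'; apply: tr_al; rewrite (lf_rT L) (lf_rT L').
apply: transferD; first apply: transferD.
- apply: transferZ; apply: transferM; last exact: transferV trS.
  by apply: transferM; [exact: trT|exact: trS].
- by apply: transferZ; apply: transferM; [exact: trS|exact: transferV (trT g)].
- apply: transfer_sum => h; apply: transfer_sum => k; apply: transferZ.
  apply: transferM; last exact: transferV (trT _).
  by apply: transferM; exact: trT.
Qed.

Let tr_wd w x x' : tr x x' -> tr (wo w x) (wo' w x').
Proof.
move=> h; rewrite /wd /=; apply: tr_al; elim: w.2 => //= m IH; exact: tr_rho.
Qed.

Let ew w : star_endo (wo w). Proof. exact: wd_endo L w. Qed.
Let ew' w : star_endo (wo' w). Proof. exact: wd_endo L' w. Qed.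

Let tr_hom w v X : (v.2 <= 1)%N -> hom (wo w) (wo v) X ->
  exists2 X', tr X X' & hom (wo' w) (wo' v) X'.
Proof.
pose Q w v X := hom (wo w) (wo v) X /\ exists2 X', tr X X' & hom (wo' w) (wo' v) X'.
move=> hv hX; suff: Q w v X by case.
apply: (word_hom_ind L HM (Q := Q)) hv hX.
- move=> u; split; first exact: hom1.
  by exists 1; [exact: transfer1|exact: hom1].
- move=> u z c Y Z [h1 [Y' t1 k1]] [h2 [Z' t2 k2]]; split; first exact: homL.
  by exists (c *: Y' + Z'); [exact: transfer_lin|exact: homL].
- move=> u z u' Y Z [h1 [Y' t1 k1]] [h2 [Z' t2 k2]]; split; first exact: homM h1 h2.
  by exists (Z' * Y'); [exact: transferM|exact: homM k1 k2].
- move=> u z; split; first exact: hom0.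
  by exists 0; [exact: transfer0|exact: hom0].
- move=> u z Y h [_ [Y' t1 k1]]; split; first exact: homV h.
  by exists (st Y'); [exact: transferV|exact: homV k1].
- move=> g m; split; first exact: (wd_S L).
  by exists (wo' (g, m) S'); [exact: tr_wd|exact: (wd_S L')].
- move=> g m h; split; first exact: (wd_T L).
  by exists (wo' (g, m) (T' h)); [exact: tr_wd|exact: (wd_T L')].
Qed.

(** The transfer isomorphism as a function, 0 outside its domain; [known] marks the domain. *)
Let phi_exists : {phi : M -> M | forall x x', tr x x' -> phi x = x'}.
Proof.
apply: cid; have H x : exists z, forall x', tr x x' -> z = x'.
  have [[z hz]|n] := pselect (exists z, tr x z); last first.
    by exists 0 => x' h; case: n; exists x'.
  by exists z => x'; exact: tr_uniq.
by have [phi hphi] := choice H; exists phi.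
Qed.
Let phi : M -> M := sval phi_exists.
Let phiE x x' : tr x x' -> phi x = x'. Proof. exact: (svalP phi_exists). Qed.

Let known X := tr X (phi X).
Let knownI X X' : tr X X' -> known X. Proof. by move=> h; rewrite /known (phiE h). Qed.

Let phiM X Y : known X -> known Y -> phi (X * Y) = phi X * phi Y /\ known (X * Y).
Proof. by move=> h h'; have e := transferM h h'; split; [exact: phiE|exact: knownI e]. Qed.
Let phiV X : known X -> phi (st X) = st (phi X) /\ known (st X).
Proof. by move=> h; have e := transferV h; split; [exact: phiE|exact: knownI e]. Qed.
Let phi_sum (I : finType) (X : I -> M) : (forall i, known (X i)) ->
  phi (\sum_i X i) = \sum_i phi (X i).
Proof. by move=> h; apply: phiE; apply: transfer_sum. Qed.
Let phi_wd w X : known X -> phi (wo w X) = wo' w (phi X) /\ known (wo w X).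
Proof. by move=> h; have e := tr_wd w h; split; [exact: phiE|exact: knownI e]. Qed.

Let hom_known w v X : (v.2 <= 1)%N -> hom (wo w) (wo v) X ->
  known X /\ hom (wo' w) (wo' v) (phi X).
Proof.
by move=> hv /(tr_hom hv) [X' h1 h2]; rewrite (phiE h1); split=> //; exact: knownI h1.
Qed.

Let phi_simple w v X : (w.2 <= 1)%N -> (v.2 <= 1)%N -> hom (wo w) (wo v) X -> phi X = X.
Proof.
move=> hw hv /(wd_simple_hom L HM hw hv) [c ->]; apply: phiE; apply: transferZ.
by case: eqP => _; [exact: transfer1|exact: transfer0].
Qed.

Let hom_simple w v X : (w.2 <= 1)%N -> (v.2 <= 1)%N ->
  hom (wo w) (wo v) X <-> hom (wo' w) (wo' v) X.
Proof.
move=> hw hv; split=> [/(wd_simple_hom L HM hw hv)|/(wd_simple_hom L' HM hw hv)] [c ->].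
- by apply: homZ => //; case: eqP => [->|_]; [exact: hom1|exact: hom0].
- by apply: homZ => //; case: eqP => [->|_]; [exact: hom1|exact: hom0].
Qed.

Let res_exists : {r : (M -> M) -> {n & (('I_n -> word G) * ('I_n -> M))%type} |
  forall s, C s -> resolution al rho s (projT2 (r s)).1 (projT2 (r s)).2}.
Proof.
apply: cid; have H s : exists r : {n & (('I_n -> word G) * ('I_n -> M))%type},
    C s -> resolution al rho s (projT2 r).1 (projT2 r).2.
  have [cs|ncs] := pselect (C s).
    by have [n [W [V r]]] := resolution_exists L cs; exists (existT _ n (W, V)).
  by exists (existT _ 0%N (fun=> (0, 0%N), fun=> 0)).
by have [r rP] := choice H; exists r.
Qed.
Let res := sval res_exists.
Let W s i := (projT2 (res s)).1 i.
Let V s i := (projT2 (res s)).2 i.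
Arguments W : clear implicits.
Arguments V : clear implicits.
Let resP s : C s -> resolution al rho s (W s) (V s).
Proof. exact: (svalP res_exists). Qed.

Section Obj.
Variable s : M -> M.
Hypothesis cs : C s.
Lemma res_size i : ((W s i).2 <= 1)%N. Proof. by case: (resP cs). Qed.
Lemma res_hom i : hom (wo (W s i)) s (V s i). Proof. by case: (resP cs). Qed.
Lemma res_orth i j : st (V s i) * V s j = if i == j then 1 else 0.
Proof. by case: (resP cs). Qed.
Lemma res_sum1 : \sum_i V s i * st (V s i) = 1. Proof. by case: (resP cs). Qed.
Lemma res_complete : complete_family (V s). Proof. split; [exact: res_orth|exact: res_sum1]. Qed.
End Obj.

Definition tf_obj s : M -> M := sum_endo (V s) (fun i => wo' (W s i)).
Local Notation ob := tf_obj.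

Lemma tf_obj_obj s : C s -> C (ob s).
Proof. by move=> cs; apply: sum_endo_obj (res_complete cs) _ => i; exact: wd_obj L' _. Qed.
Lemma tf_obj_endo s : C s -> star_endo (ob s).
Proof. by move=> /tf_obj_obj /obj_endo. Qed.

Lemma tf_V s i : C s -> hom (wo' (W s i)) (ob s) (V s i).
Proof. by move=> cs; exact: (@sum_endo_hom _ _ _ _ (fun i => wo' (W s i)) i (res_complete cs)). Qed.

(* The functor maps s = \sum_i V_i (wo (W i) _) V_i^* to the same expression with
   wo' for wo; it acts on morphisms by the identity between simple words, hence by
   phi on components of morphisms out of longer words. *)
Definition tf_word s X : M := \sum_i V s i * phi (st (V s i) * X).
Local Notation ft := tf_word.

Lemma res_hom_comp w s X i : C s -> hom (wo w) s X -> hom (wo w) (wo (W s i)) (st (V s i) * X).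
Proof. by move=> cs hX; apply: homM hX (homV (ew _) (obj_endo cs) (res_hom cs i)). Qed.

Lemma tf_word_known w s X i : C s -> hom (wo w) s X -> known (st (V s i) * X).
Proof. by move=> cs hX; case: (hom_known (res_size cs i) (res_hom_comp i cs hX)). Qed.

Lemma tf_word_hom w s X : C s -> hom (wo w) s X -> hom (wo' w) (ob s) (ft s X).
Proof.
move=> cs hX; apply: hom_sum => i; apply: homM (tf_V i cs).
by case: (hom_known (res_size cs i) (res_hom_comp i cs hX)).
Qed.

Lemma tf_word_proj s X i : C s -> st (V s i) * ft s X = phi (st (V s i) * X).
Proof.
move=> cs; rewrite mulr_sumr (bigD1 i) //= big1 => [|j nj].
  by rewrite mulrA (res_orth cs) eqxx mul1r addr0.
by rewrite mulrA (res_orth cs) eq_sym (negPf nj) mul0r.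
Qed.

Lemma tf_word_simple w s X : C s -> (w.2 <= 1)%N -> hom (wo w) s X -> ft s X = X.
Proof.
move=> cs hw hX; rewrite -[RHS]mul1r -(res_sum1 cs) mulr_suml; apply: eq_bigr => i _.
by rewrite (phi_simple hw (res_size cs i) (res_hom_comp i cs hX)) mulrA.
Qed.

(** Transport fixes morphisms out of simple words, so each X V_i intertwines the new objects as
    well, and the V_i are complete. *)
Lemma tf_hom s t X : C s -> C t -> hom s t X -> hom (ob s) (ob t) X.
Proof.
move=> cs ct hX z; apply: (complete_ext (res_sum1 cs)) => i.
have h : hom (wo (W s i)) t (X * V s i) by apply: homM (res_hom cs i) hX.
have := tf_word_hom ct h; rewrite (tf_word_simple ct (res_size cs i) h) => h'.
by rewrite -mulrA -(tf_V i cs) mulrA h' mulrA.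
Qed.

Lemma tf_word_comp w s t X Y : C s -> C t -> hom s t X -> hom (wo w) s Y ->
  X * ft s Y = ft t (X * Y).
Proof.
move=> cs ct hX hY; apply: (complete_extl (res_sum1 ct)) => j; rewrite tf_word_proj //.
have hXV i : hom (wo (W s i)) t (X * V s i) by apply: homM (res_hom cs i) hX.
have -> : st (V t j) * (X * Y) = \sum_i (st (V t j) * (X * V s i)) * (st (V s i) * Y).
  rewrite -[Y in LHS]mul1r -(res_sum1 cs) mulr_suml !mulr_sumr.
  by apply: eq_bigr => i _; rewrite !mulrA.
have kn1 i := tf_word_known j ct (hXV i); have kn2 i := tf_word_known i cs hY.
rewrite phi_sum => [|i]; last by case: (phiM (kn1 i) (kn2 i)).
rewrite !mulr_sumr; apply: eq_bigr => i _; rewrite (phiM (kn1 i) (kn2 i)).1 !mulrA.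
congr (_ * _); rewrite -!mulrA.
by rewrite (phi_simple (res_size cs i) (res_size ct j) (res_hom_comp j ct (hXV i))).
Qed.

Lemma tf_wordM s X Y : C s -> (forall i, known (st (V s i) * X)) -> known Y ->
  ft s (X * Y) = ft s X * phi Y.
Proof.
move=> cs kX kY; rewrite /tf_word mulr_suml; apply: eq_bigr => i _.
by rewrite mulrA (phiM (kX i) kY).1 mulrA.
Qed.

Lemma tf_word_sum s (I : finType) (X : I -> M) : C s ->
  (forall i j, known (st (V s i) * X j)) -> ft s (\sum_j X j) = \sum_j ft s (X j).
Proof.
move=> cs k; rewrite /tf_word exchange_big; apply: eq_bigr => i _.
by rewrite mulr_sumr phi_sum // mulr_sumr.
Qed.

Lemma tf_word_dot s X Y : C s -> (forall i, known (st (V s i) * X)) ->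
  (forall i, known (st (V s i) * Y)) -> st (ft s X) * ft s Y = phi (st X * Y).
Proof.
move=> cs kX kY; have kX' i := (phiV (kX i)).2.
have -> : st X * Y = \sum_i st (st (V s i) * X) * (st (V s i) * Y).
  rewrite -[Y in LHS]mul1r -(res_sum1 cs) mulr_suml mulr_sumr; apply: eq_bigr => i _.
  by rewrite starM starK !mulrA.
rewrite phi_sum => [|i]; last by case: (phiM (kX' i) (kY i)).
rewrite {1}/tf_word star_sum mulr_suml; apply: eq_bigr => i _.
rewrite starM -mulrA tf_word_proj // (phiM (kX' i) (kY i)).1.
by rewrite (phiV (kX i)).1.
Qed.

Definition tf_mid s t (ij : 'I_(projT1 (res s)) * 'I_(projT1 (res t))) : M :=
  V s ij.1 * wo' (W s ij.1) (V t ij.2).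
Definition tf_pair s t (ij : 'I_(projT1 (res s)) * 'I_(projT1 (res t))) : M :=
  V s ij.1 * wo (W s ij.1) (V t ij.2).
Arguments tf_mid : clear implicits.
Arguments tf_pair : clear implicits.

Lemma pair_complete (I J : finType) (U : I -> M) (U' : J -> M) (f : I -> M -> M) :
  complete_family U -> complete_family U' -> (forall i, star_endo (f i)) ->
  complete_family (fun ij : I * J => U ij.1 * f ij.1 (U' ij.2)).
Proof.
move=> [UU U1] [UU' U1'] ef; split=> [[i j] [k l]|] /=.
  rewrite starM -mulrA (mulrA (st (U i))) UU xpair_eqE; case: eqP => [->|_] /=.
    rewrite mul1r -(endoS _ (ef k)) -(endoM _ _ (ef k)) UU'.
    by case: eqP => _; [exact: endo1|exact: endo0].
  by rewrite mul0r mulr0.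
rewrite -U1 -(pair_bigA _ (fun i j => U i * f i (U' j) * st (U i * f i (U' j)))) /=.
apply: eq_bigr => i _.
transitivity (U i * f i (\sum_j U' j * st (U' j)) * st (U i)).
  rewrite (endo_sum _ _ _ (ef i)) mulr_sumr mulr_suml; apply: eq_bigr => j _.
  by rewrite starM (endoM _ _ (ef i)) (endoS _ (ef i)) !mulrA.
by rewrite U1' (endo1 (ef i)) mulr1.
Qed.

(** [tf_pair] resolves the product of s and t by words with up to two [rho] in the old lifting;
    [tf_mid] resolves the product of their images by the same words in the new one. The tensorator
    matches the second with the transport of the first. *)
Definition tf_ten s t : M :=
  \sum_(ij : 'I_(projT1 (res s)) * 'I_(projT1 (res t)))
    ft (s \o t) (tf_pair s t ij) * st (tf_mid s t ij).

Lemma tf_mid_c s t : C s -> C t -> complete_family (tf_mid s t).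
Proof.
move=> cs ct.
exact: (@pair_complete _ _ (V s) (V t) (fun i => wo' (W s i)) (res_complete cs) (res_complete ct) (fun i => ew' _)).
Qed.
Lemma tf_pair_c s t : C s -> C t -> complete_family (tf_pair s t).
Proof.
move=> cs ct.
exact: (@pair_complete _ _ (V s) (V t) (fun i => wo (W s i)) (res_complete cs) (res_complete ct) (fun i => ew _)).
Qed.

Lemma tf_mid_hom s t ij : C s -> C t ->
  hom (wo' (wmul (W s ij.1) (W t ij.2))) (ob s \o ob t) (tf_mid s t ij).
Proof.
by move=> cs ct; rewrite -(wd_mul L'); apply: homT => //; exact: tf_V.
Qed.
Lemma tf_pair_hom s t ij : C s -> C t ->
  hom (wo (wmul (W s ij.1) (W t ij.2))) (s \o t) (tf_pair s t ij).
Proof.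
by move=> cs ct; rewrite -(wd_mul L); apply: homT => //; exact: res_hom.
Qed.

Lemma tf_ten_mid s t ij : C s -> C t ->
  tf_ten s t * tf_mid s t ij = ft (s \o t) (tf_pair s t ij).
Proof.
move=> cs ct; have [MM _] := tf_mid_c cs ct.
rewrite mulr_suml (bigD1 ij) //= big1 => [|kl nkl].
  by rewrite -mulrA MM eqxx mulr1 addr0.
by rewrite -mulrA MM (negPf nkl) mulr0.
Qed.

(** The defining property of the tensorator, extended to all morphisms out of words. Naturality,
    associativity and the unit laws reduce to it on complete families. *)
Lemma tf_ten_word w v s t X Y : C s -> C t -> hom (wo w) s X -> hom (wo v) t Y ->
  tf_ten s t * (ft s X * wo' w (ft t Y)) = ft (s \o t) (X * wo w Y).
Proof.
move=> cs ct hX hY; have cst := obj_comp cs ct.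
have e : X * wo w Y = \sum_(ij : 'I_(projT1 (res s)) * 'I_(projT1 (res t)))
    tf_pair s t ij * (wo (W s ij.1) (st (V t ij.2) * Y) * (st (V s ij.1) * X)).
  have [_ P1] := tf_pair_c cs ct.
  rewrite -[LHS]mul1r -P1 mulr_suml; apply: eq_bigr => -[i j] _ /=.
  rewrite -mulrA; congr (_ * _); rewrite starM -(endoS _ (ew _)) (endoM _ _ (ew _)).
  rewrite -!mulrA; congr (_ * _).
  by rewrite (mulrA (st (V s i)) X) (res_hom_comp i cs hX Y).
have kp i ij : known (st (V (s \o t) i) * tf_pair s t ij).
  exact: tf_word_known cst (tf_pair_hom ij cs ct).
have kY i := tf_word_known i ct hY; have kX i := tf_word_known i cs hX.
have kq ij : known (wo (W s ij.1) (st (V t ij.2) * Y) * (st (V s ij.1) * X)).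
  by case: (phiM (phi_wd (W s ij.1) (kY ij.2)).2 (kX ij.1)).
rewrite e tf_word_sum => [|//|i ij]; last by rewrite mulrA; case: (phiM (kp i ij) (kq ij)).
rewrite /tf_ten mulr_suml; apply: eq_bigr => -[i j] _.
rewrite (tf_wordM cst) // -mulrA; congr (_ * _).
rewrite /tf_mid /= starM -(endoS _ (ew' _)) -mulrA (mulrA (st (V s i))) tf_word_proj //.
have [_ hphi] := hom_known (res_size cs i) (res_hom_comp i cs hX).
rewrite hphi mulrA -(endoM _ _ (ew' _)) tf_word_proj //.
by rewrite (phiM (phi_wd (W s i) (kY j)).2 (kX i)).1 (phi_wd (W s i) (kY j)).1.
Qed.

Lemma wo_nil : wo (0, 0%N) = idfun.
Proof. by rewrite -[LHS]/(al 0 \o idfun) (lf_0 L). Qed.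
Lemma wo_nil' : wo' (0, 0%N) = idfun.
Proof. by rewrite -[LHS]/(al' 0 \o idfun) (lf_0 L'). Qed.

Lemma tf_word_obj w : (w.2 <= 1)%N -> ob (wo w) = wo' w.
Proof.
move=> hw; have cw := wd_obj L w; apply/funext => z.
have := tf_word_hom cw (hom1 (wo w)); rewrite (tf_word_simple cw hw (hom1 _)).
by move=> /(_ z); rewrite mul1r mulr1.
Qed.

Definition tf_data : autoeq_data M := AutoeqData ob (fun _ _ X => X) tf_ten 1.

Lemma tf_ax : is_autoeq C tf_data.
Proof.
have obi : ob idfun = idfun by have := tf_word_obj (w := (0, 0%N)) isT; rewrite wo_nil wo_nil'.
split=> //=.
- exact: tf_obj_obj.
- by move=> s t X; exact: tf_hom.
- move=> s t X cs ct hX; exists X => // z.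
  apply: (complete_ext (res_sum1 cs)) => i; apply: (complete_extl (res_sum1 ct)) => j.
  have h : hom (wo (W s i)) (wo (W t j)) (st (V t j) * (X * V s i)).
    apply/(hom_simple _ (res_size cs i) (res_size ct j)).
    apply: homM (homV (ew' _) (tf_obj_endo ct) (tf_V j ct)).
    by apply: homM (tf_V i cs) hX.
  have := h z; rewrite -!mulrA -(res_hom cs i z) !(mulrA X) => ->.
  by rewrite !mulrA (homV (ew _) (obj_endo ct) (res_hom ct j) z).
(* t is resolved in the new lifting and the new words are replaced by the old ones; the resulting s
   has image equal to t. *)
- move=> t ct; have [n [W' [V' [W1 hV' VV' V1']]]] := resolution_exists L' ct.
  have cV' : complete_family V' by split.
  pose s := sum_endo V' (fun i => wo (W' i)).
  have cs : C s by apply: sum_endo_obj cV' _ => i; exact: wd_obj L _.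
  have hs i : hom (wo (W' i)) s (V' i) by exact: (@sum_endo_hom _ _ _ _ (fun i => wo (W' i)) i cV').
  exists s => //; have -> : ob s = t; last exact: iso_refl.
  rewrite (sum_endo_uniq cV' hV'); apply: (sum_endo_uniq cV') => i.
  by have := tf_word_hom cs (hs i); rewrite (tf_word_simple cs (W1 i) (hs i)).
- move=> s t cs ct; have cst := obj_comp cs ct; apply: hom_sum => ij.
  apply: homM (homV _ _ (tf_mid_hom ij cs ct)) (tf_word_hom cst (tf_pair_hom ij cs ct)) => //.
  by apply: endo_comp; exact: tf_obj_endo.
- move=> s t cs ct; have cst := obj_comp cs ct.
  have [MM M1] := tf_mid_c cs ct; have [PP P1] := tf_pair_c cs ct.
  have kp i ij : known (st (V (s \o t) i) * tf_pair s t ij).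
    exact: tf_word_known cst (tf_pair_hom ij cs ct).
  have ZZ ij kl : st (ft (s \o t) (tf_pair s t ij)) * ft (s \o t) (tf_pair s t kl) =
      if ij == kl then 1 else 0.
    rewrite tf_word_dot // PP; case: eqP => _; apply: phiE;
      [exact: transfer1|exact: transfer0].
  (* The transported pairs are complete because each matrix entry of their sum is phi of the
     corresponding entry for [tf_pair], whose sum is 1. *)
  have Z1 : \sum_ij ft (s \o t) (tf_pair s t ij) * st (ft (s \o t) (tf_pair s t ij)) = 1.
    apply: (complete_ext (res_sum1 cst)) => l; apply: (complete_extl (res_sum1 cst)) => k.
    rewrite mul1r (res_orth cst) mulr_suml mulr_sumr.
    have kq i ij := (phiV (kp i ij)).2.
    transitivity (phi (\sum_ij (st (V (s \o t) k) * tf_pair s t ij) *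
        st (st (V (s \o t) l) * tf_pair s t ij))).
      rewrite phi_sum => [|ij]; last by case: (phiM (kp k ij) (kq l ij)).
      apply: eq_bigr => ij _; rewrite (phiM (kp k ij) (kq l ij)).1 (phiV (kp l ij)).1.
      by rewrite -tf_word_proj // -tf_word_proj // starM starK !mulrA.
    rewrite -[X in phi X](_ : st (V (s \o t) k) * V (s \o t) l = _).
      by rewrite (res_orth cst); case: eqP => _; apply: phiE; [exact: transfer1|exact: transfer0].
    rewrite -[V (s \o t) l in LHS]mul1r -P1 mulr_suml mulr_sumr; apply: eq_bigr => ij _.
    by rewrite starM starK !mulrA.
  split; rewrite /tf_ten star_sum mulr_suml.
    rewrite -M1; apply: eq_bigr => ij _; rewrite mulr_sumr (bigD1 ij) //= big1 => [|kl nkl].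
      move: (tf_mid s t ij) (ft _ _) (ZZ ij ij) => m z; rewrite eqxx => zz.
      by rewrite addr0 starM starK -!mulrA (mulrA (st z)) zz mul1r.
    move: (tf_mid s t ij) (tf_mid s t kl) (ft _ _) (ft _ _) (ZZ ij kl) => m m' z z'.
    rewrite eq_sym (negPf nkl) => zz.
    by rewrite starM starK -!mulrA (mulrA (st z')) zz mul0r !mulr0.
  rewrite -Z1; apply: eq_bigr => ij _; rewrite mulr_sumr (bigD1 ij) //= big1 => [|kl nkl].
    move: (tf_mid s t ij) (ft _ _) (MM ij ij) => m z; rewrite eqxx => mm.
    by rewrite addr0 starM starK -!mulrA (mulrA (st m)) mm mul1r.
  move: (tf_mid s t ij) (tf_mid s t kl) (ft _ _) (ft _ _) (MM ij kl) => m m' z z'.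
  rewrite eq_sym (negPf nkl) => mm.
  by rewrite starM starK -!mulrA (mulrA (st m)) mm mul0r !mulr0.
- move=> s s' t t' X Y cs cs' ct ct' hX hY.
  have cst := obj_comp cs ct; have cst' := obj_comp cs' ct'.
  apply: (complete_ext (tf_mid_c cs ct).2) => -[i j].
  have hXV : hom (wo (W s i)) s' (X * V s i) by apply: homM (res_hom cs i) hX.
  have hYV : hom (wo (W t j)) t' (Y * V t j) by apply: homM (res_hom ct j) hY.
  rewrite -mulrA tf_ten_mid // (tf_word_comp cst cst' (homT (obj_endo cs) hX hY) (tf_pair_hom _ cs ct)).
  rewrite -(mulrA (tf_ten _ _)); have -> : X * ob s Y * tf_mid s t (i, j) = (X * V s i) * wo' (W s i) (Y * V t j).
    rewrite /tf_mid /= (endoM _ _ (ew' _)) -!mulrA; congr (_ * _).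
    by rewrite !mulrA -(tf_V i cs).
  rewrite -(tf_word_simple cs' (res_size cs i) hXV) -(tf_word_simple ct' (res_size ct j) hYV).
  rewrite (tf_ten_word cs' ct' hXV hYV); congr (ft _ _).
  rewrite /tf_pair /= (endoM _ _ (ew _)) -!mulrA; congr (_ * _).
  by rewrite !mulrA -(res_hom cs i).
- move=> s t k cs ct ck; have cst := obj_comp cs ct; have ctk := obj_comp ct ck.
  have [_ K1] := @pair_complete _ _ (tf_mid s t) (V k)
    (fun ij => wo' (wmul (W s ij.1) (W t ij.2))) (tf_mid_c cs ct) (res_complete ck) (fun ij => ew' _).
  apply: (complete_ext K1) => -[[i j] l] /=.
  have hP := tf_pair_hom (i, j) cs ct; have hQ := tf_pair_hom (j, l) ct ck.
  have eV : V k l = ft k (V k l) by rewrite (tf_word_simple ck (res_size ck l) (res_hom ck l)).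
  rewrite -mulrA (mulrA (tf_ten s t)) tf_ten_mid // {1}eV (tf_ten_word cst ck hP (res_hom ck l)).
  have -> : tf_ten s (t \o k) * ob s (tf_ten t k) *
      (tf_mid s t (i, j) * wo' (wmul (W s i) (W t j)) (V k l)) =
      tf_ten s (t \o k) * (V s i * wo' (W s i) (ft (t \o k) (tf_pair t k (j, l)))).
    rewrite -(mulrA (tf_ten s _)); congr (_ * _); rewrite -tf_ten_mid // -(wd_mul L').
    rewrite [tf_mid t k _]/tf_mid [tf_mid s t _]/tf_mid /= !(endoM _ _ (ew' _)).
    by rewrite -(mulrA (V s i)) mulrA -(tf_V i cs) !mulrA.
  have eVi : V s i = ft s (V s i) by rewrite (tf_word_simple cs (res_size cs i) (res_hom cs i)).
  rewrite {1}eVi (tf_ten_word cs ctk (res_hom cs i) hQ); congr (ft _ _).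
  by rewrite /tf_pair /= -(wd_mul L) /= (endoM _ _ (ew _)) mulrA.
- by rewrite obi; exact: hom1.
- exact: unitary1.
- move=> s cs; rewrite mulr1; apply: (complete_ext (res_sum1 cs)) => i; rewrite mul1r.
  have ci := obj_id C; have h1 : hom (wo (0, 0%N)) (@idfun M) 1 by rewrite wo_nil; exact: hom1.
  have := tf_ten_word ci cs h1 (res_hom cs i); rewrite !(tf_word_simple _ _ h1) //.
  rewrite (tf_word_simple cs (res_size cs i) (res_hom cs i)) wo_nil wo_nil' !mul1r /=.
  by rewrite -[idfun \o s]/s (tf_word_simple cs (res_size cs i) (res_hom cs i)).
- move=> s cs; rewrite (endo1 (tf_obj_endo cs)) mulr1.
  apply: (complete_ext (res_sum1 cs)) => i; rewrite mul1r.
  have ci := obj_id C; have h1 : hom (wo (0, 0%N)) (@idfun M) 1 by rewrite wo_nil; exact: hom1.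
  have := tf_ten_word cs ci (res_hom cs i) h1; rewrite !(tf_word_simple _ _ h1) //.
  rewrite (tf_word_simple cs (res_size cs i) (res_hom cs i)) (endo1 (ew _)) (endo1 (ew' _)) !mulr1.
  by rewrite -[s \o idfun]/s (tf_word_simple cs (res_size cs i) (res_hom cs i)).
Qed.

Lemma transfer_functor : exists F : autoeq C,
  graded_frames F (fun g => Frame (al g) (al' g) 1) (fun _ _ => 1) /\
  frame_ok F (Frame rho rho' 1).
Proof.
exists (Autoeq tf_ax); have ea g : ob (al g) = al' g := @tf_word_obj (g, 0%N) isT.
have er : ob rho = rho'.
  have e : wo (0, 1%N) = rho by rewrite -[LHS]/(al 0 \o rho) (lf_0 L).
  have e' : wo' (0, 1%N) = rho' by rewrite -[LHS]/(al' 0 \o rho') (lf_0 L').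
  by rewrite -e -e'; exact: tf_word_obj.
have ft1 g : ft (al g) 1 = 1.
  exact: (tf_word_simple (w := (g, 0%N)) (lf_Cal L g) isT (hom1 _)).
have ten1 g h : tf_ten (al g) (al h) = 1.
  have := @tf_ten_word (g, 0%N) (h, 0%N) _ _ 1 1 (lf_Cal L g) (lf_Cal L h) (hom1 _) (hom1 _).
  rewrite !ft1 !(endo1 (ew _)) !(endo1 (ew' _)) !mulr1 -(lf_D L) => ->.
  exact: ft1.
split; last first.
  split=> /=; [exact: lf_Crho L|exact: lf_Er L'|rewrite er; exact: hom1|exact: unitary1].
split=> [g|g h|g h]; last 1 first.
- rewrite fscale1 /ften /= ten1 ea (endo1 (lf_Ear L' g)) st1 !mulr1.
  by rewrite (lf_D L) (lf_D L').
- split=> /=; [exact: lf_Cal L g|exact: lf_Ear L' g|rewrite ea; exact: hom1|exact: unitary1].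
- by rewrite normr1.
Qed.

End Functor.

(** * Cocycle perturbations *)

Section Perturbation.
Variables (R : realType) (M : starAlg R) (C : fusionCat M) (G : finZmodType).
Local Notation st := (@star R M).
Implicit Types (g h a b : G) (s t : M -> M).

(** The isometries come from a direct sum of |G| copies of the unit object. *)
Lemma complete_family_exists : exists V : G -> M, complete_family V.
Proof.
have nG : #|G| = #|G|.-1.+1 by rewrite prednK //; apply/card_gt0P; exists 0.
have [k _ [V [VV V1] _]] := ord_sum_exists (fun _ : 'I_#|G|.-1.+1 => obj_id C).
pose r g := cast_ord nG (enum_rank g).
have rI : bijective r.
  exists (fun i => enum_val (cast_ord (esym nG) i)) => [g|i].
    by rewrite /r cast_ordK enum_rankK.
  by rewrite /r enum_valK cast_ordKV.
exists (V \o r); split=> [g h|/=].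
  by rewrite VV (inj_eq (bij_inj rI)).
by rewrite -V1 [RHS](reindex r) //; exact: onW_bij.
Qed.

Lemma iso_classes (al al' : G -> M -> M) rho rho' :
  (forall g, star_endo (al' g)) -> star_endo rho' ->
  (forall g, iso (al g) (al' g)) -> iso rho rho' ->
  simple_classes C al rho -> simple_classes C al' rho'.
Proof.
move=> ea' er' ia ir [[ca cr] cl i j n].
have ea g := obj_endo (ca g); have er := obj_endo cr.
have ca' g : C (al' g) := obj_replete (ca g) (ea' g) (ia g).
have iar g : iso (al g \o rho) (al' g \o rho') by exact: iso_ten.
have ear g : star_endo (al g \o rho) by exact: endo_comp.
have ear' g : star_endo (al' g \o rho') by exact: endo_comp.
have ia' g : iso (al' g) (al g) by exact: iso_sym.
have iar' g : iso (al' g \o rho') (al g \o rho) by exact: iso_sym.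
split.
- by split=> //; exact: obj_replete cr er' ir.
- move=> s cs; apply: (iff_trans (cl s cs)).
  by split=> -[[g hg]|[g hg]]; [left|right|left|right]; exists g;
     apply: iso_trans hg.
- by move=> g h e; apply: i; apply: iso_trans (ia g) (iso_trans e _).
- by move=> g h e; apply: j; apply: iso_trans (iar g) (iso_trans e _).
- by move=> g h e; apply: (n g h); apply: iso_trans (ia g) (iso_trans e _).
Qed.

Variable V : G -> M.
Hypothesis cV : complete_family V.

(** A monomial matrix with respect to V, twisted by s: the a-th summand goes to the r(a)-th with
    coefficient f(a). *)
Definition pert s (f : G -> R[i]) (r : G -> G) : M :=
  \sum_a f a *: (V (r a) * s (st (V a))).

Lemma pert_mul s t f f' r r' : star_endo s ->
  pert s f r * s (pert t f' r') =
  pert (s \o t) (fun a => f (r' a) * f' a) (r \o r').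
Proof.
move=> es; rewrite /pert (endo_sum _ _ _ es) mulr_sumr; apply: eq_bigr => b _.
rewrite mulr_suml (bigD1 (r' b)) //= big1 ?addr0 => [|a na].
  rewrite (endoZ _ _ es) -scalerAl -scalerAr scalerA; congr (_ *: _).
  by rewrite -mulrA -(endoM _ _ es) mulrA cV.1 eqxx mul1r.
rewrite (endoZ _ _ es) -scalerAl -scalerAr -mulrA -(endoM _ _ es) mulrA.
by rewrite cV.1 (negPf na) mul0r (endo0 es) mulr0 !scaler0.
Qed.

Lemma pert_unitary s f r : star_endo s -> injective r -> (forall a, `|f a| = 1) ->
  unitary (pert s f r).
Proof.
move=> es ri f1; have [VV V1] := cV.
have eS : st (pert s f r) = \sum_a Num.conj (f a) *: (s (V a) * st (V (r a))).
  by rewrite star_sum; apply: eq_bigr => a _; rewrite starZ starM -(endoS _ es) starK.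
split; rewrite eS mulr_suml.
- rewrite -[RHS](endo1 es) -V1 (endo_sum _ _ _ es); apply: eq_bigr => a _.
  rewrite mulr_sumr (bigD1 a) //= big1 ?addr0 => [|b nb].
    rewrite -scalerAl -scalerAr scalerA unit_conjl // scale1r -mulrA.
    by rewrite (mulrA (st (V _))) VV eqxx mul1r (endoM _ _ es).
  rewrite -scalerAl -scalerAr -mulrA (mulrA (st (V _))) VV (inj_eq ri) eq_sym.
  by rewrite (negPf nb) mul0r mulr0 !scaler0.
- rewrite -[RHS]V1 [RHS](reindex_inj ri); apply: eq_bigr => a _.
  rewrite mulr_sumr (bigD1 a) //= big1 ?addr0 => [|b nb].
    rewrite -scalerAl -scalerAr scalerA unit_conj // scale1r -mulrA.
    by rewrite (mulrA (s _)) -(endoM _ _ es) VV eqxx (endo1 es) mul1r.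
  rewrite -scalerAl -scalerAr -mulrA (mulrA (s _)) -(endoM _ _ es) VV eq_sym.
  by rewrite (negPf nb) (endo0 es) mul0r mulr0 !scaler0.
Qed.

End Perturbation.

Section Realization.
Variables (R : realType) (M : starAlg R) (C : fusionCat M) (G : finZmodType).
Local Notation st := (@star R M).
Implicit Types (g h a b : G) (s : M -> M).

(** u is the om-twisted regular representation of G and w is inversion weighted by K. The exchange
    relation holds since K is a character and om is invariant under negating both arguments. The
    frames are over the identity functor; only their targets are perturbed. *)
Lemma realize_coefficients (al : G -> M -> M) (rho : M -> M) (S : M) (T : G -> M)
    (y : ldata R G) (om : G -> G -> R[i]) (K : G -> R[i]) :
  lift C al rho S T y -> normalized_cocycle om -> (forall g, `|K g| = 1) ->
  (forall g h, K (g + h) = K g * K h) ->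
  exists (u : G -> M) (w : M), let F := ae_one C in
    let A g := Frame (al g) (fun z => u g * al g z * st (u g)) (u g) in
    let P := Frame rho (fun z => w * rho z * st w) w in
    [/\ graded_frames F A om, A 0 = fone F, frame_ok F P,
        forall h, ften F P (A h) = fscale (K h) (ften F (A (- h)) P) &
        simple_classes C (fun g => ftgt (A g)) (ftgt P)].
Proof.
move=> L oN K1 KM; have [[o1 oA] _ _ _] := oN; have [V cV] := complete_family_exists C G.
have ea g : star_endo (al g) by exact: lf_Ear L g.
have er : star_endo rho by exact: lf_Er L.
pose u g := pert V (al g) (om g) (+%R g); pose w := pert V rho K -%R.
have uu g : unitary (u g) by apply: pert_unitary => //; exact: addrI.
have uw : unitary w by apply: pert_unitary => //; exact: oppr_inj.
exists u, w => F A P.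
have okf s v : C s -> unitary v -> frame_ok F (Frame s (fun z => v * s z * st v) v).
  move=> cs uv; split=> //=; first exact: endo_Ad (obj_endo cs) uv.
  by move=> z; rewrite -!mulrA uv.1 mulr1.
have hA g : frame_ok F (A g) by apply: okf => //; exact: lf_Cal L g.
have hP : frame_ok F P by apply: okf => //; exact: lf_Crho L.
have uD g h : u g * al g (u h) = om g h *: u (g + h).
  rewrite pert_mul // -(lf_D L) /u /pert scaler_sumr; apply: eq_bigr => a _ /=.
  by rewrite addrA mulrC oA scalerA.
have wu h : w * rho (u h) = K h *: (u (- h) * al (- h) w).
  rewrite !pert_mul // (lf_rho L) opprK /pert scaler_sumr; apply: eq_bigr => a _ /=.
  rewrite opprD scalerA KM (nc_NN oN) mulrAC -!mulrA.
  by congr (_ *: _); rewrite mulrA mulrC.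
have u0 : u 0 = 1.
  rewrite /u /pert -cV.2; apply: eq_bigr => a _.
  by rewrite (nc_0l oN) scale1r add0r (lf_0 L).
have tgt s v v' z : star_endo s ->
    v * s (v' * z * st v') * st v = v * s v' * s z * st (v * s v').
  by move=> es; rewrite !(endoM _ _ es) starM (endoS _ es) !mulrA.
have tgtZ (c : R[i]) (v z : M) : `|c| = 1 -> (c *: v) * z * st (c *: v) = v * z * st v.
  by move=> c1; rewrite starZ -!scalerAl -scalerAr scalerA unit_conj // scale1r.
split=> //.
- split=> // g h; rewrite /ften /fscale /A /=; congr Frame; first by rewrite (lf_D L).
    by apply/funext => z /=; rewrite tgt // uD tgtZ // (lf_D L).
  by rewrite st1 mulr1 uD.
- rewrite /A u0 /fone /= st1 (lf_0 L); congr Frame; apply/funext => z.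
  by rewrite mul1r mulr1.
- move=> h; rewrite /ften /fscale /A /P /=; congr Frame.
  + by rewrite (lf_rho L) opprK.
  + apply/funext => z /=; rewrite !tgt // wu tgtZ //.
    by have /(congr1 (fun f => f z)) /= -> := lf_rho L (- h); rewrite opprK.
  + by rewrite !st1 !mulr1 wu.
- apply: iso_classes (lf_cls L) => [g||g|]; try exact: iso_Ad.
    exact: endo_Ad.
  exact: endo_Ad.
Qed.

End Realization.

(** * From a solution of the system to an autoequivalence *)

Section RealizeSystem.
Variables (R : realType) (M : starAlg R) (C : fusionCat M) (G : finZmodType).
Hypothesis HM : hyperfinite_III1_factor M.
Local Notation st := (@star R M).
Implicit Types (g h a b : G) (s : M -> M).
Local Infix "\*" := ae_mul (at level 40, left associativity).

Lemma frame_adj s (v : M) : C s -> unitary v ->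
  frame_ok (ae_one C) (Frame (fun z => v * s z * st v) s (st v)).
Proof.
move=> cs uv; have es := obj_endo cs; split=> /=; last exact: unitaryV.
- by apply: (obj_replete cs); [exact: endo_Ad|exact: iso_Ad].
- exact: es.
- by move=> z; rewrite !mulrA uv.1 mul1r.
Qed.

(** Read in this direction, the system says that shift, perturbation by the inverse cocycle and
    rescaling lead to the relabelled data. *)
Lemma system_ldata (x : numdata R G) c om p tau K (t : {perm G}) :
  normalized_cocycle om -> system om p tau K (relabel_data t x) x ->
  rescale_ldata tau (twist (fun g h => (om g h)^-1) K (std_ldata (shift_data p x) c)) =
  std_ldata (relabel_data t x) c.
Proof.
move=> oN [[t1 K1 KM tK] E1 E2 E3]; have [[o1 _] _ _ _] := oN.
have on g h : om g h != 0 by exact: unit_neq0.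
have tn g : tau g != 0 by exact: unit_neq0.
have back g h : om (g + h *+ 2) (- h) = (om (g + h) h)^-1.
  by rewrite mulr2n addrA (nc_back _ _ oN).
have cV g h : Num.conj (om g h)^-1 = om g h.
  by rewrite conj_unit ?invrK // normfV o1 invr1.
have ct g : Num.conj (tau g) = (tau g)^-1 by exact: conj_unit.
have cg g : tw_c (fun g h => (om g h)^-1) K g = K g.
  by rewrite /tw_c (nc_N oN) invr1 mulr1.
rewrite /rescale_ldata /twist /std_ldata /=; congr Ldata.
- apply/funext => h; apply/funext => g.
  rewrite [RHS]E1 cV back invrK ct /=.
  by rewrite -!mulrA; congr (_ * _); field; rewrite !tn.
- apply/funext => g; rewrite cg ct -tK -mulrA exprVn divff ?mulr1 //.
  exact: expf_neq0.
- by apply/funext => g; rewrite -E2.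
- apply/funext => g; rewrite cg (conj_unit (K1 g)) -tK -[eta x ((t^-1)%g g)]/(eta (relabel_data t x) g).
  by rewrite E2 -mulrA mulVf ?mulr1 // expf_neq0.
- apply/funext => g; apply/funext => h; apply/funext => k.
  rewrite [RHS]E3 cV !ct (nc_N oN) /=.
  have e1 : om (g + h + k) (- h) = (om (g + k) h)^-1 by rewrite addrAC (nc_back _ _ oN).
  have e2 : om (g + h) (- g) = (om h g)^-1 by rewrite addrC (nc_back _ _ oN).
  by rewrite e1 e2 !invrK; field; rewrite !tn.
Qed.

Lemma describes_of_system (x : numdata R G) c al rho S T om p tau K (t : {perm G})
    (oC : cocycle om) (tD : {morph t : g h / g + h}) :
  (forall h g, eps x h g = 1 \/ eps x h g = -1) ->
  lift C al rho S T (std_ldata x c) ->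
  normalized_cocycle om -> system om p tau K (relabel_data t x) x ->
  exists F : autoeq C, describes al rho F (GammaRep p oC tD).
Proof.
move=> e1 L oN sys; have [[t1 K1 KM _] _ _ _] := sys.
have [o1 _] := oC; have on g h : om g h != 0 by exact: unit_neq0.
have L1 := shift_lift p e1 L.
(* The perturbing frames lead from the lifting to the perturbed one, whereas describing the functor
   requires the way back; taking adjoints inverts the cocycle again. *)
pose w g h := (om g h)^-1.
have wN : normalized_cocycle w.
  split=> [|g|g h|g h].
  - split=> [g h|g h k]; first by rewrite normfV o1 invr1.
    by rewrite /w -!invfM oC.2.
  - by rewrite /w (nc_0r oN) (nc_0l oN) (nc_N oN) invr1.
  - by rewrite /w (nc_opp oN g h) invrK mulVf.
  - by rewrite /w (nc_NN oN) conj_unit ?invrK ?mulVf // normfV o1 invr1.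
have [u [v [gA A0 hP PA cls]]] := realize_coefficients L1 wN K1 KM.
have L3 := rescale_lift t1 (twist_lift gA A0 hP K1 PA L1 cls).
rewrite (system_ldata c oN sys) in L3.
have [F [gF hF]] := transfer_functor (relabel_lift tD L) L3 HM.
have [hA _ AA] := gA; have [hB _ BB] := gF.
have uu g : unitary (u g) := ok_uni (hA g).
have uw : unitary v := ok_uni hP.
have cal g : C (al g) := lf_Cal L g.
pose A' g := Frame (fun z => u g * al g z * st (u g)) (al g) (st (u g)).
pose P' := Frame (fun z => v * (al p \o rho) z * st v) (al p \o rho) (st v).
have hA' g : frame_ok (ae_one C) (A' g) by exact: frame_adj.
have hP' : frame_ok (ae_one C) P'.
  by apply: frame_adj => //; exact: obj_comp (cal p) (lf_Crho L).
have AA' g h : ften (ae_one C) (A' g) (A' h) = fscale (om g h) (A' (g + h)).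
  have := AA g h; rewrite /ften /fscale /A' /= st1 !mulr1 => -[_ eA eu].
  congr Frame; [exact: eA|exact: esym (lf_D L g h)|].
  rewrite !mulrA (uu g).1 mul1r (endoS _ (obj_endo (cal g))) -starM eu starZ.
  by rewrite conj_unit ?invrK // normfV o1 invr1.
(* F is strict from the relabelled lifting to the perturbed one. The identity functor, framed by the
   adjoints, contributes om and brings the targets back to al_g and al_p rho. *)
exists (ae_one C \* F).
exists (fun g => fcomp (ae_one C) F (A' g) (Frame (al ((t^-1)%g g)) (fsrc (A' g)) 1)).
exists (fcomp (ae_one C) F P' (Frame rho (fsrc P') 1)); split.
- split=> [g|g h|g h].
  + exact: fcomp_ok (hB g) (hA' g) erefl.
  + exact: o1.
  + rewrite (fcomp_ten (hB g) (hB h) (hA' g) (hA' h) erefl erefl) AA' BB.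
    by rewrite (fcomp_scale _ _ (hB _) (hA' _) erefl) mulr1.
- by [].
- exact: fcomp_ok hF hP' erefl.
- by [].
Qed.

End RealizeSystem.

Theorem theorem5p10 (R : realType) (G : finZmodType)
    (M : starAlg R) (HM : hyperfinite_III1_factor M)
    (C : fusionCat M) (HC : generalized_haagerup C G)
    (x : numdata R G) (Hx : polynomial_equations x) (HCx : numerical_data C x)
    (HA : forall g h k : G, amp x g h k != 0) :
  exists f : Out C -> Gamma R G,
    [/\ {morph f : u v / (u * v)%g >-> (u * v)%g},
        injective f &
        forall ga : Gamma R G, (exists u : Out C, f u = ga) <-> Gamma0 x ga].
Proof.
have [rho [al [S [T [c L]]]]] := std_lift HM Hx HCx.
have [f [fM fI fE]] := out_reduction HM L (describes_one_trivial HM Hx HA L).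
exists f; split=> // ga; apply: (iff_trans (fE ga)); split=> [[F [d [dF <-]]]|[d [sd <-]]].
  have [d' [sd e]] := stabilizes_of_describes HM Hx L dF.
  by exists d'; split=> //; apply/pg_classP.
have [om [tau [K [coh oN sys]]]] := system_of_stabilizes sd; have [oC _ _ _] := oN.
have [F dF] := describes_of_system HM oC (@g_autP _ _ d) (pe_eps Hx) L oN sys.
(* The functor has point -q for a stabilizing triple with point q, and q = -q + 2q. *)
exists F, (GammaRep (- g_pt d) oC (@g_autP _ _ d)); split=> //; apply/pg_classP.
split=> //=; first exact: coh_sym.
by exists (g_pt d); rewrite mulr2n addrA addNr add0r.
Qed.
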